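(* Let $M,M_1,M_2$ be positive integers and let $\mathcal{A}\in\mathscr{A}_{2,M}$ be an operator of the form $$\mathcal{A}\mathbf{u}=\mathbf{A}_0\mathbf{u}+\mathbf{A}_1\langle \mathbf{B}_1\mathbf{u}\rangle_1+\mathbf{A}_2\langle \mathbf{B}_2\mathbf{u}\rangle_2+\mathcal{K}\mathbf{u},\qquad \mathbf{u}\in L^2_{2,M},$$ where $\mathcal{K}\in\mathscr{K}_{2,M}$ and $\mathbf{A}_0$, $\mathbf{A}_j$, $\mathbf{B}_j$ ($j=1,2$) are continuous complex matrix-valued functions on $[0,1]^2$ of sizes $M\times M$, $M\times M_j$, $M_j\times M$ respectively. Let $\mathbf{E}_0,\mathbf{E}_1,\mathbf{E}_2,\mathbf{C}_0,\mathbf{C}_1,\mathbf{C}_2,\mathbf{D}_1,\mathbf{D}_2$ be the matrix-valued functions associated with this representation as defined in the context. Then $\mathcal{A}$ is invertible if and only if $\det\mathbf{E}_j\neq0$ everywhere for $j=0,1,2$ and the operator $\mathcal{I}+\mathcal{K}_1$ is invertible, where $\mathcal{I}$ is the identity operator and the compact operator $\mathcal{K}_1$ is defined by $$\mathcal{K}_1\mathbf{u}=\int_{[0,1]^2}(\mathbf{D}_2-\mathbf{D}_1)(\mathbf{k},\mathbf{k}')\,\mathbf{u}(\mathbf{k}')\,d\mathbf{k}'+\mathcal{R}\circ\mathcal{K}\mathbf{u},\qquad \mathbf{u}\in L^2_{2,M},$$ $$\mathcal{R}=(\mathcal{I}-\mathbf{C}_2\mathbf{E}_2^{-1}\langle\mathbf{B}_2\,\cdot\rangle_2)\circ(\mathcal{I}-\mathbf{C}_1\mathbf{E}_1^{-1}\langle\mathbf{B}_1\,\cdot\rangle_1)\circ(\mathbf{C}_0\,\cdot).$$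 Moreover, in this case the inverse operator belongs to $\mathscr{A}_{2,M}$ and has the form $$\mathcal{A}^{-1}=(\mathcal{I}-\mathcal{K}_1\circ(\mathcal{I}+\mathcal{K}_1)^{-1})\circ\mathcal{R}.$$
   Context: Let $L^2_{2,M}:=L^2([0,1]^2,\mathbb{C}^M)$. Points of $[0,1]^2$ are written $\mathbf{k}=(k_1,k_2)$, $\mathbf{k}'=(k_1',k_2')$. For a matrix- or vector-valued function of $\mathbf{k}\in[0,1]^2$ put $\langle\cdot\rangle_i:=\int_0^1\cdot\,dk_i$ for $i=1,2$; thus $\langle\cdot\rangle_1$ yields a function of $k_2$ only and $\langle\cdot\rangle_2$ yields a function of $k_1$ only, again regarded as functions on $[0,1]^2$. In operator expressions the dot $\cdot$ denotes the operator argument, e.g. $\mathbf{C}_0\,\cdot$ is multiplication by $\mathbf{C}_0$, and $\mathbf{C}_1\mathbf{E}_1^{-1}\langle\mathbf{B}_1\,\cdot\rangle_1$ is the operator $\mathbf{u}\mapsto\mathbf{C}_1\mathbf{E}_1^{-1}\langle\mathbf{B}_1\mathbf{u}\rangle_1$. Let $\mathscr{B}_{2,M}$ be the algebra of all bounded linear operators on $L^2_{2,M}$ and $\mathscr{K}_{2,M}$ the set of all compact operators on $L^2_{2,M}$. The algebra $\mathscr{A}_{2,M}$ is the minimal (non-closed, i.e. no topological closure is taken) subalgebra of $\mathscr{B}_{2,M}$ containing all operators of multiplication by continuous $M\times M$ matrix-valued functions on $[0,1]^2$, the integral projectors $\langle\cdot\rangle_1$, $\langle\cdot\rangle_2$,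 and all compact operators $\mathcal{K}\in\mathscr{K}_{2,M}$. ''Invertible'' and ''inverse'' always mean invertible and inverse in $\mathscr{B}_{2,M}$. For an operator $\mathcal{A}$ given by $\mathbf{A}_0,\mathbf{A}_1,\mathbf{A}_2,\mathbf{B}_1,\mathbf{B}_2,\mathcal{K}$ as in the claim, define (if the inverse matrices exist) $$\mathbf{C}_0=\mathbf{A}_0^{-1},\quad \mathbf{E}_0=\mathbf{A}_0,\quad \mathbf{C}_1=\mathbf{C}_0\mathbf{A}_1,\quad \mathbf{C}_2=\mathbf{C}_0\mathbf{A}_2,$$ $$\mathbf{E}_1=\mathbf{I}+\langle\mathbf{B}_1\mathbf{C}_1\rangle_1,\qquad \mathbf{E}_2=\mathbf{I}+\langle\mathbf{B}_2\mathbf{C}_2\rangle_2,$$ $$\mathbf{D}_1(\mathbf{k},\mathbf{k}')=\mathbf{C}_1(\mathbf{k})\mathbf{E}_1^{-1}(k_2)\mathbf{B}_1(k_1',k_2)\mathbf{C}_2(k_1',k_2)\mathbf{B}_2(\mathbf{k}'),$$ $$\mathbf{D}_2(\mathbf{k},\mathbf{k}')=\mathbf{C}_2(\mathbf{k})\mathbf{E}_2^{-1}(k_1)\int_0^1\mathbf{B}_2(k_1,k_2'')\mathbf{D}_1(k_1,k_2'',\mathbf{k}')\,dk_2''.$$ Here $\mathbf{I}$ is the identity matrix of the appropriate size, $\mathbf{E}_0$ is a function of $\mathbf{k}\in[0,1]^2$, $\mathbf{E}_1=\mathbf{E}_1(k_2)$ is a function of $k_2\in[0,1]$, and $\mathbf{E}_2=\mathbf{E}_2(k_1)$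 is a function of $k_1\in[0,1]$. The conditions are read successively: $\mathbf{E}_1,\mathbf{E}_2$ are defined once $\det\mathbf{E}_0\ne0$ everywhere on $[0,1]^2$, and $\mathbf{D}_1,\mathbf{D}_2,\mathcal{R},\mathcal{K}_1$ are defined once also $\det\mathbf{E}_1\neq0$ and $\det\mathbf{E}_2\ne0$ everywhere on $[0,1]$. *)

(* Defs.v *)
From HB Require Import structures.
From mathcomp Require Import all_boot all_order all_algebra.
From mathcomp Require Import complex ring lra.
From mathcomp Require Import all_classical all_reals all_analysis.
From mathcomp Require Import measurable_realfun.
Set Implicit Arguments.
Unset Strict Implicit.
Unset Printing Implicit Defensive.
Import Order.TTheory GRing.Theory Num.Theory.
Import numFieldNormedType.Exports.
Local Open Scope classical_set_scope.
Local Open Scope complex_scope.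
Local Open Scope quotient_scope.
Local Open Scope ring_scope.

Definition lebesgue2 (R : realType) :
    {measure set _ -> \bar R} :=
  (@lebesgue_measure R \x @lebesgue_measure R)%E.

#[global] Instance lebesgue2_ae_filter (R : realType) :
  Filter (nbhs (almost_everywhere (lebesgue2 R))).
Proof. exact: ae_filter_ringOfSetsType. Qed.

Definition unit_itv (R : realType) : set R := `[0, 1].
Definition square (R : realType) : set (R * R) := `[0, 1] `*` `[0, 1].

Section Euclid.
Context (R : realType).

Lemma sqrt_addr2_le (a b c A B C : R) : 0 <= a -> 0 <= b -> 0 <= c ->
  0 <= A -> 0 <= B -> 0 <= C ->
  a <= b + c -> A <= B + C ->
  Num.sqrt (a ^+ 2 + A ^+ 2) <=
  Num.sqrt (b ^+ 2 + B ^+ 2) + Num.sqrt (c ^+ 2 + C ^+ 2).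
Proof.
move=> a0 b0 c0 A0 B0 C0 abc ABC.
rewrite -(@ler_pXn2r _ 2)// ?nnegrE ?addr_ge0 ?sqrtr_ge0//.
rewrite sqrrD !sqr_sqrtr ?addr_ge0 ?sqr_ge0// -sqrtrM ?addr_ge0 ?sqr_ge0//.
have h : b * c + B * C <=
    Num.sqrt ((b ^+ 2 + B ^+ 2) * (c ^+ 2 + C ^+ 2)).
  rewrite -(@ler_pXn2r _ 2)// ?nnegrE ?sqrtr_ge0 ?addr_ge0 ?mulr_ge0//.
  rewrite sqr_sqrtr ?mulr_ge0 ?addr_ge0 ?sqr_ge0// -subr_ge0.
  rewrite (_ : _ - _ = (b * C - B * c) ^+ 2) ?sqr_ge0//; ring.
have : a ^+ 2 <= (b + c) ^+ 2 by rewrite ler_pXn2r// nnegrE ?addr_ge0.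
have : A ^+ 2 <= (B + C) ^+ 2 by rewrite ler_pXn2r// nnegrE ?addr_ge0.
lra.
Qed.

Lemma sqrt_sum2_le (I : Type) (r : seq I) (a b c : I -> R) :
  (forall i, 0 <= a i) -> (forall i, 0 <= b i) -> (forall i, 0 <= c i) ->
  (forall i, a i <= b i + c i) ->
  Num.sqrt (\sum_(i <- r) a i ^+ 2) <=
  Num.sqrt (\sum_(i <- r) b i ^+ 2) + Num.sqrt (\sum_(i <- r) c i ^+ 2).
Proof.
move=> a0 b0 c0 abc; elim: r => [|i r IH].
  by rewrite !big_nil sqrtr0 addr0.
have s0 (f : I -> R) : 0 <= \sum_(i <- r) f i ^+ 2.
  by apply: sumr_ge0 => j _; rewrite sqr_ge0.
rewrite !big_cons -(sqr_sqrtr (s0 a)) -(sqr_sqrtr (s0 b)) -(sqr_sqrtr (s0 c)).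
by apply: sqrt_addr2_le; rewrite ?sqrtr_ge0.
Qed.

End Euclid.

Section L2fun.
Context (R : realType) (M : nat).
Notation C := R[i].
Notation mu := (lebesgue2 R).

(* Square-integrability on the square only: values of u elsewhere are ignored,
   here as well as in L2_null, L2_norm and mx_continuous. *)
Definition is_L2 (u : R * R -> 'cV[C]_M) : Prop := forall i,
  ((fun k => complex.Re (u k i 0)) \_ (@square R) \in Lfun mu 2%:E) /\
  ((fun k => complex.Im (u k i 0)) \_ (@square R) \in Lfun mu 2%:E).

Definition L2_pred : {pred (R * R -> 'cV[C]_M)} := fun u => `[< is_L2 u >].

Lemma L2_submod_closed : submod_closed L2_pred.
Proof.
have [z sc] := @Lfun_submod_closed _ _ R mu 2%:E (lee1n 2).
split.
  apply/asboolP => i; rewrite (_ : _ \_ _ = 0)//.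
    by rewrite (_ : _ \_ _ = 0)//; apply/funext => k; rewrite patchE !mxE; case: ifP.
  by apply/funext => k; rewrite patchE !mxE; case: ifP.
move=> a u v /asboolP uL /asboolP vL; apply/asboolP => i.
have [ur ui] := uL i; have [vr vi] := vL i.
case: a => a b.
split.
  rewrite (_ : _ \_ _ = a *: (fun k => complex.Re (u k i 0)) \_ (@square R) +
    ((- b) *: (fun k => complex.Im (u k i 0)) \_ (@square R) +
     (fun k => complex.Re (v k i 0)) \_ (@square R))).
    by apply: (sc) => //; apply: sc.
  apply/funext => k; rewrite !fctE !patchE !mxE; case: ifP => _ /=.
    by case: (u k i 0) (v k i 0) => [x y] [x1 y1] /=; rewrite addrA scaleNr.
  by rewrite !scaler0 !addr0.
rewrite (_ : _ \_ _ = a *: (fun k => complex.Im (u k i 0)) \_ (@square R) +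
    (b *: (fun k => complex.Re (u k i 0)) \_ (@square R) +
     (fun k => complex.Im (v k i 0)) \_ (@square R))).
  by apply: (sc) => //; apply: sc.
apply/funext => k; rewrite !fctE !patchE !mxE; case: ifP => _ /=.
  by case: (u k i 0) (v k i 0) => [x y] [x' y'] /=; rewrite addrA.
by rewrite !scaler0 !addr0.
Qed.

HB.instance Definition _ :=
  GRing.isSubmodClosed.Build _ _ L2_pred L2_submod_closed.

Record L2fun := MkL2fun { L2fun_val :> R * R -> 'cV[C]_M ;
                          L2fun_valP : L2fun_val \in L2_pred }.

HB.instance Definition _ := [isSub for L2fun_val].
HB.instance Definition _ := [Choice of L2fun by <:].
HB.instance Definition _ := [SubChoice_isSubLmodule of L2fun by <:].

Definition L2_null : {pred L2fun} :=
  fun u => `[< {ae mu, forall k, square k -> u k = 0} >].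

Lemma L2_null_submod_closed : submod_closed L2_null.
Proof.
split.
  by apply/asboolP; apply: nearW => k _.
move=> a u v /asboolP u0 /asboolP v0; apply/asboolP.
apply: filterS2 u0 v0 => k u0 v0 kD.
rewrite [LHS](_ : _ = a *: u k + v k)//.
by rewrite u0// v0// scaler0 addr0.
Qed.

HB.instance Definition _ :=
  GRing.isSubmodClosed.Build _ _ L2_null L2_null_submod_closed.

Definition L2 := {ideal_quot L2_null}.

HB.instance Definition _ := GRing.Zmodule.on L2.
HB.instance Definition _ := EqQuotient.on L2.

Definition L2_scale (a : C) (x : L2) : L2 := \pi_L2 (a *: repr x).

Lemma L2_eqP (u v : L2fun) :
  (\pi_L2 u = \pi_L2 v) <-> {ae mu, forall k, square k -> u k = v k}.
Proof.
have -> : (\pi_L2 u = \pi_L2 v) <-> (u - v \in L2_null).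
  split=> [/eqP|]; first by rewrite -Quotient.idealrBE.
  by rewrite Quotient.idealrBE => /eqP.
split=> [/asboolP|] h; last apply/asboolP; apply: filterS h => k h kD.
  by apply/eqP; rewrite -subr_eq0; apply/eqP/h.
by apply/eqP; rewrite subr_eq0; apply/eqP/h.
Qed.

Lemma L2_piD (u v : L2fun) : \pi_L2 (u + v) = \pi_L2 u + \pi_L2 v.
Proof. exact: Quotient.pi_add. Qed.

Lemma L2_piZ a (u : L2fun) : \pi_L2 (a *: u) = L2_scale a (\pi_L2 u).
Proof.
apply/L2_eqP; have : \pi_L2 u = \pi_L2 (repr (\pi_L2 u)) by rewrite reprK.
move/L2_eqP; apply: filterS => k h kD.
change (a *: u k = a *: (repr (\pi_L2 u) : L2fun) k).
by rewrite h.
Qed.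

Lemma L2_scaleA a b x : L2_scale a (L2_scale b x) = L2_scale (a * b) x.
Proof. by rewrite -[x]reprK -(L2_piZ b) -!L2_piZ scalerA. Qed.

Lemma L2_scale1 : left_id 1 L2_scale.
Proof. by move=> x; rewrite -[x]reprK -!L2_piZ scale1r. Qed.

Lemma L2_scaleDr : right_distributive L2_scale +%R.
Proof.
by move=> a x y; rewrite -[x]reprK -[y]reprK -L2_piD -!L2_piZ scalerDr L2_piD.
Qed.

Lemma L2_scaleDl x : {morph L2_scale^~ x : a b / a + b}.
Proof. by move=> a b; rewrite -[x]reprK -!L2_piZ scalerDl L2_piD. Qed.

HB.instance Definition _ := GRing.Zmodule_isLmodule.Build C L2
  L2_scaleA L2_scale1 L2_scaleDr L2_scaleDl.

Definition L2_norm (x : L2) : R :=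
  Num.sqrt (\int[mu]_(k in @square R)
    \sum_(i < M) Normc.normc ((repr x : L2fun) k i 0) ^+ 2).

Definition L2_comp (u : L2fun) (p : 'I_M * bool) : R * R -> R :=
  (fun k => (if p.2 then @complex.Re R else @complex.Im R) (u k p.1 0))
    \_ (@square R).

Lemma L2_comp_Lfun u p : L2_comp u p \in Lfun mu 2%:E.
Proof.
by have /asboolP/(_ p.1) := L2fun_valP u; rewrite /L2_comp; case: p.2 => -[].
Qed.

Definition real_L2norm (f : R * R -> R) : R := fine 'N[mu]_2%:E[EFin \o f]%E.

Lemma real_L2norm_ge0 f : 0 <= real_L2norm f.
Proof. by rewrite /real_L2norm fine_ge0// Lnorm_ge0. Qed.
#[local] Hint Resolve real_L2norm_ge0 L2_comp_Lfun : core.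

Lemma int_sqr_real_L2norm f : f \in Lfun mu 2%:E ->
  (\int[mu]_k (f k ^+ 2)%:E = (real_L2norm f ^+ 2)%:E)%E.
Proof.
move=> fL.
have := poweR_Lnorm mu (EFin \o f) (_ : 2 != 0 :> R).
have -> : 'N[mu]_2%:E[EFin \o f]%E = (real_L2norm f)%:E.
  by rewrite (finite_norm_fine (Lfun_Sub (lee1n 2) fL)).
rewrite pnatr_eq0 => /(_ isT).
rewrite poweR_EFin powR_mulrn// => ->.
apply: eq_integral => k _ /=.
by rewrite powR_mulrn ?normr_ge0// real_normK ?num_real.
Qed.

Lemma real_L2norm_compD u v p :
  real_L2norm (L2_comp (u + v) p) <=
  real_L2norm (L2_comp u p) + real_L2norm (L2_comp v p).
Proof.
have := ler_LnormD (Lfun_Sub (lee1n 2) (L2_comp_Lfun u p))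
  (Lfun_Sub (lee1n 2) (L2_comp_Lfun v p)).
apply: le_trans; rewrite le_eqVlt; apply/orP; left; apply/eqP.
congr (fine _); congr Lnorm; apply/funext => k /=; congr EFin.
rewrite !fctE /L2_comp !patchE; case: ifP => _; last by rewrite addr0.
change ((u + v) k p.1 0) with ((u k + v k) p.1 0); rewrite mxE.
by case: p.2; case: (u k _ _) (v k _ _) => [? ?] [? ?].
Qed.

Definition L2_sqr (u : L2fun) k : R := \sum_p L2_comp u p k ^+ 2.

Lemma measurable_L2_comp u p : measurable_fun setT (L2_comp u p).
Proof. by have := sub_Lfun_mfun (L2_comp_Lfun u p); rewrite inE. Qed.

Lemma L2_sqrE (u : L2fun) :
  (fun k => \sum_(i < M) Normc.normc (u k i 0) ^+ 2) \_ (@square R) = L2_sqr u.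
Proof.
apply/funext => k; rewrite /L2_sqr patchE /L2_comp; case: ifPn => kD; last first.
  by rewrite big1// => p _; rewrite patchE (negbTE kD) expr0n.
rewrite -(pair_bigA _ (fun i b => ((fun k =>
  (if b then @complex.Re R else @complex.Im R) (u k i 0)) \_ (@square R))
    k ^+ 2))/=.
apply: eq_bigr => i _; rewrite big_bool /= !patchE kD.
by case: (u k i 0) => a b /=; rewrite sqr_sqrtr ?addr_ge0 ?sqr_ge0.
Qed.

Lemma int_L2_sqr (u : L2fun) :
  (\int[mu]_k (L2_sqr u k)%:E = (\sum_p real_L2norm (L2_comp u p) ^+ 2)%:E)%E.
Proof.
under eq_integral do rewrite -sumEFin.
rewrite ge0_integral_sum//=.
- by rewrite -sumEFin; apply: eq_bigr => p _; exact/int_sqr_real_L2norm/L2_comp_Lfun.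
- by move=> p; apply/measurable_EFinP; apply: measurable_funX; exact: measurable_L2_comp.
- by move=> p k _; rewrite lee_fin sqr_ge0.
Qed.

Lemma L2_normE (x : L2) :
  L2_norm x = Num.sqrt (\sum_p real_L2norm (L2_comp (repr x) p) ^+ 2).
Proof.
rewrite /L2_norm; congr Num.sqrt; rewrite /Rintegral integral_mkcond.
by rewrite -[RHS]/(fine (_)%:E) -int_L2_sqr -L2_sqrE restrict_EFin.
Qed.

Lemma L2_norm_ge0 x : 0 <= L2_norm x.
Proof. exact: sqrtr_ge0. Qed.

Lemma L2_norm_pi (u : L2fun) :
  L2_norm (\pi_L2 u) = Num.sqrt (\sum_p real_L2norm (L2_comp u p) ^+ 2).
Proof.
rewrite L2_normE; congr Num.sqrt; apply: eq_bigr => p _.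
have /L2_eqP h : \pi_L2 (repr (\pi_L2 u)) = \pi_L2 u by rewrite reprK.
apply: EFin_inj; rewrite -!int_sqr_real_L2norm//.
apply: ge0_ae_eq_integral => //.
- by apply/measurable_EFinP; apply: measurable_funX; exact: measurable_L2_comp.
- by apply/measurable_EFinP; apply: measurable_funX; exact: measurable_L2_comp.
- by move=> k _; rewrite lee_fin sqr_ge0.
- by move=> k _; rewrite lee_fin sqr_ge0.
- apply: filterS h => k h _ /=; rewrite /L2_comp !patchE.
  by case: ifP => // /[!inE] kD; rewrite h.
Qed.

Lemma L2_ler_normD (x y : L2) : L2_norm (x + y) <= L2_norm x + L2_norm y.
Proof.
rewrite -[x]reprK -[y]reprK -L2_piD !L2_norm_pi.
by apply: sqrt_sum2_le => p; [exact: real_L2norm_ge0..|exact: real_L2norm_compD].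
Qed.

Lemma L2_normZ (a : C) (x : L2) : L2_norm (a *: x) = Normc.normc a * L2_norm x.
Proof.
rewrite -[x]reprK -[_ *: _]L2_piZ !L2_norm_pi; set u : L2fun := repr x.
have na0 : 0 <= Normc.normc a by case: a => a b; exact: sqrtr_ge0.
have qZ k : L2_sqr (a *: u) k = Normc.normc a ^+ 2 * L2_sqr u k.
  rewrite -!L2_sqrE !patchE; case: ifP => _; last by rewrite mulr0.
  rewrite mulr_sumr; apply: eq_bigr => i _.
  change ((a *: u) k i 0) with ((a *: u k) i 0).
  by rewrite mxE Normc.normcM exprMn.
rewrite (_ : \sum_p _ = Normc.normc a ^+ 2 * \sum_p real_L2norm (L2_comp u p) ^+ 2).
  by rewrite sqrtrM ?sqr_ge0// sqrtr_sqr ger0_norm.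
apply: EFin_inj; rewrite EFinM -!int_L2_sqr -ge0_integralZl//.
- by apply: eq_integral => k _; rewrite qZ.
- apply/measurable_EFinP; apply: measurable_sum => p.
  apply: measurable_funX; exact: measurable_L2_comp.
- by move=> k _; rewrite lee_fin sumr_ge0// => p _; rewrite sqr_ge0.
- by rewrite lee_fin sqr_ge0.
Qed.

Lemma L2_norm0 (x : L2) : L2_norm x = 0 -> x = 0.
Proof.
rewrite L2_normE => /eqP; rewrite sqrtr_eq0 => S0.
have {}S0 : \sum_p real_L2norm (L2_comp (repr x) p) ^+ 2 == 0.
  by rewrite eq_le S0 sumr_ge0// => p _; exact: sqr_ge0.
have {}S0 p : real_L2norm (L2_comp (repr x) p) = 0.
  move: S0; rewrite psumr_eq0; last by move=> ? _; exact: sqr_ge0.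
  by move=> /allP/(_ p (mem_index_enum _)) /=; rewrite sqrf_eq0 => /eqP.
have ae0 p : {ae mu, forall k, L2_comp (repr x) p k = 0}.
  have := fine_Lnormr_eq0 (f := Lfun_Sub (lee1n 2) (L2_comp_Lfun (repr x) p)).
  by move=> /(_ (S0 p)); apply: filterS => k /(_ I).
have -> : x = \pi_L2 (0 : L2fun).
  rewrite -[x]reprK; apply/L2_eqP.
  have : {ae mu, forall k p, L2_comp (repr x) p k = 0}.
    exact: filter_forall.
  apply: filterS => k h kD; apply/matrixP => i j; rewrite ord1 mxE.
  have := h (i, true); have := h (i, false).
  rewrite /L2_comp !patchE mem_set//=.
  by case: (_ i 0) => ? ? /= -> ->.
by rewrite -(scale0r (0 : L2fun)) L2_piZ; exact: scale0r.
Qed.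

#[local] Hint Resolve L2_norm_ge0 : core.

(* A normed module over C has its norm valued in C. *)
Let cnorm (x : L2) : C := (L2_norm x)%:C.

Let cnormD x y : cnorm (x + y) <= cnorm x + cnorm y.
Proof. by rewrite /cnorm -rmorphD lecR L2_ler_normD. Qed.

Let cnormZ a x : cnorm (a *: x) = `|a| * cnorm x.
Proof. by rewrite /cnorm L2_normZ rmorphM. Qed.

Let cnorm0 x : cnorm x = 0 -> x = 0.
Proof. by move=> /complexI/L2_norm0. Qed.

HB.instance Definition _ := @Lmodule_isNormed.Build C L2
  cnorm cnormD cnormZ cnorm0.

End L2fun.

Section BoundedOperators.
Context (K : numFieldType) (V : normedModType K).

Definition bounded_op (T : V -> V) : Prop :=
  linear T /\ exists c : K, forall u, `|T u| <= c * `|u|.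

Definition compact_op (T : V -> V) : Prop :=
  linear T /\ forall A : set V, bounded_set A -> precompact (T @` A).

Definition inverse_op (T S : V -> V) : Prop :=
  [/\ bounded_op T, bounded_op S, S \o T = idfun & T \o S = idfun].

Definition invertible_op (T : V -> V) : Prop := exists S, inverse_op T S.

Definition bounded_subalgebra (X : set (V -> V)) : Prop :=
  [/\ X `<=` bounded_op,
      forall T S, X T -> X S -> X (T \+ S),
      forall (a : K) T, X T -> X (a \*: T) &
      forall T S, X T -> X S -> X (T \o S)].

End BoundedOperators.

Section Operators.
Context (R : realType).
Notation C := R[i].

Definition mx_integral d (T : measurableType d) (mu : {measure set T -> \bar R})
    (D : set T) m n (F : T -> 'M[C]_(m, n)) : 'M[C]_(m, n) :=
  \matrix_(i, j) ((\int[mu]_(x in D) complex.Re (F x i j)) +i*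
                  (\int[mu]_(x in D) complex.Im (F x i j))).

Definition integral01 m n (F : R -> 'M[C]_(m, n)) : 'M[C]_(m, n) :=
  mx_integral (@lebesgue_measure R) (@unit_itv R) F.

(* C^o carries the topology of the modulus, and 'M[C^o]_(m, n) the entrywise
   one; R[i] itself has no canonical topology. *)
Definition mx_continuous m n (A : R * R -> 'M[C]_(m, n)) : Prop :=
  {within @square R, continuous (A : R * R -> 'M[C^o]_(m, n))}.

(* The class of f when f is square-integrable on the square, and 0 otherwise. *)
Definition toL2 m (f : R * R -> 'cV[C]_m) : L2 R m :=
  \pi_(L2 R m) (insubd (0 : L2fun R m) f).

Definition L2rep m (u : L2 R m) : R * R -> 'cV[C]_m := (repr u : L2fun R m).

Definition mul_op m n (A : R * R -> 'M[C]_(m, n)) (u : L2 R n) : L2 R m :=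
  toL2 (fun k => A k *m L2rep u k).

Definition avg1 m (u : L2 R m) : L2 R m :=
  toL2 (fun k => integral01 (fun x => L2rep u (x, k.2))).

Definition avg2 m (u : L2 R m) : L2 R m :=
  toL2 (fun k => integral01 (fun x => L2rep u (k.1, x))).

Definition kernel_op m n (D : R * R -> R * R -> 'M[C]_(m, n)) (u : L2 R n) :
    L2 R m :=
  toL2 (fun k => mx_integral (lebesgue2 R) (@square R)
                   (fun k' => D k k' *m L2rep u k')).

Definition opalg_generators M : set (L2 R M -> L2 R M) :=
  [set T | (exists2 A : R * R -> 'M[C]_M, mx_continuous A & T = mul_op A) \/
           T = @avg1 M \/ T = @avg2 M \/ compact_op T].

(* No topological closure: smallest set closed under the algebra operations. *)
Definition opalg M : set (L2 R M -> L2 R M) :=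
  smallest (@bounded_subalgebra C (L2 R M)) (@opalg_generators M).

End Operators.

Section Symbols.
Context (R : realType) (M M1 M2 : nat).
Notation C := R[i].
Variables (A0 : R * R -> 'M[C]_M).
Variables (A1 : R * R -> 'M[C]_(M, M1)) (A2 : R * R -> 'M[C]_(M, M2)).
Variables (B1 : R * R -> 'M[C]_(M1, M)) (B2 : R * R -> 'M[C]_(M2, M)).
Variable K : L2 R M -> L2 R M.

Definition symC0 k := invmx (A0 k).
Definition symE0 k := A0 k.
Definition symC1 k := symC0 k *m A1 k.
Definition symC2 k := symC0 k *m A2 k.
Definition symE1 (k2 : R) : 'M[C]_M1 :=
  1%:M + integral01 (fun k1 => B1 (k1, k2) *m symC1 (k1, k2)).
Definition symE2 (k1 : R) : 'M[C]_M2 :=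
  1%:M + integral01 (fun k2 => B2 (k1, k2) *m symC2 (k1, k2)).

Definition symD1 (k k' : R * R) : 'M[C]_M :=
  symC1 k *m invmx (symE1 k.2) *m B1 (k'.1, k.2) *m symC2 (k'.1, k.2) *m B2 k'.
Definition symD2 (k k' : R * R) : 'M[C]_M :=
  symC2 k *m invmx (symE2 k.1) *m
  integral01 (fun x => B2 (k.1, x) *m symD1 (k.1, x) k').

Definition R_op : L2 R M -> L2 R M :=
  (idfun \- (mul_op (fun k => symC2 k *m invmx (symE2 k.1))
             \o @avg2 R M2 \o mul_op B2))
  \o (idfun \- (mul_op (fun k => symC1 k *m invmx (symE1 k.2))
                \o @avg1 R M1 \o mul_op B1))
  \o mul_op symC0.

Definition K1_op : L2 R M -> L2 R M :=
  kernel_op (fun k k' => symD2 k k' - symD1 k k') \+ (R_op \o K).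

End Symbols.

(* Main.v *)
Require Import Defs.
From mathcomp Require Import all_boot all_order all_algebra.
From mathcomp Require Import complex ring lra.
From mathcomp Require Import all_classical all_reals all_analysis.
From mathcomp Require Import measurable_realfun.
Set Implicit Arguments.
Unset Strict Implicit.
Unset Printing Implicit Defensive.
Import Order.TTheory GRing.Theory Num.Theory.
Import numFieldNormedType.Exports.
Local Open Scope classical_set_scope.
Local Open Scope ring_scope.

(** Let [S1] and [S2] be the operators [C1 <B1 u>_1] and [C2 <B2 u>_2]. If [A0] is
    invertible everywhere then [C0 A = 1 + S1 + S2 + C0 K]. Each of [1 + S1] and
    [1 + S2] can be inverted by hand as soon as [E1] and [E2] are invertible
    matrices: [<B1 S1 u>_1] is [(E1 - 1) <B1 u>_1], since an average taken twice in
    the same direction sees the coefficients only, so [P1 u = C1 E1^-1 <B1 u>_1]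
    satisfies [(1 - P1) (1 + S1) = 1 = (1 + S1) (1 - P1)], and likewise for [P2]
    ([one_sided_invK], [one_sided_Kinv]). Hence [R = (1 - P2) (1 - P1) C0] is
    invertible, and [R A = 1 + P2 Q - Q + R K] with [Q = P1 S2]
    ([R_op_regularizes]). By Fubini [P2 Q - Q] is the integral operator with kernel
    [D2 - D1] ([kernel_op_D2_D1]), so that [R A = 1 + K1].

    The operator [K1] is compact because the core of [Q] averages first over one
    coordinate and then over the other with a continuous matrix in between: the
    images of a bounded set are functions of one coordinate with a common bound and
    modulus of continuity ([compact_avg_mul_avg]). Once the determinants do not
    vanish, [A] and [1 + K1] differ by the invertible factor [R], which gives the
    equivalence and the formula for the inverse. The inverse lies in the algebra:
    [1 - P1], [1 - P2] and [C0] do, the averages of vectors of length [M1] or [M2]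
    being sums of averages of vectors of length [M] ([subalgebra_one_sided]), and
    the product of [K1] with a bounded operator is compact.

    There remains to see that an invertible [A] has nonvanishing determinants. An
    invertible operator is bounded below, which excludes a sequence with pairwise
    disjoint supports on which [A - K] is arbitrarily small compared with the norm:
    a compact [K] nearly repeats a value on the normalized sequence
    ([no_singular_sequence]). If [A0 k0] is singular, such a sequence is obtained
    from a kernel vector placed on small disjoint rectangles near [k0], where both
    averages are small because the supports are thin ([singular_A0]). If [A0] is
    invertible but [E1 y0] has a kernel vector [v], the functions [C1 v] on thin
    disjoint strips near [k2 = y0] have this property: they are almost annihilated
    by [1 + S1], and the other average is small because the strips are thin
    ([singular_symE]). The case of [E2] is symmetric. *)

#[global] Instance lebesgue_ae_filter (R : realType) :
  Filter (nbhs (almost_everywhere (@lebesgue_measure R))).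
Proof. exact: ae_filter_ringOfSetsType. Qed.

(** * Iterated integration over the unit square, in either order *)

Section SquareMeasure.
Context (R : realType).
Notation mu := (@lebesgue_measure R).
Notation mu2 := (lebesgue2 R).
Notation I01 := (@unit_itv R).
Notation sq := (@square R).

(** The two averages differ only in the variable that is integrated out, so both
    are handled at once: [true] integrates over the first coordinate and [false]
    over the second. The inner coordinate [ic b k] is the integrated one and the
    outer coordinate [oc b k] is the one that remains. *)
Definition pt (b : bool) (x y : R) : R * R := if b then (x, y) else (y, x).
Definition oc (b : bool) (k : R * R) : R := if b then k.2 else k.1.
Definition ic (b : bool) (k : R * R) : R := if b then k.1 else k.2.

Lemma oc_pt b x y : oc b (pt b x y) = y. Proof. by case: b. Qed.
Lemma ic_pt b x y : ic b (pt b x y) = x. Proof. by case: b. Qed.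
Lemma pt_icoc b k : pt b (ic b k) (oc b k) = k. Proof. by case: b; case: k. Qed.

Lemma square_pt b x y : sq (pt b x y) <-> I01 x /\ I01 y.
Proof. by case: b; rewrite /square/=; split => -[]. Qed.

Lemma square_oc b k : sq k -> I01 (oc b k).
Proof. by case: b => -[]. Qed.

Lemma square_ic b k : sq k -> I01 (ic b k).
Proof. by case: b => -[]. Qed.

Lemma measurable_I01 : measurable (I01 : set (measurableTypeR R)).
Proof. exact: measurable_itv. Qed.

Lemma measurable_square :
  measurable (sq : set (measurableTypeR R * measurableTypeR R)).
Proof. by apply: measurableX; exact: measurable_itv. Qed.

Lemma mu_I01 : mu I01 = 1%E.
Proof. by rewrite /unit_itv lebesgue_measure_itv/= lte_fin ltr01 oppr0 addr0. Qed.

Lemma mu2_square : mu2 sq = 1%E.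
Proof.
have -> : mu2 sq = (mu I01 * mu I01)%E.
  by apply: product_measure1E; exact: measurable_I01.
by rewrite mu_I01 mule1.
Qed.

Lemma measurable_pt b y : measurable_fun setT (fun x => pt b x y).
Proof. by case: b; [exact: pair2_measurable|exact: pair1_measurable]. Qed.

Lemma measurable_oc b : measurable_fun setT (oc b).
Proof. by case: b; [exact: measurable_snd|exact: measurable_fst]. Qed.

Lemma measurable_ic b : measurable_fun setT (ic b).
Proof. by case: b; [exact: measurable_fst|exact: measurable_snd]. Qed.

Lemma measurable_slice b d (T : measurableType d) (f : R * R -> T) y :
  measurable_fun sq f -> I01 y -> measurable_fun I01 (fun x => f (pt b x y)).
Proof.
move=> mf Iy.
apply: (measurable_comp measurable_square _ mf).
  by move=> _ [x Ix <-]; exact/square_pt.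
by apply: measurable_funTS; exact: measurable_pt.
Qed.

Lemma measurable_comp_oc b d (T : measurableType d) (f : R -> T) :
  measurable_fun I01 f -> measurable_fun sq (f \o oc b).
Proof.
move=> mf; apply: (measurable_comp measurable_I01 _ mf).
  by move=> _ [k kD <-]; exact: square_oc.
by apply: measurable_funTS; exact: measurable_oc.
Qed.

Lemma patch_pt b (f : R * R -> \bar R) x y :
  (f \_ sq) (pt b x y) =
  ((fun y => ((fun x => f (pt b x y)) \_ I01) x) \_ I01) y.
Proof.
rewrite !patchE.
have [yI|yI] := boolP (y \in I01); last first.
  rewrite memNset//; move=> /square_pt[_ Iy]; move: yI; rewrite mem_set//.
have [xI|xI] := boolP (x \in I01); last first.
  rewrite memNset//; move=> /square_pt[Ix _]; move: xI; rewrite mem_set//.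
by rewrite mem_set//; apply/square_pt; split; exact/set_mem.
Qed.

Local Open Scope ereal_scope.

(** Extension by zero turns an integral over the square into one over the plane;
    this is how the Fubini theorems for product measures reach the square. *)
Lemma integral_patch_pt b (f : R * R -> \bar R) y :
  \int[mu]_x (f \_ sq) (pt b x y) =
  ((fun y => \int[mu]_(x in I01) f (pt b x y)) \_ I01) y.
Proof.
under eq_integral do rewrite patch_pt.
rewrite patchE; case: ifPn => yI.
  by rewrite [RHS]integral_mkcond; apply: eq_integral => x _; rewrite patchE yI.
by rewrite integral0_eq// => x _; rewrite patchE (negbTE yI).
Qed.

Lemma measurable_inner_integral_ge0 b (f : R * R -> \bar R) :
  measurable_fun sq f -> (forall k, sq k -> 0 <= f k) ->
  measurable_fun I01 (fun y => \int[mu]_(x in I01) f (pt b x y)).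
Proof.
move=> /(measurable_restrictT _ measurable_square).1 mf f0.
have f0' k : 0 <= (f \_ sq) k.
  by rewrite patchE; case: ifPn => // /set_mem/f0.
apply: (measurable_restrictT _ measurable_I01).2.
rewrite -(funext (integral_patch_pt b f)).
case: b => /=.
- exact: (measurable_fun_fubini_tonelli_G (m1 := mu) _ mf f0').
- exact: (measurable_fun_fubini_tonelli_F (m2 := mu) _ mf f0').
Qed.

Lemma tonelli_square b (f : R * R -> \bar R) :
  measurable_fun sq f -> (forall k, sq k -> 0 <= f k) ->
  \int[mu2]_(k in sq) f k = \int[mu]_(y in I01) \int[mu]_(x in I01) f (pt b x y).
Proof.
move=> /(measurable_restrictT _ measurable_square).1 mf f0.
have f0' k : 0 <= (f \_ sq) k.
  by rewrite patchE; case: ifPn => // /set_mem/f0.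
rewrite integral_mkcond [RHS]integral_mkcond.
rewrite -(funext (integral_patch_pt b f)).
case: b => /=.
- exact: (fubini_tonelli2 (m1 := mu) (m2 := mu) _ mf f0').
- exact: (fubini_tonelli1 (m1 := mu) (m2 := mu) _ mf f0').
Qed.

Lemma measurable_inner_integral b (f : R * R -> \bar R) :
  measurable_fun sq f ->
  measurable_fun I01 (fun y => \int[mu]_(x in I01) f (pt b x y)).
Proof.
move=> mf.
rewrite (_ : (fun y => _) = (fun y => \int[mu]_(x in I01) f^\+ (pt b x y)) \-
                            (fun y => \int[mu]_(x in I01) f^\- (pt b x y))).
  by apply: emeasurable_funB; apply: measurable_inner_integral_ge0 => //;
    [exact: measurable_funepos|exact: measurable_funeneg].
apply/funext => y; rewrite integralE; congr (_ - _).
- by apply: eq_integral => x _; rewrite !funepos.unlock.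
- by apply: eq_integral => x _; rewrite !funeneg.unlock.
Qed.

Lemma integrable_restrict (f : R * R -> \bar R) :
  mu2.-integrable sq f -> mu2.-integrable setT (f \_ sq).
Proof. by move=> h; exact: ((integrable_mkcond (mu := mu2) f measurable_square).1 h). Qed.

Lemma ae_integrable_slice b (f : R * R -> \bar R) :
  mu2.-integrable sq f ->
  {ae mu, forall y, I01 y -> mu.-integrable I01 (fun x => f (pt b x y))}.
Proof.
move=> /integrable_restrict intf.
have := match b return {ae mu, forall y, mu.-integrable setT
    (fun x => (f \_ sq) (pt b x y))} with
  | true => ae_integrable2 intf | false => ae_integrable1 intf end.
apply: filterS => y intfy Iy; apply/(integrable_mkcond (mu := mu) _ measurable_I01).
move: intfy; apply: eq_integrable => // x _.
by rewrite patch_pt !patchE (mem_set Iy).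
Qed.

Lemma integrable_inner_integral b (f : R * R -> \bar R) :
  mu2.-integrable sq f ->
  mu.-integrable I01 (fun y => \int[mu]_(x in I01) f (pt b x y)).
Proof.
move=> intf; have mf := measurable_int _ intf.
have maf : measurable_fun sq (abse \o f) by exact: measurableT_comp.
apply/integrableP; split; first exact: measurable_inner_integral.
apply: (le_lt_trans _ (integrableP _ _ _ intf).2).
rewrite (tonelli_square b maf); last by move=> k _; exact: abse_ge0.
apply: ge0_le_integral => //; [exact: measurable_I01|..].
- by apply: measurableT_comp => //; exact: measurable_inner_integral.
- exact: measurable_inner_integral.
- move=> y Iy; apply: le_abse_integral; first exact: measurable_I01.
  exact: measurable_slice.
Qed.

Lemma fubini_square b (f : R * R -> \bar R) :
  mu2.-integrable sq f ->
  \int[mu2]_(k in sq) f k = \int[mu]_(y in I01) \int[mu]_(x in I01) f (pt b x y).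
Proof.
move=> /integrable_restrict intf.
rewrite integral_mkcond [RHS]integral_mkcond -(funext (integral_patch_pt b f)).
by case: b => /=; [rewrite -(integral21_prod_meas1 intf)|rewrite -(integral12_prod_meas1 intf)].
Qed.

(** A null set has almost all of its slices null, because the integral of its
    indicator can be iterated. *)
Lemma ae_slice b (P : R * R -> Prop) :
  {ae mu2, forall k, sq k -> P k} ->
  {ae mu, forall y, I01 y -> {ae mu, forall x, I01 x -> P (pt b x y)}}.
Proof.
move=> [N [mN N0 PN]].
have : \int[mu2]_(k in sq) (\1_N k)%:E = 0.
  apply/eqP; rewrite eq_le; apply/andP; split; last first.
    by apply: integral_ge0 => k _; rewrite lee_fin.
  rewrite integral_indic//; last exact: measurable_square.
  rewrite -N0; apply: le_measure; rewrite ?inE//.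
  by apply: measurableI => //; exact: measurable_square.
have mI : measurable_fun sq (EFin \o (\1_N : R * R -> R)).
  by apply: measurable_funTS; apply/measurable_EFinP; exact: measurable_indic.
have I0 k : sq k -> 0 <= (EFin \o (\1_N : R * R -> R)) k by rewrite lee_fin.
rewrite (tonelli_square b mI I0) => h.
have : ae_eq mu I01 (fun y => \int[mu]_(x in I01) (EFin \o \1_N) (pt b x y)) (cst 0).
  apply: (ae_eq_integral_abs mu measurable_I01
    (measurable_inner_integral_ge0 b mI I0)).1.
  rewrite -[RHS]h; apply: eq_integral => y _; rewrite gee0_abs//.
  by apply: integral_ge0 => x _; rewrite lee_fin.
apply: filterS => y hy Iy; have {}hy := hy Iy; rewrite /cst in hy.
suff : {ae mu, forall x, I01 x -> (EFin \o \1_N) (pt b x y) = 0 :> \bar R}.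
  apply: filterS => x hx Ix; apply: contrapT => nP.
  have : N (pt b x y) by apply: PN => /= H; apply: nP; apply: H; apply/square_pt.
  move=> Npt; have /eqP := hx Ix; rewrite /= indicE mem_set//.
  by rewrite eqe oner_eq0.
apply: (ae_eq_integral_abs mu measurable_I01 (measurable_slice b mI Iy)).1.
rewrite -[RHS]hy; apply: eq_integral => x _; rewrite gee0_abs//.
by rewrite lee_fin.
Qed.

(** A statement about the outer coordinate fails on a strip over a null set,
    which is null in the square. *)
Lemma ae_comp_oc b (P : R -> Prop) :
  {ae mu, forall y, I01 y -> P y} ->
  {ae mu2, forall k, sq k -> P (oc b k)}.
Proof.
move=> [N [mN N0 PN]].
have mO : measurable (oc b @^-1` N).
  by rewrite -[X in measurable X]setTI; apply: measurable_oc.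
exists (sq `&` (oc b @^-1` N)); split.
- by apply: measurableI => //; exact: measurable_square.
- have NI : mu (N `&` I01) = 0.
    apply/eqP; rewrite eq_le measure_ge0 andbT -N0.
    by apply: le_measure; rewrite ?inE//; apply: measurableI => //; exact: measurable_I01.
  rewrite (_ : _ `&` _ = if b then I01 `*` (N `&` I01) else (N `&` I01) `*` I01).
    have mNI : measurable (N `&` I01) by apply: measurableI => //; exact: measurable_I01.
    case: b {mO} => /=.
    - apply: (eq_trans (product_measure1E mu mu measurable_I01 mNI)).
      by rewrite -(mule0 (mu I01)); congr (_ * _); exact: NI.
    - apply: (eq_trans (product_measure1E mu mu mNI measurable_I01)).
      by rewrite -(mul0e (mu I01)); congr (_ * _); exact: NI.
  by case: b {mO}; apply/seteqP; split => -[x y] /=; rewrite /square/=; tauto.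
- move=> k /= /not_implyP[kD nP]; split => //.
  by apply: PN => /= H; apply: nP; apply: H; exact: square_oc.
Qed.
End SquareMeasure.
Arguments measurable_I01 {R}.
Arguments measurable_square {R}.
Arguments mu_I01 {R}.
Arguments mu2_square {R}.

(** * A Cauchy-Schwarz bound for functions of small support *)

Section CauchySchwarz.
Context (R : realType).
Notation mu := (@lebesgue_measure R).
Notation I01 := (@unit_itv R).

Lemma integrable_sqr_I01 (f : R -> R) : measurable_fun I01 f ->
  (\int[mu]_(x in I01) (f x ^+ 2)%:E < +oo)%E ->
  mu.-integrable I01 (EFin \o (fun x => f x ^+ 2)) /\
  mu.-integrable I01 (EFin \o f).
Proof.
move=> mf fin.
have mf2 : measurable_fun I01 (EFin \o (fun x => f x ^+ 2)).
  by apply/measurable_EFinP; exact: measurable_funX.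
have i2 : mu.-integrable I01 (EFin \o (fun x => f x ^+ 2)).
  apply/integrableP; split => //; apply: le_lt_trans fin.
  apply: ge0_le_integral => //; [exact: measurable_I01|exact: measurableT_comp|].
  by move=> x _ /=; rewrite lee_fin ger0_norm// sqr_ge0.
split => //.
have i1 : mu.-integrable I01 (EFin \o (fun=> 1 : R)).
  apply/integrableP; split; first by apply/measurable_EFinP; exact: measurable_cst.
  rewrite (_ : (fun x => _) = cst 1%E); last first.
    by apply/funext => x; rewrite /= normr1.
  by rewrite (integral_cst mu measurable_I01) mul1e [X in (X < _)%E]mu_I01 ltry.
have i12 := integrableD measurable_I01 i1 i2.
apply: (le_integrable measurable_I01 _ _ i12); first exact/measurable_EFinP.
move=> x _ /=; rewrite lee_fin.
rewrite [leRHS]ger0_norm ?addr_ge0 ?sqr_ge0//.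
have := sqr_ge0 (`|f x| - 1); rewrite sqrrB1 real_normK ?num_real//.
by have := sqr_ge0 (f x); lra.
Qed.

(** Cauchy-Schwarz for [f] against the indicator of [S], by integrating the
    nonnegative function [(f - t 1_S)^2] for the optimal [t]. The gain of the factor
    [s] makes averages of functions with small support small; with [s = 1] this is
    the bound that makes averaging a contraction. *)
Lemma sqr_Rintegral_le (f : R -> R) (S : set R) (s : R) :
  measurable_fun I01 f -> measurable S -> 0 < s -> (mu S <= s%:E)%E ->
  (forall x, I01 x -> ~ S x -> f x = 0) ->
  (((\int[mu]_(x in I01) f x) ^+ 2)%:E <=
   s%:E * \int[mu]_(x in I01) (f x ^+ 2)%:E)%E.
Proof.
move=> mf mS s0 Ss fS.
have : (0 <= \int[mu]_(x in I01) (f x ^+ 2)%:E)%E.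
  by apply: integral_ge0 => x _; rewrite lee_fin sqr_ge0.
have [fin|] := ltP (\int[mu]_(x in I01) (f x ^+ 2)%:E)%E +oo%E; last first.
  by rewrite leye_eq => /eqP -> _; rewrite gt0_muley ?lte_fin// leey.
move=> _.
have [i2 i1] := integrable_sqr_I01 mf fin.
(* This [t] minimizes [s * t ^+ 2 - 2 * t * m]. *)
set m := \int[mu]_(x in I01) f x; pose t := m / s.
have iS : mu.-integrable I01 (EFin \o (\1_S : R -> R)).
  apply: (integrableS measurableT) => //; first exact: measurable_I01.
  apply/integrableP; split; first by apply/measurable_EFinP; exact: measurable_indic.
  rewrite (_ : \int[mu]_x `|_| = mu S)%E; first exact: le_lt_trans (ltry s).
  rewrite -[in RHS](setIT S) -integral_indic//.
  by apply: eq_integral => x _ /=; rewrite ger0_norm.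
have mi : \int[mu]_(x in I01) (\1_S x : R) <= s.
  rewrite -lee_fin; apply: le_trans Ss.
  rewrite /Rintegral fineK; last by apply: integrable_fin_num => //; exact: measurable_I01.
  rewrite integral_indic//; last exact: measurable_I01.
  by apply: le_measure; rewrite ?inE//; apply: measurableI => //; exact: measurable_I01.
have itm := integrableZl measurable_I01 (- (2 * t)) i1.
have itS := integrableZl measurable_I01 (t ^+ 2) iS.
have key : 0 <= \int[mu]_(x in I01) (f x ^+ 2) + (- (2 * t) * m + t ^+ 2 * s).
  have : 0 <= \int[mu]_(x in I01) ((f x - t * \1_S x) ^+ 2).
    by apply: Rintegral_ge0 => x _; exact: sqr_ge0.
  have -> : \int[mu]_(x in I01) ((f x - t * \1_S x) ^+ 2) =
     \int[mu]_(x in I01) (f x ^+ 2 + (- (2 * t) * f x + t ^+ 2 * \1_S x)).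
    apply: eq_Rintegral => x /set_mem xI.
    rewrite indicE; have [xS|xS] := boolP (x \in S); first by rewrite /=; ring.
    by rewrite (fS x xI) /=; [ring|move=> Sx; move: xS; rewrite mem_set].
  rewrite (@RintegralD _ _ _ mu I01 (fun x => f x ^+ 2)
    (fun x => - (2 * t) * f x + t ^+ 2 * \1_S x) measurable_I01 i2
    (integrableD measurable_I01 itm itS)).
  rewrite (@RintegralD _ _ _ mu I01 (fun x => - (2 * t) * f x)
    (fun x => t ^+ 2 * \1_S x) measurable_I01 itm itS).
  rewrite (@RintegralZl _ _ _ mu I01 f _ measurable_I01 i1).
  rewrite (@RintegralZl _ _ _ mu I01 (\1_S) _ measurable_I01 iS).
  rewrite -/m => h; apply: le_trans h _; rewrite lerD2l lerD2l.
  by rewrite ler_wpM2l// sqr_ge0.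
have -> : (\int[mu]_(x in I01) (f x ^+ 2)%:E =
   (\int[mu]_(x in I01) (f x ^+ 2))%:E)%E.
  by rewrite /Rintegral fineK//; apply: integrable_fin_num => //; exact: measurable_I01.
rewrite -EFinM lee_fin.
have e : s * (\int[mu]_(x in I01) (f x ^+ 2) + (- (2 * t) * m + t ^+ 2 * s)) =
   s * \int[mu]_(x in I01) (f x ^+ 2) - m ^+ 2.
  by rewrite /t; field; rewrite gt_eqF.
by rewrite -subr_ge0 -e mulr_ge0// ltW.
Qed.
End CauchySchwarz.

(** * Real and imaginary components of complex matrices *)

Section Components.
Context (R : realType).
Notation C := R[i].
Notation sq := (@square R).

(** Integrability, continuity and integrals of complex matrix functions are all
    componentwise, so they are reduced to real functions indexed by a boolean. *)
Definition cp (b : bool) (z : C) : R := (if b then @complex.Re R else @complex.Im R) z.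

Lemma cpD b z w : cp b (z + w) = cp b z + cp b w.
Proof. by case: b; case: z => ? ?; case: w => ? ?. Qed.

Lemma cpB b z w : cp b (z - w) = cp b z - cp b w.
Proof. by case: b; case: z => ? ?; case: w => ? ?. Qed.

Lemma cp0 b : cp b 0 = 0.
Proof. by case: b. Qed.

Lemma cp_sum b (I : Type) (r : seq I) (P : pred I) (F : I -> C) :
  cp b (\sum_(i <- r | P i) F i) = \sum_(i <- r | P i) cp b (F i).
Proof. by apply: (big_morph (cp b)) => [x y|]; [exact: cpD|exact: cp0]. Qed.

Lemma cpM b z w : cp b (z * w) =
  if b then cp true z * cp true w - cp false z * cp false w
  else cp true z * cp false w + cp false z * cp true w.
Proof. by case: b; case: z => ? ?; case: w => ? ?. Qed.

Lemma complex_cp z : z = (cp true z +i* cp false z)%C.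
Proof. by case: z. Qed.

Lemma complexP z w : (forall b, cp b z = cp b w) -> z = w.
Proof. by move=> h; rewrite (complex_cp z) (complex_cp w) !h. Qed.

Definition nrm (z : C) : R := ComplexField.Normc.normc z.

Lemma nrmE z : nrm z ^+ 2 = cp true z ^+ 2 + cp false z ^+ 2.
Proof. by case: z => a b; rewrite /nrm/= sqr_sqrtr// addr_ge0 ?sqr_ge0. Qed.

Lemma nrm_ge0 z : 0 <= nrm z.
Proof. by case: z => a b; rewrite sqrtr_ge0. Qed.

Lemma normC_nrm (z : C) : `|z| = (nrm z)%:C%C.
Proof. by []. Qed.

Lemma cp_le_nrm b z : `|cp b z| <= nrm z.
Proof.
rewrite -(@ler_pXn2r _ 2)// ?nnegrE ?nrm_ge0// real_normK ?num_real// nrmE.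
by case: b; rewrite ?lerDl ?lerDr sqr_ge0.
Qed.

Lemma nrm_le_cp z e : (forall b, `|cp b z| <= e) -> nrm z <= 2 * e.
Proof.
move=> h; have e0 : 0 <= e by apply: le_trans (h true).
rewrite -(@ler_pXn2r _ 2)// ?nnegrE ?nrm_ge0 ?mulr_ge0// nrmE.
have sqle b : cp b z ^+ 2 <= e ^+ 2.
  by rewrite -real_normK ?num_real// ler_pXn2r// ?nnegrE.
have := sqle true; have := sqle false; have := sqr_ge0 e; lra.
Qed.

Definition ccont (f : R * R -> C) : Prop :=
  forall b, {within sq, continuous (cp b \o f)}.

Lemma cball (z w : C^o) (e : C) : ball z e w = (`|z - w| < e) :> Prop.
Proof. by []. Qed.

Lemma mx_continuousP m n (A : R * R -> 'M[C]_(m, n)) :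
  mx_continuous A <-> forall i j, ccont (fun k => A k i j).
Proof.
split=> [cA i j b x|cA x].
  apply/cvgrPdist_lt => e e0.
  have /cvg_ballP := cA x => /(_ (e%:C)%C).
  rewrite ltcR => /(_ e0); apply: filterS => y [_ /(_ i j)] xy.
  rewrite /from_subspace /= -cpB; apply: le_lt_trans (cp_le_nrm _ _) _.
  by move: xy; rewrite cball normC_nrm ltcR.
rewrite /continuous_at; apply/cvg_ballP => e e0.
have : \forall y \near (x : subspace sq), forall i j b, `|cp b (A x i j) - cp b (A y i j)| < (complex.Re e) / 4.
  have e0' : 0 < complex.Re e / 4.
    by apply: divr_gt0 => //; move: e0; case: (e) => a b; rewrite ltcE/= => /andP[].
  apply: filter_forall => i; apply: filter_forall => j; apply: filter_forall => b.
  by have /cvgrPdist_lt := cA i j b x; exact.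
apply: filterS => y h; split=> // i j; rewrite cball normC_nrm.
have : nrm (A x i j - A y i j) <= 2 * (complex.Re e / 4).
  by apply: nrm_le_cp => b; rewrite cpB ltW.
move: e0; case: (e) => a b; rewrite !ltcE/= => /andP[/eqP -> a0] h2.
by rewrite eqxx/=; apply: le_lt_trans h2 _; lra.
Qed.
End Components.

(** * Continuous matrix functions on the square *)

Section ContinuousOnSquare.
Context (R : realType).
Notation C := R[i].
Notation sq := (@square R).
Notation I01 := (@unit_itv R).
Notation mu := (@lebesgue_measure R).

Lemma compact_square : compact (sq : set (R * R)).
Proof. by apply: compact_setX; exact: segment_compact. Qed.

(** Every open set of the plane is the union of the countably many boxes with
    rational corners that it contains. *)
Lemma open_measurable_prod (U : set (R * R)) : open U -> measurable U.
Proof.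
move=> oU.
pose box (q : (rat * rat) * (rat * rat)) : set (R * R) :=
  `]ratr q.1.1, ratr q.1.2[ `*` `]ratr q.2.1, ratr q.2.2[.
have -> : U = \bigcup_(q in setT) (if `[< box q `<=` U >] then box q else set0).
  apply/seteqP; split => [p Up|p [q _]]; last by case: asboolP => // h /h.
  have /nbhs_ballP[e /= e0 eU] := open_nbhs_nbhs (conj oU Up).
  have rl (x : R) : exists q : rat, ratr q \in `]x - e, x[.
    by apply: rat_in_itvoo; rewrite ltrBlDr ltrDl.
  have rr (x : R) : exists q : rat, ratr q \in `]x, x + e[.
    by apply: rat_in_itvoo; rewrite ltrDl.
  have [a1 a1P] := rl p.1; have [b1 b1P] := rr p.1.
  have [a2 a2P] := rl p.2; have [b2 b2P] := rr p.2.
  move: a1P b1P a2P b2P; rewrite !in_itv/= => /andP[? ?] /andP[? ?] /andP[? ?] /andP[? ?].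
  exists ((a1, b1), (a2, b2)) => //.
  case: asboolP => [_|]; first by split => /=; rewrite in_itv/=; apply/andP.
  move=> []; move=> y [/=]; rewrite !in_itv/= => /andP[? ?] /andP[? ?].
  by apply: eU; split; rewrite /ball/= ltr_distlC; apply/andP; split; lra.
apply: countable_bigcupT_measurable; first exact: countableP.
move=> q; case: asboolP => // _; apply: measurableX; exact: measurable_itv.
Qed.

Lemma rcont_measurable (f : R * R -> R) :
  {within sq, continuous f} -> measurable_fun sq f.
Proof.
move=> /continuousP cf; apply: (measurability _ (RGenOpens.measurableE R)).
move=> _ [_ [a [b ->] <-]].
have : open (from_subspace sq f @^-1` `]a, b[) by exact/cf/interval_open.
move=> /open_subspaceP[V oV VD]; rewrite setIC -[X in measurable X]VD; apply: measurableI; last exact: measurable_square.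
exact: open_measurable_prod.
Qed.

Lemma rcont_bounded (f : R * R -> R) : {within sq, continuous f} ->
  exists2 c, 0 < c & forall k, sq k -> `|f k| <= c.
Proof.
move=> cf; have /compact_bounded[N [_ h]] := continuous_compact cf compact_square.
exists (`|N| + 1) => [|k kD]; first by rewrite ltr_wpDl.
apply: (h (`|N| + 1)); last by exists k.
by rewrite ltr_pwDr// ler_norm.
Qed.

(** Uniform continuity, from the covering form of compactness: near a point [x],
    two applications of continuity at [x] compare [f k] with [f l]. *)
Lemma heine (f : R * R -> R) : {within sq, continuous f} ->
  forall e, 0 < e -> exists2 d, 0 < d & forall k l, sq k -> sq l ->
    `|k.1 - l.1| < d -> `|k.2 - l.2| < d -> `|f k - f l| < e.
Proof.
move=> /subspace_continuousP cf e e0.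
have e20 : 0 < e / 2 by rewrite divr_gt0.
have /near_covering_withinP ncov : near_covering (sq : set (R * R)).
  exact/compact_near_coveringP/compact_square.
have := ncov R (0^'+) (fun d k => forall l, sq l ->
  `|k.1 - l.1| < d -> `|k.2 - l.2| < d -> `|f k - f l| < e) _.
case=> [x xD|d0 d0_gt0 dP].
  have /cvgrPdist_lt/(_ _ e20) := cf x xD.
  rewrite near_withinE => /nbhs_ballP[r /= r0 rP].
  have r20 : 0 < r / 2 by rewrite divr_gt0.
  exists (ball x (r / 2), [set d | d < r / 2]) => /=.
    by split; [exact: nbhsx_ballx|exact: nbhs_right_lt].
  move=> [y d] /= [[xy1 xy2] dr] yD l lD l1 l2.
  have fy : `|f x - f y| < e / 2.
    apply: rP => //; split; rewrite /ball/=.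
      by apply: lt_trans xy1 _; lra.
    by apply: lt_trans xy2 _; lra.
  have fl : `|f x - f l| < e / 2.
    apply: rP => //; split; rewrite /ball/=.
      by rewrite -(subrKA y.1); apply: le_lt_trans (ler_normD _ _) _;
        move: xy1; rewrite /ball/= => xy1; lra.
    by rewrite -(subrKA y.2); apply: le_lt_trans (ler_normD _ _) _;
        move: xy2; rewrite /ball/= => xy2; lra.
  rewrite -(subrKA (f x)); apply: le_lt_trans (ler_normD _ _) _.
  by rewrite (distrC (f y)); lra.
exists (d0 / 2); first by rewrite divr_gt0.
move=> k l kD lD k1 k2; apply: (dP (d0 / 2)) => //.
  by rewrite /ball_/= sub0r normrN gtr0_norm ?divr_gt0// gtr_pMr// invf_lt1// ltr1n.
by rewrite divr_gt0.
Qed.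

Lemma uniform_rcont (f : R * R -> R) :
  (forall e, 0 < e -> exists2 d, 0 < d & forall k l, sq k -> sq l ->
    `|k.1 - l.1| < d -> `|k.2 - l.2| < d -> `|f k - f l| <= e) ->
  {within sq, continuous f}.
Proof.
move=> h; apply/subspace_continuousP => x xD; apply/cvgrPdist_le => e e0.
have [d d0 dP] := h e e0; rewrite near_withinE.
by apply/nbhs_ballP; exists d => //= y [xy1 xy2] yD; apply: dP.
Qed.

Lemma eq_ccont (f g : R * R -> C) : (forall k, sq k -> f k = g k) -> ccont f -> ccont g.
Proof.
move=> fg cf b; apply: subspace_eq_continuous (cf b) => k /set_mem kD.
by rewrite /from_subspace /= fg.
Qed.

Lemma ccont_cst (z : C) : ccont (fun=> z).
Proof. by move=> b x; exact: cvg_cst. Qed.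

Lemma ccontD (f g : R * R -> C) : ccont f -> ccont g -> ccont (fun k => f k + g k).
Proof.
move=> cf cg b.
rewrite (_ : _ \o _ = fun k => cp b (f k) + cp b (g k)); last first.
  by apply/funext => k /=; rewrite cpD.
by move=> x; apply: cvgD; [exact: cf|exact: cg].
Qed.

Lemma ccontM (f g : R * R -> C) : ccont f -> ccont g -> ccont (fun k => f k * g k).
Proof.
move=> cf cg b.
have cM (b1 b2 : bool) : {within sq, continuous (fun k => cp b1 (f k) * cp b2 (g k))}.
  by move=> x; apply: cvgM; [exact: cf|exact: cg].
case: b.
  rewrite (_ : _ \o _ = fun k => cp true (f k) * cp true (g k)
    - cp false (f k) * cp false (g k)); last by apply/funext => k; rewrite [LHS]cpM.
  by move=> x; apply: cvgB; exact: cM.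
rewrite (_ : _ \o _ = fun k => cp true (f k) * cp false (g k)
    + cp false (f k) * cp true (g k)); last by apply/funext => k; rewrite [LHS]cpM.
by move=> x; apply: cvgD; exact: cM.
Qed.

Lemma ccont_sum (I : Type) (r : seq I) (F : I -> R * R -> C) :
  (forall i, ccont (F i)) -> ccont (fun k => \sum_(i <- r) F i k).
Proof.
move=> cF; elim: r => [|i r IH].
  by rewrite (_ : (fun k => _) = fun=> 0); [exact: ccont_cst|
    apply/funext => k; rewrite big_nil].
rewrite (_ : (fun k => _) = fun k => F i k + \sum_(j <- r) F j k).
  exact: ccontD.
by apply/funext => k; rewrite big_cons.
Qed.

Lemma ccont_prod (I : Type) (r : seq I) (F : I -> R * R -> C) :
  (forall i, ccont (F i)) -> ccont (fun k => \prod_(i <- r) F i k).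
Proof.
move=> cF; elim: r => [|i r IH].
  by rewrite (_ : (fun k => _) = fun=> 1); [exact: ccont_cst|
    apply/funext => k; rewrite big_nil].
rewrite (_ : (fun k => _) = fun k => F i k * \prod_(j <- r) F j k).
  exact: ccontM.
by apply/funext => k; rewrite big_cons.
Qed.

Lemma cpV b (z : C) : cp b z^-1 =
  (if b then cp true z else - cp false z) / (cp true z ^+ 2 + cp false z ^+ 2).
Proof. by case: z => x y; case: b => //=; rewrite mulNr. Qed.

Lemma ccontV (f : R * R -> C) : ccont f -> (forall k, sq k -> f k != 0) ->
  ccont (fun k => (f k)^-1).
Proof.
move=> cf f0 b.
rewrite (_ : _ \o _ = fun k => (if b then cp true (f k) else - cp false (f k)) *
  (cp true (f k) * cp true (f k) + cp false (f k) * cp false (f k))^-1); last first.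
  by apply/funext => k /=; rewrite cpV !expr2.
apply/subspace_continuousP => x xD.
have c b' : (fun k => cp b' (f k)) @ within sq (nbhs x) --> cp b' (f x).
  by have /subspace_continuousP := cf b'; exact.
apply: cvgM; first by case: (b); [exact: c|apply: cvgN; exact: c].
apply: cvgV; last by apply: cvgD; apply: cvgM; exact: c.
apply: contraNneq (f0 x xD) => /eqP.
rewrite -!expr2 paddr_eq0 ?sqr_ge0// !sqrf_eq0 => /andP[/eqP fr /eqP fi].
by apply/eqP/complexP => -[]; rewrite ?fr ?fi.
Qed.

Lemma mx_continuousM m n p (A : R * R -> 'M[C]_(m, n)) (B : R * R -> 'M[C]_(n, p)) :
  mx_continuous A -> mx_continuous B -> mx_continuous (fun k => A k *m B k).
Proof.
move=> /mx_continuousP cA /mx_continuousP cB; apply/mx_continuousP => i j.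
rewrite (_ : (fun k => _) = fun k => \sum_l A k i l * B k l j); last first.
  by apply/funext => k; rewrite mxE.
by apply: ccont_sum => l; apply: ccontM; [exact: cA|exact: cB].
Qed.

Lemma mx_continuousD m n (A B : R * R -> 'M[C]_(m, n)) :
  mx_continuous A -> mx_continuous B -> mx_continuous (fun k => A k + B k).
Proof.
move=> /mx_continuousP cA /mx_continuousP cB; apply/mx_continuousP => i j.
rewrite (_ : (fun k => _) = fun k => A k i j + B k i j); last first.
  by apply/funext => k; rewrite mxE.
by apply: ccontD; [exact: cA|exact: cB].
Qed.

Lemma mx_continuous_cst m n (A : 'M[C]_(m, n)) : mx_continuous (fun=> A).
Proof. by apply/mx_continuousP => i j; exact: ccont_cst. Qed.

Lemma eq_mx_continuous m n (A B : R * R -> 'M[C]_(m, n)) :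
  (forall k, sq k -> A k = B k) -> mx_continuous A -> mx_continuous B.
Proof.
move=> AB /mx_continuousP cA; apply/mx_continuousP => i j.
by apply: eq_ccont (cA i j) => k kD; rewrite AB.
Qed.

Lemma ccont_det n (A : R * R -> 'M[C]_n) :
  mx_continuous A -> ccont (fun k => \det (A k)).
Proof.
move=> /mx_continuousP cA; rewrite /determinant.
apply: ccont_sum => s; apply: ccontM; first exact: ccont_cst.
by apply: ccont_prod => i; exact: cA.
Qed.

(** Cramer's rule gives the inverse as a continuous expression wherever the
    determinant does not vanish. *)
Lemma mx_continuousV n (A : R * R -> 'M[C]_n) : mx_continuous A ->
  (forall k, sq k -> \det (A k) != 0) -> mx_continuous (fun k => invmx (A k)).
Proof.
move=> cA dA; have /mx_continuousP ceA := cA.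
apply: (@eq_mx_continuous _ _ (fun k => (\det (A k))^-1 *: \adj (A k))).
  by move=> k kD; rewrite /invmx unitmxE unitfE dA.
apply/mx_continuousP => i j.
rewrite (_ : (fun k => _) = fun k => (\det (A k))^-1 * cofactor (A k) j i); last first.
  by apply/funext => k; rewrite !mxE.
apply: ccontM; first by apply: ccontV => //; exact: ccont_det.
apply: ccontM; first exact: ccont_cst.
apply: ccont_det; apply/mx_continuousP => i' j'.
rewrite (_ : (fun k => _) = fun k => A k (lift j i') (lift i j')); first exact: ceA.
by apply/funext => k; rewrite !mxE.
Qed.

Definition mx_bounded m n (A : R * R -> 'M[C]_(m, n)) (c : R) : Prop :=
  forall k, sq k -> forall i j, nrm (A k i j) <= c.

Lemma mx_continuous_bounded m n (A : R * R -> 'M[C]_(m, n)) :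
  mx_continuous A -> exists2 c, 0 <= c & mx_bounded A c.
Proof.
move=> /mx_continuousP cA.
have /choice[c cP] (ijb : 'I_m * 'I_n * bool) :
    exists c, forall k, sq k -> `|cp ijb.2 (A k ijb.1.1 ijb.1.2)| <= c.
  by have [c _ cP] := rcont_bounded (cA ijb.1.1 ijb.1.2 ijb.2); exists c.
exists (2 * \sum_ijb `|c ijb|).
  by rewrite mulr_ge0// sumr_ge0.
move=> k kD i j; apply: nrm_le_cp => b.
apply: le_trans (cP (i, j, b) k kD) _; rewrite (bigD1 (i, j, b))//=.
by rewrite (le_trans (ler_norm _))// lerDl sumr_ge0.
Qed.

Lemma ccont_inner_integral b (f : R * R -> C) (p : bool) : ccont f ->
  {within sq, continuous (fun k => \int[mu]_(x in I01) cp p (f (pt b x (oc b k))))}.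
Proof.
move=> cf; apply: uniform_rcont => e e0.
have [d d0 dP] := heine (cf p) e0.
have mf := rcont_measurable (cf p); have [c c0 cP] := rcont_bounded (cf p).
have intf y : I01 y ->
    mu.-integrable I01 (EFin \o (fun x => cp p (f (pt b x y)))).
  move=> Iy; apply: measurable_bounded_integrable.
  - exact: measurable_I01.
  - by rewrite [X in (X < _)%E]mu_I01 ltry.
  - exact: (measurable_slice b mf Iy).
  - exists c; split; first exact: num_real.
    by move=> M cM x Ix; apply: le_trans (ltW cM); apply: cP; exact/square_pt.
exists d => // k l kD lD k1 k2.
have Ik := square_oc b kD; have Il := square_oc b lD.
rewrite -(@RintegralB _ _ _ mu I01 _ _ measurable_I01 (intf _ Ik) (intf _ Il)).
apply: le_trans (le_normr_Rintegral measurable_I01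
  (integrableB measurable_I01 (intf _ Ik) (intf _ Il))) _.
have intc : mu.-integrable I01 (EFin \o (fun=> e)).
  apply: measurable_bounded_integrable.
  - exact: measurable_I01.
  - by rewrite [X in (X < _)%E]mu_I01 ltry.
  - exact: measurable_cst.
  - exists `|e|; split; first exact: num_real.
    by move=> M cM x Ix /=; exact: ltW.
have -> : e = \int[mu]_(x in I01) e.
  by rewrite (Rintegral_cst _ measurable_I01) [X in fine X]mu_I01 mulr1.
apply: (le_Rintegral measurable_I01 _ intc) => [|x Ix].
  apply: (@integrable_norm _ _ _ mu I01 _) => //; exact: (integrableB measurable_I01 (intf _ Ik) (intf _ Il)).
apply/ltW/dP; [exact/square_pt|exact/square_pt|..].
- by case: (b) k1 k2 => /=; rewrite ?subrr ?normr0.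
- by case: (b) k1 k2 => /=; rewrite ?subrr ?normr0.
Qed.

(** Uniform continuity is inherited by partial integrals; this is what makes the
    symbols [E1] and [E2] continuous. *)
Lemma mx_continuous_inner b m n (A : R * R -> 'M[C]_(m, n)) : mx_continuous A ->
  mx_continuous (fun k => integral01 (fun x => A (pt b x (oc b k)))).
Proof.
move=> /mx_continuousP cA; apply/mx_continuousP => i j p.
apply: (subspace_eq_continuous _ (@ccont_inner_integral b _ p (cA i j))) => k _.
by rewrite /from_subspace /= mxE; case: p.
Qed.

End ContinuousOnSquare.

(** * Integrals of matrix-valued functions *)

Section MatrixIntegrals.
Context (R : realType).
Notation C := R[i].
Notation sq := (@square R).
Notation I01 := (@unit_itv R).
Notation mu := (@lebesgue_measure R).
Notation mu2 := (lebesgue2 R).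

Lemma Rintegral_sum d (T : measurableType d) (nu : {measure set T -> \bar R})
    (D : set T) (I : Type) (r : seq I) (F : I -> T -> R) : measurable D ->
  (forall i, nu.-integrable D (EFin \o F i)) ->
  \int[nu]_(x in D) (\sum_(i <- r) F i x) = \sum_(i <- r) \int[nu]_(x in D) F i x.
Proof.
move=> mD intF; elim: r => [|i r IH].
  rewrite big_nil; under eq_Rintegral do rewrite big_nil.
  by rewrite Rintegral_cst// mul0r.
rewrite big_cons -IH -RintegralD//.
  by apply: eq_Rintegral => x _; rewrite big_cons.
have := integrable_sum mD r (fun i _ => intF i) (P := predT).
by apply: eq_integrable => // x _ /=; rewrite sumEFin.
Qed.

Lemma integrable_finsum d (T : measurableType d) (nu : {measure set T -> \bar R})
    (D : set T) (I : Type) (r : seq I) (F : I -> T -> R) : measurable D ->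
  (forall i, nu.-integrable D (EFin \o F i)) ->
  nu.-integrable D (EFin \o (fun x => \sum_(i <- r) F i x)).
Proof.
move=> mD intF.
have := integrable_sum mD r (fun i _ => intF i) (P := predT).
by apply: eq_integrable => // x _ /=; rewrite sumEFin.
Qed.

Lemma integrable_bounded_mul d (T : measurableType d) (nu : {measure set T -> \bar R})
    (D : set T) (g f : T -> R) (c : R) : measurable D ->
  measurable_fun D g -> (forall x, D x -> `|g x| <= c) ->
  nu.-integrable D (EFin \o f) -> nu.-integrable D (EFin \o (fun x => g x * f x)).
Proof.
move=> mD mg gc intf.
have mf : measurable_fun D f by apply/measurable_EFinP; exact: measurable_int intf.
apply: (le_integrable mD _ _ (integrableZl mD c intf)).
  by apply/measurable_EFinP; exact: measurable_funM.
move=> x Dx /=; rewrite lee_fin !normrM ler_wpM2r//.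
by apply: le_trans (gc x Dx) (ler_norm _).
Qed.

Definition mmeas d (T : measurableType d) (D : set T) m n (F : T -> 'M[C]_(m, n)) : Prop :=
  forall i j b, measurable_fun D (fun x => cp b (F x i j)).

Definition mint d (T : measurableType d) (nu : {measure set T -> \bar R})
    (D : set T) m n (F : T -> 'M[C]_(m, n)) : Prop :=
  forall i j b, nu.-integrable D (EFin \o (fun x => cp b (F x i j))).

Lemma cp_mx_integral d (T : measurableType d) (nu : {measure set T -> \bar R})
    (D : set T) m n (F : T -> 'M[C]_(m, n)) b i j :
  cp b (mx_integral nu D F i j) = \int[nu]_(x in D) cp b (F x i j).
Proof. by rewrite mxE; case: b. Qed.

Lemma eq_mx_integral d (T : measurableType d) (nu : {measure set T -> \bar R})
    (D : set T) m n (F G : T -> 'M[C]_(m, n)) : (forall x, D x -> F x = G x) ->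
  mx_integral nu D F = mx_integral nu D G.
Proof.
move=> FG; apply/matrixP => i j; apply: complexP => b.
by rewrite !cp_mx_integral; apply: eq_Rintegral => x /set_mem Dx; rewrite FG.
Qed.

Section Mul.
Context d (T : measurableType d) (nu : {measure set T -> \bar R}) (D : set T).
Hypothesis mD : measurable D.

Lemma mmeasM m n p (F : T -> 'M[C]_(m, n)) (G : T -> 'M[C]_(n, p)) :
  mmeas D F -> mmeas D G -> mmeas D (fun x => F x *m G x).
Proof.
move=> mF mG i j b.
under eq_fun do rewrite mxE cp_sum.
apply: measurable_sum => l; under eq_fun do rewrite cpM.
by case: b; [apply: measurable_funB|apply: measurable_funD]; apply: measurable_funM.
Qed.

Lemma mmeas_cst m n (A : 'M[C]_(m, n)) : mmeas D (fun=> A).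
Proof. by move=> i j b; exact: measurable_cst. Qed.

Lemma mint_mul_comp m n p (F : T -> 'M[C]_(m, n)) (G : T -> 'M[C]_(n, p)) :
  (forall i l j b b', nu.-integrable D (EFin \o (fun x => cp b (F x i l) * cp b' (G x l j)))) ->
  mint nu D (fun x => F x *m G x).
Proof.
move=> iFG i j b.
have h l : nu.-integrable D (EFin \o (fun x => cp b (F x i l * G x l j))).
  case: b.
    have := integrableB mD (iFG i l j true true) (iFG i l j false false).
    by apply: eq_integrable => // x _; rewrite /comp cpM EFinB.
  have := integrableD mD (iFG i l j true false) (iFG i l j false true).
  by apply: eq_integrable => // x _; rewrite /comp cpM EFinD.
have := integrable_finsum (index_enum _) mD h.
by apply: eq_integrable => // x _; rewrite /comp mxE cp_sum.
Qed.

Lemma mint_boundedM m n p (F : T -> 'M[C]_(m, n)) (G : T -> 'M[C]_(n, p)) c :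
  mmeas D F -> (forall x, D x -> forall i j, nrm (F x i j) <= c) ->
  mint nu D G -> mint nu D (fun x => F x *m G x).
Proof.
move=> mF Fc iG; apply: mint_mul_comp => i l j b b'.
apply: (integrable_bounded_mul mD _ _ (iG _ _ _)) => // x Dx.
exact: le_trans (cp_le_nrm _ _) (Fc _ Dx _ _).
Qed.

Lemma mint_constM m n p (A : 'M[C]_(m, n)) (G : T -> 'M[C]_(n, p)) :
  mint nu D G -> mint nu D (fun x => A *m G x).
Proof.
apply: (@mint_boundedM _ _ _ (fun=> A) G (\sum_i \sum_j nrm (A i j))).
  exact: mmeas_cst.
move=> _ _ i j; rewrite (bigD1 i)//= (bigD1 j)//= -addrA lerDl.
by rewrite addr_ge0// ?sumr_ge0// => *; rewrite ?sumr_ge0// => *; exact: nrm_ge0.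
Qed.

Lemma mx_integralD m n (F G : T -> 'M[C]_(m, n)) :
  mint nu D F -> mint nu D G ->
  mx_integral nu D (fun x => F x + G x) = mx_integral nu D F + mx_integral nu D G.
Proof.
move=> iF iG; apply/matrixP => i j; apply: complexP => b.
rewrite [in RHS]mxE cpD !cp_mx_integral -(RintegralD mD (iF i j b) (iG i j b)).
by apply: eq_Rintegral => x _; rewrite mxE cpD.
Qed.

Lemma mx_integralB m n (F G : T -> 'M[C]_(m, n)) :
  mint nu D F -> mint nu D G ->
  mx_integral nu D (fun x => F x - G x) = mx_integral nu D F - mx_integral nu D G.
Proof.
move=> iF iG; apply/matrixP => i j; apply: complexP => b.
have subE (X Y : 'M[C]_(m, n)) : (X - Y) i j = X i j - Y i j by rewrite !mxE.
rewrite subE cpB !cp_mx_integral.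
rewrite -(RintegralB mD (iF i j b) (iG i j b)).
by apply: eq_Rintegral => x _; rewrite !mxE cpB.
Qed.

Let int_mulcp (z : C) (f : T -> C) b :
  (forall b, nu.-integrable D (EFin \o (fun x => cp b (f x)))) ->
  \int[nu]_(x in D) cp b (z * f x) =
  cp b (z * ((\int[nu]_(x in D) cp true (f x)) +i* (\int[nu]_(x in D) cp false (f x)))%C).
Proof.
move=> intf.
have iZ c b' := integrableZl mD c (intf b').
rewrite [RHS]cpM; case: b.
  rewrite -(RintegralZl _ mD (intf true)) -(RintegralZl _ mD (intf false)).
  rewrite -(RintegralB mD (iZ _ _) (iZ _ _)).
  by apply: eq_Rintegral => x _; rewrite [LHS]cpM.
rewrite -(RintegralZl _ mD (intf false)) -(RintegralZl _ mD (intf true)).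
rewrite -(RintegralD mD (iZ _ _) (iZ _ _)).
by apply: eq_Rintegral => x _; rewrite [LHS]cpM.
Qed.

Lemma mx_integral_constM m n p (A : 'M[C]_(m, n)) (G : T -> 'M[C]_(n, p)) :
  mint nu D G ->
  mx_integral nu D (fun x => A *m G x) = A *m mx_integral nu D G.
Proof.
move=> iG; apply/matrixP => i j; apply: complexP => b.
rewrite cp_mx_integral mxE cp_sum.
have iz l : nu.-integrable D (EFin \o (fun x => cp b (A i l * G x l j))).
  case: b.
    have := integrableB mD (integrableZl mD (cp true (A i l)) (iG l j true))
                           (integrableZl mD (cp false (A i l)) (iG l j false)).
    by apply: eq_integrable => // x _; rewrite /comp cpM.
  have := integrableD mD (integrableZl mD (cp true (A i l)) (iG l j false))
                         (integrableZl mD (cp false (A i l)) (iG l j true)).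
  by apply: eq_integrable => // x _; rewrite /comp cpM.
transitivity (\int[nu]_(x in D) \sum_l cp b (A i l * G x l j)).
  by apply: eq_Rintegral => x _; rewrite mxE cp_sum.
rewrite (Rintegral_sum _ mD iz); apply: eq_bigr => l _.
by rewrite (int_mulcp _ _ (iG l j)) mxE.
Qed.

Lemma mx_integral_Mconst m n p (A : 'M[C]_(n, p)) (F : T -> 'M[C]_(m, n)) :
  mint nu D F ->
  mx_integral nu D (fun x => F x *m A) = mx_integral nu D F *m A.
Proof.
move=> iF; apply: trmx_inj; rewrite trmx_mul.
have iFT : mint nu D (fun x => (F x)^T).
  by move=> i j b; have := iF j i b; apply: eq_integrable => // x _; rewrite /comp mxE.
have trI m' n' (H : T -> 'M[C]_(m', n')) :
    (mx_integral nu D H)^T = mx_integral nu D (fun x => (H x)^T).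
  apply/matrixP => i j; apply: complexP => b; rewrite mxE !cp_mx_integral.
  by apply: eq_Rintegral => x _; rewrite mxE.
rewrite !trI -(mx_integral_constM _ iFT); apply: eq_mx_integral => x _.
by rewrite trmx_mul.
Qed.

End Mul.

Lemma mmeas_slice b m n (F : R * R -> 'M[C]_(m, n)) y : mmeas sq F -> I01 y ->
  mmeas I01 (fun x => F (pt b x y)).
Proof. by move=> mF Iy i j c; exact: (measurable_slice b (mF i j c) Iy). Qed.

Lemma mx_continuous_mmeas m n (A : R * R -> 'M[C]_(m, n)) :
  mx_continuous A -> mmeas sq A.
Proof.
by move=> /mx_continuousP cA i j b; apply: rcont_measurable; exact: cA.
Qed.

Lemma measurable_inner_Rintegral b (f : R * R -> R) : measurable_fun sq f ->
  measurable_fun I01 (fun y => \int[mu]_(x in I01) f (pt b x y)).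
Proof.
move=> mf; apply: (measurableT_comp (f := fine)) => //.
by apply: (@measurable_inner_integral _ b (EFin \o f)); exact/measurable_EFinP.
Qed.

Lemma integral_inner_fine b (f : R * R -> R) : mu2.-integrable sq (EFin \o f) ->
  {ae mu, forall y, I01 y -> (\int[mu]_(x in I01) f (pt b x y))%:E =
     (\int[mu]_(x in I01) (f (pt b x y))%:E)%E}.
Proof.
move=> intf; have := ae_integrable_slice b intf.
apply: filterS => y h Iy; rewrite /Rintegral fineK//.
by apply: integrable_fin_num; [exact: measurable_I01|exact: h].
Qed.

Lemma integrable_inner_Rintegral b (f : R * R -> R) :
  mu2.-integrable sq (EFin \o f) ->
  mu.-integrable I01 (EFin \o (fun y => \int[mu]_(x in I01) f (pt b x y))).
Proof.
move=> intf; have inti := integrable_inner_integral b intf.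
have mf : measurable_fun sq f by apply/measurable_EFinP; exact: measurable_int intf.
have mi : measurable_fun I01 (EFin \o (fun y => \int[mu]_(x in I01) f (pt b x y))).
  by apply/measurable_EFinP; exact: measurable_inner_Rintegral.
apply/integrableP; split => //.
apply: le_lt_trans (integrableP _ _ _ inti).2; rewrite le_eqVlt; apply/orP; left.
apply/eqP; apply: ae_eq_integral; first exact: measurable_I01.
- exact: measurableT_comp.
- apply: measurableT_comp => //; exact: measurable_int inti.
- by have := integral_inner_fine b intf; apply: filterS => y h Iy; rewrite /comp h.
Qed.

Lemma fubini_Rsquare b (f : R * R -> R) : mu2.-integrable sq (EFin \o f) ->
  \int[mu2]_(k in sq) f k = \int[mu]_(y in I01) \int[mu]_(x in I01) f (pt b x y).
Proof.
move=> intf; rewrite {1 2}/Rintegral (fubini_square b intf); congr fine.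
have mf : measurable_fun sq f by apply/measurable_EFinP; exact: measurable_int intf.
apply: ae_eq_integral; first exact: measurable_I01.
- by apply: measurable_int; exact: integrable_inner_integral intf.
- by apply/measurable_EFinP; exact: measurable_inner_Rintegral.
- by have := integral_inner_fine b intf; apply: filterS => y h Iy; rewrite -h.
Qed.

Lemma mmeas_inner b m n (F : R * R -> 'M[C]_(m, n)) : mmeas sq F ->
  mmeas I01 (fun y => integral01 (fun x => F (pt b x y))).
Proof.
move=> mF i j c; under eq_fun do rewrite cp_mx_integral.
exact: (measurable_inner_Rintegral b (mF i j c)).
Qed.

Lemma mint_inner b m n (F : R * R -> 'M[C]_(m, n)) : mint mu2 sq F ->
  mint mu I01 (fun y => integral01 (fun x => F (pt b x y))).
Proof.
move=> mF i j c; have := integrable_inner_Rintegral b (mF i j c).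
by apply: eq_integrable => [|x _]; [exact: measurable_I01|rewrite /comp cp_mx_integral].
Qed.

Lemma ae_mint_slice b m n (F : R * R -> 'M[C]_(m, n)) : mint mu2 sq F ->
  {ae mu, forall y, I01 y -> mint mu I01 (fun x => F (pt b x y))}.
Proof.
move=> iF.
have : {ae mu, forall y, forall i j c, I01 y ->
    mu.-integrable I01 (fun x => (EFin \o (fun k => cp c (F k i j))) (pt b x y))}.
  apply: filter_forall => i; apply: filter_forall => j; apply: filter_forall => c.
  exact: (ae_integrable_slice b (iF i j c)).
by apply: filterS => y h Iy i j c; exact: h.
Qed.

Lemma fubini_mx b m n (F : R * R -> 'M[C]_(m, n)) : mint mu2 sq F ->
  mx_integral mu2 sq F = integral01 (fun y => integral01 (fun x => F (pt b x y))).
Proof.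
move=> iF; apply/matrixP => i j; apply: complexP => c.
rewrite !cp_mx_integral (fubini_Rsquare b (iF i j c)).
by apply: eq_Rintegral => y _; rewrite cp_mx_integral.
Qed.

Lemma ae_eq_mx_integral d (T : measurableType d) (nu : {measure set T -> \bar R})
    (D : set T) m n (F G : T -> 'M[C]_(m, n)) : measurable D ->
  mmeas D F -> mmeas D G -> {ae nu, forall x, D x -> F x = G x} ->
  mx_integral nu D F = mx_integral nu D G.
Proof.
move=> mD mF mG FG; apply/matrixP => i j; apply: complexP => b.
rewrite !cp_mx_integral; congr fine; apply: ae_eq_integral => //.
- by apply/measurable_EFinP; exact: mF.
- by apply/measurable_EFinP; exact: mG.
- have [N [mN N0 NP]] := FG; exists N; split => //.
  by apply: subset_trans NP; apply: subsetC => x h /h ->.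
Qed.

End MatrixIntegrals.

(** * The squared Euclidean norm *)

Section VectorNorm.
Context (R : realType).
Notation C := R[i].

Definition nsq m (v : 'cV[C]_m) : R := \sum_i nrm (v i 0) ^+ 2.

Lemma nsq_ge0 m (v : 'cV[C]_m) : 0 <= nsq v.
Proof. by apply: sumr_ge0 => i _; exact: sqr_ge0. Qed.

Lemma nsq0 m : nsq (0 : 'cV[C]_m) = 0.
Proof. by apply: big1 => i _; rewrite mxE /nrm Normc.normc0 expr0n. Qed.

Lemma nsq_cp m (v : 'cV[C]_m) :
  nsq v = \sum_(p : 'I_m * bool) cp p.2 (v p.1 0) ^+ 2.
Proof.
rewrite -(pair_bigA _ (fun i b => cp b (v i 0) ^+ 2)) /=.
by apply: eq_bigr => i _; rewrite big_bool/= nrmE.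
Qed.

Lemma nrm_le_nsq m (v : 'cV[C]_m) i : nrm (v i 0) ^+ 2 <= nsq v.
Proof.
by rewrite /nsq (bigD1 i)//= lerDl sumr_ge0// => j _; exact: sqr_ge0.
Qed.

Lemma nrmD z w : nrm (z + w) <= nrm z + nrm w :> R.
Proof. exact: le_normcD. Qed.

Lemma nrmM z w : nrm (z * w) = nrm z * nrm w :> R.
Proof. exact: Normc.normcM. Qed.

Lemma nrm0 : nrm 0 = 0 :> R.
Proof. exact: Normc.normc0. Qed.

Lemma nrm_sum (I : Type) (r : seq I) (F : I -> C) :
  nrm (\sum_(i <- r) F i) <= \sum_(i <- r) nrm (F i).
Proof.
elim: r => [|i r IH]; first by rewrite !big_nil nrm0.
by rewrite !big_cons; apply: le_trans (nrmD _ _) _; rewrite lerD2l.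
Qed.

Lemma nsq_mulmx m n (A : 'M[C]_(m, n)) (v : 'cV[C]_n) c : 0 <= c ->
  (forall i j, nrm (A i j) <= c) ->
  nsq (A *m v) <= (m%:R * (n%:R * c) ^+ 2) * nsq v.
Proof.
move=> c0 Ac.
have h i : nrm ((A *m v) i 0) ^+ 2 <= (n%:R * c) ^+ 2 * nsq v.
  have s0 : 0 <= n%:R * c * Num.sqrt (nsq v).
    by rewrite !mulr_ge0 ?sqrtr_ge0.
  rewrite -[X in _ * X](sqr_sqrtr (nsq_ge0 v)) -exprMn.
  rewrite ler_pXn2r// ?nnegrE ?nrm_ge0//.
  rewrite mxE; apply: le_trans (nrm_sum _ _) _.
  rewrite -mulrA mulr_natl -[X in _ *+ X](card_ord n) -sumr_const.
  apply: ler_sum => j _; rewrite nrmM ler_pM ?nrm_ge0//.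
  rewrite -(@ler_pXn2r _ 2)// ?nnegrE ?nrm_ge0 ?sqrtr_ge0//.
  by rewrite sqr_sqrtr ?nsq_ge0// nrm_le_nsq.
rewrite /nsq -mulrA mulr_natl -[X in _ *+ X](card_ord m) -sumr_const.
by apply: ler_sum => i _; exact: h.
Qed.

End VectorNorm.

(** * Square-integrable functions and their classes *)

Section L2Functions.
Context (R : realType).
Notation C := R[i].
Notation sq := (@square R).
Notation mu2 := (lebesgue2 R).

Lemma measurable_nsq d (T : measurableType d) (D : set T) m (f : T -> 'cV[C]_m) :
  mmeas D f -> measurable_fun D (fun k => nsq (f k)).
Proof.
move=> mf; under eq_fun do rewrite nsq_cp.
by apply: measurable_sum => p; apply: measurable_funX; exact: mf.
Qed.

(** Square-integrability without reference to function spaces: the form in which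
    it can be checked by domination. *)
Lemma Lfun2_restrictP (f : R * R -> R) :
  f \_ sq \in Lfun mu2 2%:E <->
  measurable_fun sq f /\ (\int[mu2]_(k in sq) (f k ^+ 2)%:E < +oo)%E.
Proof.
have sqrE : (fun k => ((f \_ sq) k ^+ 2)%:E) = (fun k => (f k ^+ 2)%:E) \_ sq.
  by apply/funext => k; rewrite !patchE; case: ifP => //; rewrite expr0n.
have intE : (\int[mu2]_k ((f \_ sq) k ^+ 2)%:E =
             \int[mu2]_(k in sq) (f k ^+ 2)%:E)%E.
  by rewrite sqrE -integral_mkcond.
split=> [fL|[mf fin]].
  have mf : measurable_fun sq f.
    apply: (measurable_restrictT _ measurable_square).2.
    by have := sub_Lfun_mfun fL; rewrite inE.
  split => //; rewrite -intE.
  have /integrableP[_] := Lfun2_integrable_sqr fL.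
  apply: le_lt_trans; rewrite le_eqVlt; apply/orP; left; apply/eqP.
  by apply: eq_integral => k _ /=; rewrite ger0_norm// sqr_ge0.
have mf' : measurable_fun setT (f \_ sq).
  exact: (measurable_restrictT _ measurable_square).1.
rewrite inE; apply/andP; split; rewrite inE//=.
rewrite /finite_norm unlock; apply: poweR_lty.
apply: le_lt_trans fin; rewrite -intE le_eqVlt; apply/orP; left; apply/eqP.
by apply: eq_integral => k _ /=; rewrite powR_mulrn ?normr_ge0// real_normK ?num_real.
Qed.

Lemma is_L2P m (f : R * R -> 'cV[C]_m) :
  is_L2 f <-> mmeas sq f /\ (\int[mu2]_(k in sq) (nsq (f k))%:E < +oo)%E.
Proof.
have e : mmeas sq f -> (\int[mu2]_(k in sq) (nsq (f k))%:E =
    \sum_(p : 'I_m * bool) \int[mu2]_(k in sq) (cp p.2 (f k p.1 0) ^+ 2)%:E)%E.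
  move=> mf; rewrite -ge0_integral_sum.
  - by apply: eq_integral => k _; rewrite nsq_cp sumEFin.
  - exact: measurable_square.
  - by move=> p; apply/measurable_EFinP; apply: measurable_funX; exact: mf.
  - by move=> p k _; rewrite lee_fin sqr_ge0.
split=> [fL|[mf fin]].
  have h i b : measurable_fun sq (fun k => cp b (f k i 0)) /\
      (\int[mu2]_(k in sq) (cp b (f k i 0) ^+ 2)%:E < +oo)%E.
    by apply/Lfun2_restrictP; have [? ?] := fL i; case: b.
  have mf : mmeas sq f by move=> i j b; rewrite ord1; have [] := h i b.
  by split => //; rewrite e//; apply: lte_sum_pinfty => p _; have [] := h p.1 p.2.
have h i b : (fun k => cp b (f k i 0)) \_ sq \in Lfun mu2 2%:E.
  apply/Lfun2_restrictP; split; first exact: mf.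
  apply: le_lt_trans fin; rewrite e// (bigD1 (i, b))//= leeDl//.
  apply: sume_ge0 => p _; apply: integral_ge0 => k _.
  by rewrite lee_fin sqr_ge0.
by move=> i; split; [exact: (h i true)|exact: (h i false)].
Qed.

Lemma is_L2_mmeas m (f : R * R -> 'cV[C]_m) : is_L2 f -> mmeas sq f.
Proof. by move=> /is_L2P[]. Qed.

Lemma is_L2_rep m (u : L2 R m) : is_L2 (L2rep u).
Proof. by have /asboolP := L2fun_valP (repr u). Qed.

(** The default value in [toL2] is not reached on square-integrable functions. *)
Lemma toL2_val m (f : R * R -> 'cV[C]_m) : is_L2 f ->
  exists2 u : L2fun R m, L2fun_val u = f & toL2 f = (\pi_(L2 R m) u)%qT.
Proof.
move=> fL; exists (insubd (0 : L2fun R m) f) => //.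
by rewrite -[LHS]/(\val (insubd (0 : L2fun R m) f)) insubdK//; exact/asboolP.
Qed.

Lemma toL2_eq m (f g : R * R -> 'cV[C]_m) : is_L2 f -> is_L2 g ->
  toL2 f = toL2 g <-> {ae mu2, forall k, sq k -> f k = g k}.
Proof.
move=> /toL2_val[u uf ->] /toL2_val[v vg ->].
by rewrite -uf -vg; exact: L2_eqP.
Qed.

Lemma toL2_eq_on m (f g : R * R -> 'cV[C]_m) : is_L2 f -> is_L2 g ->
  (forall k, sq k -> f k = g k) -> toL2 f = toL2 g.
Proof. by move=> fL gL h; apply/(toL2_eq fL gL); exact: aeW. Qed.

Lemma toL2_rep m (u : L2 R m) : toL2 (L2rep u) = u.
Proof.
have [v vE ->] := toL2_val (is_L2_rep u).
rewrite -[RHS]reprK; apply/L2_eqP; apply: aeW => k _.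
by rewrite vE.
Qed.

Lemma rep_toL2 m (f : R * R -> 'cV[C]_m) : is_L2 f ->
  {ae mu2, forall k, sq k -> L2rep (toL2 f) k = f k}.
Proof.
by move=> fL; apply/(toL2_eq (is_L2_rep _) fL); rewrite toL2_rep.
Qed.

Lemma is_L2_lin m (a : C) (f g : R * R -> 'cV[C]_m) : is_L2 f -> is_L2 g ->
  is_L2 (fun k => a *: f k + g k).
Proof.
move=> fL gL; have [_ h] := L2_submod_closed R m.
by have /asboolP := h a f g (asboolT fL) (asboolT gL).
Qed.

Lemma toL2_lin m (a : C) (f g : R * R -> 'cV[C]_m) : is_L2 f -> is_L2 g ->
  toL2 (fun k => a *: f k + g k) = a *: toL2 f + toL2 g.
Proof.
move=> fL gL; have [w wE ->] := toL2_val (is_L2_lin a fL gL).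
have [u uE ->] := toL2_val fL; have [v vE ->] := toL2_val gL.
rewrite -[_ *: _]L2_piZ -L2_piD; apply/L2_eqP; apply: aeW => k _.
by rewrite wE -uE -vE.
Qed.

Lemma toL2D m (f g : R * R -> 'cV[C]_m) : is_L2 f -> is_L2 g ->
  toL2 (fun k => f k + g k) = toL2 f + toL2 g.
Proof.
move=> fL gL; rewrite -[toL2 f]scale1r -(toL2_lin 1 fL gL).
by congr toL2; apply/funext => k; rewrite scale1r.
Qed.

Lemma is_L2B m (f g : R * R -> 'cV[C]_m) : is_L2 f -> is_L2 g ->
  is_L2 (fun k => f k - g k).
Proof.
move=> fL gL; have := is_L2_lin (-1) gL fL.
by under eq_fun do rewrite scaleN1r addrC.
Qed.

Lemma toL2B m (f g : R * R -> 'cV[C]_m) : is_L2 f -> is_L2 g ->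
  toL2 (fun k => f k - g k) = toL2 f - toL2 g.
Proof.
move=> fL gL; rewrite -[- toL2 g]scaleN1r addrC -(toL2_lin (-1) gL fL).
by congr toL2; apply/funext => k; rewrite scaleN1r addrC.
Qed.

Lemma L2_norm_toL2 m (f : R * R -> 'cV[C]_m) : is_L2 f ->
  (L2_norm (toL2 f) ^+ 2)%:E = (\int[mu2]_(k in sq) (nsq (f k))%:E)%E.
Proof.
move=> /toL2_val[u uE ->]; rewrite L2_norm_pi sqr_sqrtr; last first.
  by apply: sumr_ge0 => p _; exact: sqr_ge0.
rewrite -int_L2_sqr [RHS]integral_mkcond -L2_sqrE.
by apply: eq_integral => k _; rewrite !patchE -uE; case: ifP.
Qed.

Lemma L2_norm0E m : L2_norm (0 : L2 R m) = 0.
Proof.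
have := @L2_normZ R m 0 0; rewrite scaler0 => ->.
by rewrite Normc.normc0 mul0r.
Qed.

Lemma L2_normN m (u : L2 R m) : L2_norm (- u) = L2_norm u.
Proof.
rewrite -scaleN1r L2_normZ normcN Normc.normc1 mul1r//.
Qed.

(** The only source of norm estimates for multiplication operators: a pointwise
    bound passes to the integral of the squares. *)
Lemma L2_domination m n (f : R * R -> 'cV[C]_m) (g : R * R -> 'cV[C]_n) c : 0 <= c ->
  is_L2 f -> mmeas sq g -> (forall k, sq k -> nsq (g k) <= c * nsq (f k)) ->
  is_L2 g /\ L2_norm (toL2 g) ^+ 2 <= c * L2_norm (toL2 f) ^+ 2.
Proof.
move=> c0 fL mg gf; have /is_L2P[mf fin] := fL.
have h : (\int[mu2]_(k in sq) (nsq (g k))%:E <=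
          c%:E * \int[mu2]_(k in sq) (nsq (f k))%:E)%E.
  rewrite -ge0_integralZl//; first last.
  - by move=> k _; rewrite lee_fin nsq_ge0.
  - by apply/measurable_EFinP; exact: measurable_nsq.
  - exact: measurable_square.
  apply: ge0_le_integral; first exact: measurable_square.
  - by move=> k _; rewrite lee_fin nsq_ge0.
  - by apply/measurable_EFinP; exact: measurable_nsq.
  - apply/measurable_EFinP; apply: measurable_funM; first exact: measurable_cst.
    exact: measurable_nsq.
  - by move=> k kD; rewrite -EFinM lee_fin gf.
have gL : is_L2 g.
  apply/is_L2P; split => //; apply: le_lt_trans h _.
  by apply: lte_mul_pinfty; rewrite ?lee_fin.
by split => //; rewrite -lee_fin [X in (_ <= X)%E]EFinM !L2_norm_toL2.
Qed.

Lemma L2_bounded m (g : R * R -> 'cV[C]_m) c : 0 <= c -> mmeas sq g ->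
  (forall k, sq k -> nsq (g k) <= c) ->
  is_L2 g /\ L2_norm (toL2 g) ^+ 2 <= c.
Proof.
move=> c0 mg gc.
have h : (\int[mu2]_(k in sq) (nsq (g k))%:E <= c%:E)%E.
  have <- : (\int[mu2]_(k in sq) c%:E = c%:E)%E.
    by rewrite integral_cst; [rewrite [X in (_ * X)%E]mu2_square mule1|exact: measurable_square].
  apply: ge0_le_integral; first exact: measurable_square.
  - by move=> k _; rewrite lee_fin nsq_ge0.
  - by apply/measurable_EFinP; exact: measurable_nsq.
  - exact: measurable_cst.
  - by move=> k kD; rewrite lee_fin gc.
have gL : is_L2 g by apply/is_L2P; split => //; apply: le_lt_trans h (ltry _).
by split => //; rewrite -lee_fin L2_norm_toL2.
Qed.

Lemma is_L2_mint m (f : R * R -> 'cV[C]_m) : is_L2 f -> mint mu2 sq f.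
Proof.
move=> /is_L2P[mf fin] i j b; rewrite ord1.
have i1 : mu2.-integrable sq (EFin \o (fun k => 1 + nsq (f k))).
  apply/integrableP; split.
    apply/measurable_EFinP; apply: measurable_funD; first exact: measurable_cst.
    exact: measurable_nsq.
  have -> : (\int[mu2]_(k in sq) `|(EFin \o (fun k => (1 + nsq (f k))%R)) k| =
             \int[mu2]_(k in sq) (1%:E + (nsq (f k))%:E))%E.
    by apply: eq_integral => k _ /=; rewrite ger0_norm// addr_ge0// nsq_ge0.
  rewrite ge0_integralD//; first last.
  - by apply/measurable_EFinP; exact: measurable_nsq.
  - by move=> k _; rewrite lee_fin nsq_ge0.
  - exact: measurable_square.
  rewrite integral_cst ?[X in (_ * X + _)%E]mu2_square; last exact: measurable_square.
  by rewrite mule1; apply: lte_add_pinfty => //; exact: ltry.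
apply: (le_integrable measurable_square _ _ i1).
  by apply/measurable_EFinP; exact: mf.
move=> k kD /=; rewrite lee_fin [leRHS]ger0_norm ?addr_ge0 ?nsq_ge0//.
have h : cp b (f k i 0) ^+ 2 <= nsq (f k).
  apply: le_trans (nrm_le_nsq (f k) i).
  by rewrite -real_normK ?num_real// ler_pXn2r// ?nnegrE ?nrm_ge0// cp_le_nrm.
have := sqr_ge0 (`|cp b (f k i 0)| - 1); rewrite sqrrB1 real_normK ?num_real//.
by have := sqr_ge0 (cp b (f k i 0)); lra.
Qed.

End L2Functions.

(** * Multiplications and partial averages as bounded operators *)

Section Operators.
Context (R : realType).
Notation C := R[i].
Notation sq := (@square R).
Notation I01 := (@unit_itv R).
Notation mu := (@lebesgue_measure R).
Notation mu2 := (lebesgue2 R).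

(** Coefficients for which multiplication is bounded on L2. Continuous
    coefficients are of this kind, and the class is stable under slicing. *)
Definition mx_Linf m n (A : R * R -> 'M[C]_(m, n)) : Prop :=
  mmeas sq A /\ exists2 c, 0 <= c & mx_bounded A c.

Lemma mx_continuous_Linf m n (A : R * R -> 'M[C]_(m, n)) :
  mx_continuous A -> mx_Linf A.
Proof.
move=> cA; split; first exact: mx_continuous_mmeas.
exact: mx_continuous_bounded.
Qed.

Lemma Linf_mul_bound m n (A : R * R -> 'M[C]_(m, n)) : mx_Linf A ->
  exists2 c, 0 <= c & forall f : R * R -> 'cV[C]_n, is_L2 f ->
    is_L2 (fun k => A k *m f k) /\
    L2_norm (toL2 (fun k => A k *m f k)) ^+ 2 <= c * L2_norm (toL2 f) ^+ 2.
Proof.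
move=> [mA [c c0 Ac]]; exists (m%:R * (n%:R * c) ^+ 2).
  by rewrite mulr_ge0// sqr_ge0.
move=> f fL; apply: L2_domination => //.
- by rewrite mulr_ge0// sqr_ge0.
- by apply: mmeasM => //; exact: is_L2_mmeas.
- by move=> k kD; apply: nsq_mulmx => //; exact: Ac.
Qed.

Lemma is_L2_mul m n (A : R * R -> 'M[C]_(m, n)) (f : R * R -> 'cV[C]_n) :
  mx_Linf A -> is_L2 f -> is_L2 (fun k => A k *m f k).
Proof. by move=> /Linf_mul_bound[c _ h] /h[]. Qed.

Lemma mul_op_toL2 m n (A : R * R -> 'M[C]_(m, n)) (f : R * R -> 'cV[C]_n) :
  mx_Linf A -> is_L2 f -> mul_op A (toL2 f) = toL2 (fun k => A k *m f k).
Proof.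
move=> bA fL; apply/toL2_eq.
- by apply: is_L2_mul => //; exact: is_L2_rep.
- exact: is_L2_mul.
- by apply: filterS (rep_toL2 fL) => k h kD; rewrite h.
Qed.

(** [bounded_op] concerns endomorphisms only, whereas the factors of the
    operators at hand change the length of the vectors. *)
Definition blin m n (T : L2 R m -> L2 R n) : Prop :=
  linear T /\ exists2 c, 0 <= c & forall u, L2_norm (T u) <= c * L2_norm u.

Lemma blin_of_sqr m n (T : L2 R m -> L2 R n) c : linear T -> 0 <= c ->
  (forall u, L2_norm (T u) ^+ 2 <= c * L2_norm u ^+ 2) -> blin T.
Proof.
move=> lT c0 h; split => //; exists (Num.sqrt c); first exact: sqrtr_ge0.
move=> u; rewrite -(@ler_pXn2r _ 2)// ?nnegrE ?L2_norm_ge0 ?mulr_ge0 ?sqrtr_ge0 ?L2_norm_ge0//.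
by rewrite exprMn (sqr_sqrtr c0); exact: h.
Qed.

(** Operators are defined on classes through a chosen representative; linearity
    holds for them because the formula is almost everywhere linear in the function. *)
Lemma linear_of_toL2 m n (T : L2 R m -> L2 R n) (t : (R * R -> 'cV[C]_m) -> (R * R -> 'cV[C]_n)) :
  (forall f, is_L2 f -> is_L2 (t f) /\ T (toL2 f) = toL2 (t f)) ->
  (forall a f g, is_L2 f -> is_L2 g ->
    {ae mu2, forall k, sq k -> t (fun k => a *: f k + g k) k = a *: t f k + t g k}) ->
  linear T.
Proof.
move=> Tt tl a u v; have uL := is_L2_rep u; have vL := is_L2_rep v.
rewrite -(toL2_rep u) -(toL2_rep v) -(toL2_lin a uL vL).
have [tu ->] := Tt _ uL; have [tv ->] := Tt _ vL.
have [tw ->] := Tt _ (is_L2_lin a uL vL).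
rewrite -(toL2_lin a tu tv); apply/toL2_eq => //; first exact: is_L2_lin.
exact: tl.
Qed.

Lemma blin_mul_op m n (A : R * R -> 'M[C]_(m, n)) : mx_Linf A -> blin (mul_op A).
Proof.
move=> bA; have [c c0 cP] := Linf_mul_bound bA; apply: (blin_of_sqr _ c0).
  apply: (linear_of_toL2 (t := fun f k => A k *m f k)) => [f fL|a f g fL gL].
    by split; [exact: is_L2_mul|exact: mul_op_toL2].
  by apply: aeW => k _; rewrite mulmxDr scalemxAr.
move=> u; have := (cP _ (is_L2_rep u)).2; rewrite toL2_rep.
by rewrite -mul_op_toL2 ?toL2_rep//; exact: is_L2_rep.
Qed.

Lemma blin_comp m n p (T : L2 R n -> L2 R p) (S : L2 R m -> L2 R n) :
  blin T -> blin S -> blin (T \o S).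
Proof.
move=> [lT [c c0 cP]] [lS [d d0 dP]]; split=> [a u v /=|]; first by rewrite lS lT.
exists (c * d); first exact: mulr_ge0.
move=> u; apply: le_trans (cP _) _; rewrite -mulrA ler_wpM2l//.
Qed.

Lemma blinD m n (T S : L2 R m -> L2 R n) : blin T -> blin S -> blin (T \+ S).
Proof.
move=> [lT [c c0 cP]] [lS [d d0 dP]]; split=> [a u v /=|].
  by rewrite lS lT scalerDr addrACA.
exists (c + d); first exact: addr_ge0.
move=> u; apply: le_trans (L2_ler_normD _ _) _.
by rewrite mulrDl; apply: lerD; [exact: cP|exact: dP].
Qed.

Lemma blinN m n (T : L2 R m -> L2 R n) : blin T -> blin (fun u => - T u).
Proof.
move=> [lT [c c0 cP]]; split=> [a u v|]; first by rewrite lT opprD scalerN.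
by exists c => // u; rewrite L2_normN.
Qed.

Lemma blinB m n (T S : L2 R m -> L2 R n) : blin T -> blin S -> blin (T \- S).
Proof. by move=> bT /blinN; exact: blinD. Qed.

Lemma blin_id m : blin (@idfun (L2 R m)).
Proof. by split=> // ; exists 1 => // u; rewrite mul1r. Qed.

Lemma blin0 m n (T : L2 R m -> L2 R n) : blin T -> T 0 = 0.
Proof. by move=> [lT _]; have := lT (-1) 0 0; rewrite scaler0 addr0 scaleN1r addNr. Qed.

Lemma blin_addE m n (T : L2 R m -> L2 R n) u v : blin T -> T (u + v) = T u + T v.
Proof. by move=> [lT _]; have := lT 1 u v; rewrite !scale1r. Qed.

Lemma blin_subE m n (T : L2 R m -> L2 R n) u v : blin T -> T (u - v) = T u - T v.
Proof. by move=> [lT _]; rewrite addrC -scaleN1r lT scaleN1r addrC. Qed.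

Lemma normL2E m (u : L2 R m) : `|u| = (L2_norm u)%:C%C.
Proof. by []. Qed.

Lemma blin_bounded_op m (T : L2 R m -> L2 R m) : blin T <-> bounded_op T.
Proof.
split=> [[lT [c c0 cP]]|[lT [c cP]]].
  split => //; exists (c%:C)%C => u.
  by rewrite !normL2E -rmorphM/= lecR.
split => //; exists `|complex.Re c| => // u.
have := cP u; rewrite !normL2E; case: c {cP} => a b.
rewrite lecE /= !mulr0 subr0 => /andP[_ /le_trans]; apply.
by rewrite ler_wpM2r ?L2_norm_ge0// ler_norm.
Qed.

Definition avgf b m (f : R * R -> 'cV[C]_m) (k : R * R) : 'cV[C]_m :=
  integral01 (fun x => f (pt b x (oc b k))).

Definition avg_op b m (u : L2 R m) : L2 R m := toL2 (avgf b (L2rep u)).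

Lemma mmeas_avgf b m (f : R * R -> 'cV[C]_m) : mmeas sq f -> mmeas sq (avgf b f).
Proof.
move=> mf i j c.
exact: (measurable_comp_oc b (mmeas_inner b mf i j c)).
Qed.

Lemma sqr_inner_integral_le b (g : R * R -> R) (S : set R) (s : R) :
  measurable_fun sq g -> measurable S -> 0 < s -> (mu S <= s%:E)%E ->
  (forall k, sq k -> ~ S (ic b k) -> g k = 0) ->
  (\int[mu2]_(k in sq) ((\int[mu]_(x in I01) g (pt b x (oc b k))) ^+ 2)%:E <=
   s%:E * \int[mu2]_(k in sq) (g k ^+ 2)%:E)%E.
Proof.
move=> mg mS s0 Ss gS.
pose h y := \int[mu]_(x in I01) g (pt b x y).
have mh : measurable_fun I01 h by exact: measurable_inner_Rintegral.
have mg2 : measurable_fun sq (fun k => (g k ^+ 2)%:E).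
  by apply/measurable_EFinP; exact: measurable_funX.
have mh2 : measurable_fun I01 (fun y => (h y ^+ 2)%:E).
  by apply/measurable_EFinP; exact: measurable_funX.
have -> : (\int[mu2]_(k in sq) ((\int[mu]_(x in I01) g (pt b x (oc b k))) ^+ 2)%:E =
    \int[mu]_(y in I01) (h y ^+ 2)%:E)%E.
  rewrite (@tonelli_square _ b (fun k => (h (oc b k) ^+ 2)%:E)).
  - apply: eq_integral => y _; under eq_integral do rewrite oc_pt.
    by rewrite (integral_cst mu measurable_I01) [X in (_ * X)%E]mu_I01 mule1.
  - exact: (measurable_comp_oc b mh2).
  - by move=> k _; rewrite lee_fin sqr_ge0.
rewrite (@tonelli_square _ b (fun k => (g k ^+ 2)%:E)) //; last first.
  by move=> k _; rewrite lee_fin sqr_ge0.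
have mi : measurable_fun I01 (fun y => \int[mu]_(x in I01) (g (pt b x y) ^+ 2)%:E)%E.
  apply: (@measurable_inner_integral_ge0 _ b (fun k => (g k ^+ 2)%:E)) => // k _.
  by rewrite lee_fin sqr_ge0.
rewrite -ge0_integralZl//; first last.
- by rewrite lee_fin ltW.
- by move=> y _; apply: integral_ge0 => x _; rewrite lee_fin sqr_ge0.
- exact: measurable_I01.
apply: ge0_le_integral; first exact: measurable_I01.
- by move=> y _; rewrite lee_fin sqr_ge0.
- exact: mh2.
- exact: measurable_funeM.
- move=> y Iy; apply: (@sqr_Rintegral_le R (fun x => g (pt b x y)) S s) => //.
    exact: measurable_slice.
  move=> x Ix nS; apply: gS; first exact/square_pt.
  by rewrite ic_pt.
Qed.

(** Cauchy-Schwarz on each slice, followed by integration over the outer variable. *)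
Lemma avgf_supported b m (f : R * R -> 'cV[C]_m) (S : set R) (s : R) :
  is_L2 f -> measurable S -> 0 < s -> (mu S <= s%:E)%E ->
  (forall k, sq k -> ~ S (ic b k) -> f k = 0) ->
  is_L2 (avgf b f) /\ L2_norm (toL2 (avgf b f)) ^+ 2 <= s * L2_norm (toL2 f) ^+ 2.
Proof.
move=> fL mS s0 Ss fS; have /is_L2P[mf fin] := fL.
have nsqE m' (g : R * R -> 'cV[C]_m') : mmeas sq g ->
    (\int[mu2]_(k in sq) (nsq (g k))%:E =
    \sum_(p : 'I_m' * bool) \int[mu2]_(k in sq) (cp p.2 (g k p.1 0) ^+ 2)%:E)%E.
  move=> mg; rewrite -ge0_integral_sum.
  - by apply: eq_integral => k _; rewrite nsq_cp sumEFin.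
  - exact: measurable_square.
  - by move=> p; apply/measurable_EFinP; apply: measurable_funX; exact: mg.
  - by move=> p k _; rewrite lee_fin sqr_ge0.
have ma := mmeas_avgf b mf.
have h : (\int[mu2]_(k in sq) (nsq (avgf b f k))%:E <=
    s%:E * \int[mu2]_(k in sq) (nsq (f k))%:E)%E.
  rewrite !nsqE// ge0_sume_distrr; last first.
    by move=> p _; apply: integral_ge0 => k _; rewrite lee_fin sqr_ge0.
  apply: lee_sum => p _.
  under eq_integral do rewrite cp_mx_integral.
  apply: (@sqr_inner_integral_le b (fun k => cp p.2 (f k p.1 0)) S s) => //.
  by move=> k kD nS; rewrite fS// mxE cp0.
have aL : is_L2 (avgf b f).
  apply/is_L2P; split => //; apply: le_lt_trans h _.
  by apply: lte_mul_pinfty; rewrite ?lee_fin// ltW.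
split; first exact: aL.
rewrite -(L2_norm_toL2 aL) -(L2_norm_toL2 fL) -EFinM lee_fin in h.
exact: h.
Qed.

Lemma avgf_L2 b m (f : R * R -> 'cV[C]_m) : is_L2 f ->
  is_L2 (avgf b f) /\ L2_norm (toL2 (avgf b f)) <= L2_norm (toL2 f).
Proof.
move=> fL; have muI : (mu I01 <= 1%:E)%E by rewrite mu_I01.
have nI k : sq k -> ~ I01 (ic b k) -> f k = 0 by move=> /(square_ic b) Ik nI.
have [aL h] := avgf_supported fL measurable_I01 ltr01 muI nI.
split; first exact: aL.
rewrite mul1r in h.
by rewrite -(@ler_pXn2r _ 2)// ?nnegrE; [exact: L2_norm_ge0..].
Qed.

Lemma avgf_ae_eq b m (f g : R * R -> 'cV[C]_m) : mmeas sq f -> mmeas sq g ->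
  {ae mu2, forall k, sq k -> f k = g k} ->
  {ae mu2, forall k, sq k -> avgf b f k = avgf b g k}.
Proof.
move=> mf mg fg.
have h := ae_slice b fg.
have : {ae mu, forall y, I01 y ->
    integral01 (fun x => f (pt b x y)) = integral01 (fun x => g (pt b x y))}.
  apply: filterS h => y h Iy; apply: ae_eq_mx_integral.
  - exact: measurable_I01.
  - exact: mmeas_slice.
  - exact: mmeas_slice.
  - exact: h.
exact: (@ae_comp_oc _ b (fun y => integral01 (fun x => f (pt b x y)) =
  integral01 (fun x => g (pt b x y)))).
Qed.

(** Averaging may be computed with any representative: almost every slice of two
    equivalent functions agrees almost everywhere. *)
Lemma avg_op_toL2 b m (f : R * R -> 'cV[C]_m) : is_L2 f ->
  avg_op b (toL2 f) = toL2 (avgf b f).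
Proof.
move=> fL; apply/toL2_eq; [exact: (avgf_L2 b (is_L2_rep _)).1|exact: (avgf_L2 b fL).1|].
by apply: avgf_ae_eq; [apply: is_L2_mmeas; exact: is_L2_rep|exact: is_L2_mmeas|exact: rep_toL2].
Qed.

Lemma ae_avgf_slice b m (f : R * R -> 'cV[C]_m) : is_L2 f ->
  {ae mu2, forall k, sq k -> mint mu I01 (fun x => f (pt b x (oc b k)))}.
Proof.
move=> fL; apply: (@ae_comp_oc _ b (fun y => mint mu I01 (fun x => f (pt b x y)))).
exact/ae_mint_slice/is_L2_mint.
Qed.

Lemma blin_avg_op b m : blin (@avg_op b m).
Proof.
apply: (@blin_of_sqr _ _ _ 1) => //; last first.
  move=> u; rewrite mul1r ler_pXn2r ?nnegrE ?L2_norm_ge0//.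
  by have := (avgf_L2 b (is_L2_rep u)).2; rewrite toL2_rep.
apply: (linear_of_toL2 (t := @avgf b m)) => [f fL|a f g fL gL].
  by split; [exact: (avgf_L2 b fL).1|exact: avg_op_toL2].
apply: filterS2 (ae_avgf_slice b fL) (ae_avgf_slice b gL) => k hf hg kD.
have {}hf := hf kD; have {}hg := hg kD.
rewrite /avgf /integral01 (mx_integralD measurable_I01 _ hg).
  congr (_ + _); rewrite -mul_scalar_mx -(mx_integral_constM measurable_I01 _ hf).
  by apply: eq_mx_integral => x _; rewrite mul_scalar_mx.
rewrite (_ : (fun x => _) = (fun x => a%:M *m f (pt b x (oc b k)))).
  exact: (mint_constM measurable_I01 a%:M hf).
by apply/funext => x; rewrite mul_scalar_mx.
Qed.

(** A factor depending on the outer variable alone is a constant for the inner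
    integral. *)
Lemma avgf_mulr b m n (A : R * R -> 'M[C]_(m, n)) (g : R * R -> 'cV[C]_n) k :
  mx_Linf A -> sq k ->
  (forall k l, oc b k = oc b l -> g k = g l) ->
  avgf b (fun k => A k *m g k) k = integral01 (fun x => A (pt b x (oc b k))) *m g k.
Proof.
move=> [mA [c c0 cA]] kD gP.
rewrite /avgf -(mx_integral_Mconst measurable_I01); last first.
  move=> i j p; apply: measurable_bounded_integrable.
  - exact: measurable_I01.
  - by rewrite [X in (X < _)%E]mu_I01 ltry.
  - exact: (measurable_slice b (mA i j p) (square_oc b kD)).
  - exists c; split; first exact: num_real.
    move=> M cM x Ix; apply: le_trans (ltW cM).
    apply: le_trans (cp_le_nrm _ _) _; apply: cA; apply/square_pt.
    by split => //; exact: square_oc.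
by apply: eq_mx_integral => x _; congr (_ *m _); apply: gP; rewrite oc_pt.
Qed.

End Operators.

Local Opaque toL2 L2_norm.

(** * Inversion of identity plus a one-sided integral operator *)

Section OneSided.
Context (R : realType).
Notation C := R[i].
Notation sq := (@square R).
Notation I01 := (@unit_itv R).
Notation mu := (@lebesgue_measure R).
Notation mu2 := (lebesgue2 R).

Lemma mul_op_mul m n p (A : R * R -> 'M[C]_(m, n)) (B : R * R -> 'M[C]_(n, p)) u :
  mx_Linf A -> mx_Linf B ->
  mul_op A (mul_op B u) = mul_op (fun k => A k *m B k) u.
Proof.
move=> bA bB; have uL := is_L2_rep u.
rewrite -{1}(toL2_rep u) mul_op_toL2// mul_op_toL2//; last exact: is_L2_mul.
by congr toL2; apply/funext => k; rewrite mulmxA.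
Qed.

Lemma eq_is_L2 m (f g : R * R -> 'cV[C]_m) : (forall k, sq k -> f k = g k) ->
  is_L2 g -> is_L2 f.
Proof.
move=> fg /is_L2P[mg fin]; apply/is_L2P; split.
  move=> i j b; apply: (eq_measurable_fun (fun k => cp b (g k i j))) => //.
  by move=> k /set_mem kD; rewrite fg.
rewrite (_ : (\int[mu2]_(k in sq) _ = \int[mu2]_(k in sq) (nsq (g k))%:E)%E)//.
by apply: eq_integral => k /set_mem kD; rewrite fg.
Qed.

Lemma eq_mul_op m n (A B : R * R -> 'M[C]_(m, n)) u : mx_Linf A ->
  (forall k, sq k -> A k = B k) -> mul_op A u = mul_op B u.
Proof.
move=> bA AB.
have AL : is_L2 (fun k => A k *m L2rep u k) by apply: is_L2_mul => //; exact: is_L2_rep.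
apply: toL2_eq_on => //; last by move=> k kD; rewrite AB.
by apply: eq_is_L2 AL => k kD; rewrite AB.
Qed.

Lemma mul_opB m n (A B : R * R -> 'M[C]_(m, n)) u : mx_Linf A -> mx_Linf B ->
  mul_op (fun k => A k - B k) u = mul_op A u - mul_op B u.
Proof.
move=> bA bB; have uL := is_L2_rep u.
rewrite -[RHS]toL2B; [|exact: is_L2_mul..].
by congr toL2; apply/funext => k; rewrite mulmxBl.
Qed.

Lemma mul_op_id m u : mul_op (fun=> 1%:M) u = u :> L2 R m.
Proof.
rewrite -[RHS]toL2_rep; congr toL2; apply/funext => k; exact: mul1mx.
Qed.

Lemma oc_avgf b m (f : R * R -> 'cV[C]_m) k l :
  oc b k = oc b l -> avgf b f k = avgf b f l.
Proof. by rewrite /avgf => ->. Qed.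

(** A second average in the same direction only sees the coefficients, because
    the first one already removed the dependence on the inner variable. *)
Lemma avg_mul_avg b m n p (B : R * R -> 'M[C]_(p, n)) (F : R * R -> 'M[C]_(n, m)) v :
  mx_continuous B -> mx_continuous F ->
  avg_op b (mul_op B (mul_op F (avg_op b v))) =
  mul_op (fun k => integral01 (fun x => B (pt b x (oc b k)) *m F (pt b x (oc b k))))
    (avg_op b v).
Proof.
move=> cB cF; have cBF := mx_continuousM cB cF.
have bBF := mx_continuous_Linf cBF.
have bI := mx_continuous_Linf (mx_continuous_inner (b := b) cBF).
rewrite mul_op_mul; [|exact: mx_continuous_Linf..].
have wL := (avgf_L2 b (is_L2_rep v)).1.
rewrite mul_op_toL2// mul_op_toL2// avg_op_toL2; last exact: is_L2_mul.
have hL : is_L2 (avgf b (fun k => B k *m F k *m avgf b (L2rep v) k)).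
  by apply: (avgf_L2 b _).1; exact: is_L2_mul.
apply: toL2_eq_on => //; first exact: is_L2_mul.
move=> k kD; rewrite (avgf_mulr bBF kD)//.
by move=> k' l'; exact: oc_avgf.
Qed.

Section Inverse.
Variables (b : bool) (M m : nat).
Variables (F : R * R -> 'M[C]_(M, m)) (B : R * R -> 'M[C]_(m, M)).
Hypotheses (cF : mx_continuous F) (cB : mx_continuous B).

(** Common form of the symbols [E1] ([b = true]) and [E2] ([b = false]). *)
Definition symE (y : R) : 'M[C]_m :=
  1%:M + integral01 (fun x => B (pt b x y) *m F (pt b x y)).

Definition one_sided (u : L2 R M) : L2 R M := mul_op F (avg_op b (mul_op B u)).

Definition one_sided_inv (u : L2 R M) : L2 R M :=
  mul_op (fun k => F k *m invmx (symE (oc b k))) (avg_op b (mul_op B u)).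

Lemma mx_continuous_symE : mx_continuous (fun k => symE (oc b k)).
Proof.
apply: mx_continuousD; first exact: mx_continuous_cst.
exact: mx_continuous_inner (mx_continuousM cB cF).
Qed.

Hypothesis detE : forall y, I01 y -> \det (symE y) != 0.

Lemma mx_continuous_invsymE : mx_continuous (fun k => invmx (symE (oc b k))).
Proof.
apply: mx_continuousV mx_continuous_symE _ => k kD.
exact/detE/square_oc.
Qed.

Lemma symE_unit k : sq k -> symE (oc b k) \in unitmx.
Proof. by move=> kD; rewrite unitmxE unitfE; apply: detE; exact: square_oc. Qed.

Let T u := avg_op b (mul_op B u).
Let cFE : mx_continuous (fun k => F k *m invmx (symE (oc b k))).
Proof. exact: mx_continuousM cF mx_continuous_invsymE. Qed.

Lemma blin_one_sided : blin one_sided.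
Proof.
apply: (@blin_comp _ _ _ _ (mul_op F) (@avg_op R b m \o mul_op B)).
  exact/blin_mul_op/mx_continuous_Linf.
by apply: blin_comp; [exact: blin_avg_op|exact/blin_mul_op/mx_continuous_Linf].
Qed.

Lemma blin_one_sided_inv : blin one_sided_inv.
Proof.
apply: (@blin_comp _ _ _ _ (mul_op _) (@avg_op R b m \o mul_op B)).
  exact/blin_mul_op/mx_continuous_Linf.
by apply: blin_comp; [exact: blin_avg_op|exact/blin_mul_op/mx_continuous_Linf].
Qed.

Let inner_integralE k :
  integral01 (fun x => B (pt b x (oc b k)) *m F (pt b x (oc b k))) =
  symE (oc b k) - 1%:M.
Proof. by rewrite /symE addrC addKr. Qed.

Let inner_invsymE k : sq k ->
  integral01 (fun x => B (pt b x (oc b k)) *m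
    (F (pt b x (oc b k)) *m invmx (symE (oc b (pt b x (oc b k)))))) =
  1%:M - invmx (symE (oc b k)).
Proof.
move=> kD.
have mBF : mint mu I01 (fun x => B (pt b x (oc b k)) *m F (pt b x (oc b k))).
  have [mm [c c0 cc]] := mx_continuous_Linf (mx_continuousM cB cF).
  move=> i j p; apply: measurable_bounded_integrable.
  - exact: measurable_I01.
  - by rewrite [X in (X < _)%E]mu_I01 ltry.
  - exact: (measurable_slice b (mm i j p) (square_oc b kD)).
  - exists c; split; first exact: num_real.
    move=> N cN x Ix; apply: le_trans (ltW cN).
    apply: le_trans (cp_le_nrm _ _) _; apply: cc; apply/square_pt.
    by split => //; exact: square_oc.
transitivity (integral01 (fun x => B (pt b x (oc b k)) *m F (pt b x (oc b k))) *m
              invmx (symE (oc b k))).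
  rewrite -(mx_integral_Mconst measurable_I01 _ mBF).
  by apply: eq_mx_integral => x _; rewrite oc_pt mulmxA.
by rewrite inner_integralE mulmxBl mul1mx mulmxV// symE_unit.
Qed.

Let bF := mx_continuous_Linf cF.
Let bFE := mx_continuous_Linf cFE.

(** The integral of [B F] is [E - 1], so the composition has coefficient
    [F E^-1 (E - 1) = F - F E^-1]. *)
Lemma one_sided_inv_one_sided u :
  one_sided_inv (one_sided u) = one_sided u - one_sided_inv u.
Proof.
have cI := mx_continuous_inner (b := b) (mx_continuousM cB cF).
have e := avg_mul_avg b (mul_op B u) cB cF.
apply: (eq_trans (congr1 (mul_op (fun k => F k *m invmx (symE (oc b k)))) e)).
rewrite mul_op_mul//; last exact: mx_continuous_Linf.
apply: (eq_trans _ (mul_opB (avg_op b (mul_op B u)) bF bFE)); apply: eq_mul_op.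
  exact/mx_continuous_Linf/mx_continuousM.
move=> k kD; rewrite inner_integralE mulmxBr mulmx1 -mulmxA mulVmx ?mulmx1//.
exact: symE_unit.
Qed.

Lemma one_sided_one_sided_inv u :
  one_sided (one_sided_inv u) = one_sided u - one_sided_inv u.
Proof.
have cI := mx_continuous_inner (b := b) (mx_continuousM cB cFE).
have e := avg_mul_avg b (mul_op B u) cB cFE.
apply: (eq_trans (congr1 (mul_op F) e)).
rewrite mul_op_mul//; last exact: mx_continuous_Linf.
apply: (eq_trans _ (mul_opB (avg_op b (mul_op B u)) bF bFE)); apply: eq_mul_op.
  exact/mx_continuous_Linf/mx_continuousM.
by move=> k kD; rewrite inner_invsymE// mulmxBr mulmx1.
Qed.

(** Writing [S] for [one_sided] and [P] for [one_sided_inv], the identities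
    [P S = S - P] and [S P = S - P] say that [1 - P] inverts [1 + S]. *)
Lemma one_sided_invK : cancel (fun u => u + one_sided u) (fun u => u - one_sided_inv u).
Proof.
move=> u /=; rewrite (blin_addE _ _ blin_one_sided_inv) one_sided_inv_one_sided.
by rewrite [one_sided_inv u + _]addrC subrK addrK.
Qed.

Lemma one_sided_Kinv : cancel (fun u => u - one_sided_inv u) (fun u => u + one_sided u).
Proof.
move=> u /=; rewrite (blin_subE _ _ blin_one_sided) one_sided_one_sided_inv.
by rewrite subKr subrK.
Qed.

End Inverse.
End OneSided.

(** * The integral operator with kernel D2 - D1 *)

Section KernelOperator.
Context (R : realType).
Notation C := R[i].
Notation sq := (@square R).
Notation I01 := (@unit_itv R).
Notation mu := (@lebesgue_measure R).
Notation mu2 := (lebesgue2 R).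

Lemma mx_continuous_freeze b m n (A : R * R -> 'M[C]_(m, n)) x : I01 x ->
  mx_continuous A -> mx_continuous (fun k => A (pt b x (oc b k))).
Proof.
move=> Ix /mx_continuousP cA; apply/mx_continuousP => i j p.
apply: uniform_rcont => e e0; have [d d0 dP] := heine (cA i j p) e0.
exists d => // k l kD lD k1 k2.
apply/ltW/dP; [by apply/square_pt; split => //; exact: square_oc..| |].
- by case: (b) k1 k2 => /=; rewrite ?subrr ?normr0.
- by case: (b) k1 k2 => /=; rewrite ?subrr ?normr0.
Qed.

Lemma Linf_slice b m n (A : R * R -> 'M[C]_(m, n)) y : mx_Linf A -> I01 y ->
  mmeas I01 (fun x => A (pt b x y)) /\
  exists c, forall x, I01 x -> forall i j, nrm (A (pt b x y) i j) <= c.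
Proof.
move=> [mA [c _ cA]] Iy; split; first exact: mmeas_slice.
by exists c => x Ix; apply: cA; apply/square_pt.
Qed.

Lemma mint_Linf_slice b m n (A : R * R -> 'M[C]_(m, n)) y : mx_Linf A -> I01 y ->
  mint mu I01 (fun x => A (pt b x y)).
Proof.
move=> /(@Linf_slice b)/[apply] -[mA [c cA]] i j p.
apply: measurable_bounded_integrable.
- exact: measurable_I01.
- by rewrite [X in (X < _)%E]mu_I01 ltry.
- exact: mA.
- exists c; split; first exact: num_real.
  move=> N cN x Ix; apply: le_trans (ltW cN).
  by apply: le_trans (cp_le_nrm _ _) _; exact: cA.
Qed.

Variables (M m1 m2 : nat).
Variables (F1 : R * R -> 'M[C]_(M, m1)) (G : R * R -> 'M[C]_(m1, m2)).
Variables (F2 : R * R -> 'M[C]_(M, m2)) (B : R * R -> 'M[C]_(m2, M)).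
Hypotheses (cF1 : mx_continuous F1) (cG : mx_continuous G).
Hypotheses (cF2 : mx_continuous F2) (cB : mx_continuous B).

Section Fixed.
Variables (f : R * R -> 'cV[C]_M) (fL : is_L2 f).

Let w x : 'cV[C]_m2 := integral01 (fun y => B (x, y) *m f (x, y)).
Let BfL : is_L2 (fun k => B k *m f k).
Proof. exact: is_L2_mul (mx_continuous_Linf cB) fL. Qed.

Let wE k : avgf false (fun k => B k *m f k) k = w k.1.
Proof. by []. Qed.

Let wL : is_L2 (fun k => w k.1).
Proof. exact: (avgf_L2 false BfL).1. Qed.

Let w_mint : mint mu I01 w.
Proof. exact: (mint_inner false (is_L2_mint BfL)). Qed.

Let w_mmeas : mmeas I01 w.
Proof. by move=> i j b; apply/measurable_EFinP; exact: measurable_int (w_mint i j b). Qed.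

(** When the kernel depends on the first variable only, the integral in the
    second variable falls on [B f] alone and yields [w]. *)
Lemma integral_first_factor p (L : R -> 'M[C]_(p, m2)) c : mmeas I01 L ->
  (forall x, I01 x -> forall i j, nrm (L x i j) <= c) ->
  mint mu2 sq (fun k => L k.1 *m (B k *m f k)) /\
  mx_integral mu2 sq (fun k => L k.1 *m (B k *m f k)) = integral01 (fun x => L x *m w x).
Proof.
move=> mL Lc.
have mL2 : mmeas sq (fun k => L k.1).
  by move=> i j b; exact: (measurable_comp_oc false (mL i j b)).
have iLBf : mint mu2 sq (fun k => L k.1 *m (B k *m f k)).
  apply: (mint_boundedM measurable_square mL2 _ (is_L2_mint BfL) (c := c)).
  by move=> k [k1 _]; exact: Lc.
split => //; rewrite (fubini_mx false iLBf).
apply: ae_eq_mx_integral; first exact: measurable_I01.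
- move=> i j b; apply/measurable_EFinP.
  exact: measurable_int (mint_inner false iLBf i j b).
- exact: mmeasM mL w_mmeas.
- have := ae_mint_slice false (is_L2_mint BfL).
  apply: filterS => x h Ix; exact: (@mx_integral_constM R _ _ mu I01 measurable_I01
    _ _ _ (L x) (fun y => B (x, y) *m f (x, y)) (h Ix)).
Qed.

Let h y : 'cV[C]_m1 := integral01 (fun x => G (x, y) *m w x).

Lemma integral_D1 k : sq k ->
  mint mu2 sq (fun k' => F1 k *m G (k'.1, k.2) *m B k' *m f k') /\
  mx_integral mu2 sq (fun k' => F1 k *m G (k'.1, k.2) *m B k' *m f k') =
  F1 k *m h k.2.
Proof.
move=> [_ Ik2]; have [mG [c Gc]] := Linf_slice true (mx_continuous_Linf cG) Ik2.
have [iGBf e] := integral_first_factor mG Gc.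
have aE : (fun k' => F1 k *m G (k'.1, k.2) *m B k' *m f k') =
    (fun k' => F1 k *m (G (k'.1, k.2) *m (B k' *m f k'))).
  by apply/funext => k'; rewrite !mulmxA.
rewrite aE; split; first exact: (mint_constM measurable_square).
by rewrite (mx_integral_constM measurable_square _ iGBf) e.
Qed.

Let N x1 (k : R * R) : 'M[C]_(m2, m2) := B (x1, k.2) *m F1 (x1, k.2) *m G k.

Let cN x1 : I01 x1 -> mx_continuous (N x1).
Proof.
move=> Ix; apply: mx_continuousM => //; apply: mx_continuousM.
  exact: (mx_continuous_freeze (b := true) Ix cB).
exact: (mx_continuous_freeze (b := true) Ix cF1).
Qed.

(** Both sides integrate [B (x1, t) F1 (x1, t) G (x, t) w x] over [(x, t)], in
    the two orders. *)
Lemma integral_swap x1 : I01 x1 ->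
  integral01 (fun x => integral01 (fun t => N x1 (x, t)) *m w x) =
  integral01 (fun t => B (x1, t) *m (F1 (x1, t) *m h t)).
Proof.
move=> Ix1; have bN := mx_continuous_Linf (cN Ix1).
have iNw : mint mu2 sq (fun k => N x1 k *m w k.1).
  by apply/is_L2_mint/is_L2_mul.
transitivity (integral01 (fun x => integral01 (fun t => N x1 (x, t) *m w x))).
  apply: eq_mx_integral => x Ix.
  by rewrite -(mx_integral_Mconst measurable_I01 _ (mint_Linf_slice false bN Ix)).
rewrite -(fubini_mx false iNw) (fubini_mx true iNw).
apply: eq_mx_integral => t It.
have iGw : mint mu I01 (fun x => G (x, t) *m w x).
  have [mG [c Gc]] := Linf_slice true (mx_continuous_Linf cG) It.
  exact: (mint_boundedM measurable_I01 mG Gc w_mint).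
rewrite mulmxA -(mx_integral_constM measurable_I01 _ iGw).
by apply: eq_mx_integral => x _; rewrite /N/= -!mulmxA.
Qed.

Lemma integral_D2 k : sq k ->
  let D1 (k k' : R * R) := F1 k *m G (k'.1, k.2) *m B k' in
  let D2 k k' := F2 k *m integral01 (fun x => B (k.1, x) *m D1 (k.1, x) k') in
  mint mu2 sq (fun k' => D2 k k' *m f k') /\
  mx_integral mu2 sq (fun k' => D2 k k' *m f k') =
  F2 k *m integral01 (fun t => B (k.1, t) *m (F1 (k.1, t) *m h t)).
Proof.
move=> [Ik1 Ik2] D1 D2.
have bN := mx_continuous_Linf (cN Ik1).
pose L x := integral01 (fun t => N k.1 (x, t)).
have I0 : I01 (0 : R) by rewrite /unit_itv/= in_itv/= lexx ler01.
have [mL [c Lc]] : mmeas I01 L /\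
    exists c, forall x, I01 x -> forall i j, nrm (L x i j) <= c.
  have := mx_continuous_Linf (mx_continuous_inner (b := false) (cN Ik1)).
  by move=> /(Linf_slice true)/(_ I0).
have [iLBf e] := integral_first_factor mL Lc.
have aE k' : sq k' -> F2 k *m (L k'.1 *m (B k' *m f k')) = D2 k k' *m f k'.
  move=> [Ik1' _]; rewrite /D2 /L -!mulmxA; congr (_ *m _); rewrite mulmxA; congr (_ *m _).
  rewrite -(mx_integral_Mconst measurable_I01 _ (mint_Linf_slice false bN Ik1')).
  by apply: eq_mx_integral => t _; rewrite /D1 /N/= !mulmxA.
have iFL := mint_constM measurable_square (F2 k) iLBf.
split.
  move=> i j p; apply: eq_integrable (iFL i j p); first exact: measurable_square.
  by move=> k' /set_mem k'D; rewrite /comp aE.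
rewrite -(integral_swap Ik1) -e -(mx_integral_constM measurable_square _ iLBf).
by apply: eq_mx_integral => k' k'D; rewrite aE.
Qed.

End Fixed.

(** The kernel [D1] is that of [Q], a product of two averages in different
    directions, and [D2] is the kernel of [Q] followed by one more average: each
    integral in the composition is moved inside by Fubini. *)
Lemma kernel_op_D2_D1 (u : L2 R M) :
  let D1 (k k' : R * R) := F1 k *m G (k'.1, k.2) *m B k' in
  let D2 k k' := F2 k *m integral01 (fun x => B (k.1, x) *m D1 (k.1, x) k') in
  let Q u := mul_op F1 (avg_op true (mul_op G (avg_op false (mul_op B u)))) in
  kernel_op (fun k k' => D2 k k' - D1 k k') u =
  mul_op F2 (avg_op false (mul_op B (Q u))) - Q u.
Proof.
move=> D1 D2 Q; set f := L2rep u; have fL : is_L2 f := is_L2_rep u.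
have bB := mx_continuous_Linf cB; have bG := mx_continuous_Linf cG.
have bF1 := mx_continuous_Linf cF1; have bF2 := mx_continuous_Linf cF2.
pose w k := avgf false (fun k => B k *m f k) k.
have wL : is_L2 w by apply: (avgf_L2 false _).1; exact: is_L2_mul.
pose h k := avgf true (fun k => G k *m w k) k.
have hL : is_L2 h by apply: (avgf_L2 true _).1; exact: is_L2_mul.
have QE : Q u = toL2 (fun k => F1 k *m h k).
  rewrite /Q -{1}(toL2_rep u) (mul_op_toL2 bB fL).
  rewrite (avg_op_toL2 false (is_L2_mul bB fL)) (mul_op_toL2 bG wL).
  by rewrite (avg_op_toL2 true (is_L2_mul bG wL)) (mul_op_toL2 bF1 hL).
have FhL := is_L2_mul bF1 hL; have BFhL := is_L2_mul bB FhL.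
have aL := (avgf_L2 false BFhL).1; have FaL := is_L2_mul bF2 aL.
rewrite QE (mul_op_toL2 bB FhL) (avg_op_toL2 false BFhL) (mul_op_toL2 bF2 aL).
rewrite -(toL2B FaL FhL).
have ptE k : sq k -> mx_integral mu2 sq (fun k' => (D2 k k' - D1 k k') *m L2rep u k') =
   F2 k *m avgf false (fun k => B k *m (F1 k *m h k)) k - F1 k *m h k.
  move=> kD; have [i1 e1] := integral_D1 fL kD; have [i2 e2] := integral_D2 fL kD.
  rewrite -[X in _ = _ - X]e1 -[X in _ = X - _]e2.
  rewrite -(mx_integralB measurable_square i2 i1).
  by apply: eq_mx_integral => k' _; rewrite mulmxBl.
have rL := is_L2B FaL FhL.
by apply: toL2_eq_on => //; exact: eq_is_L2 rL.
Qed.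

End KernelOperator.

(** * Compact operators and equicontinuous families *)

Section CompactMaps.
Context (R : realType).
Notation C := R[i].
Notation sq := (@square R).
Notation I01 := (@unit_itv R).

(** [compact_op] for operators that change the length of the vectors. *)
Definition compact_map m n (T : L2 R m -> L2 R n) : Prop :=
  linear T /\ forall A : set (L2 R m), bounded_set A -> precompact (T @` A).

Lemma L2_cvgP m (T : Type) (F : set_system T) (FF : Filter F) (f : T -> L2 R m) (u : L2 R m) :
  f @ F --> u <-> forall e, 0 < e -> \forall t \near F, L2_norm (u - f t) < e.
Proof.
split=> [/cvgrPdist_lt h e e0|h].
  have e0' : 0 < (e%:C)%C by rewrite ltcR.
  by apply: filterS (h _ e0') => t; rewrite normL2E ltcR.
apply/cvgrPdist_lt => e e0.
have e0' : 0 < complex.Re e by move: e0; case: e => a b; rewrite ltcE/= => /andP[].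
apply: filterS (h _ e0') => t ht; rewrite normL2E.
by move: e0 ht; case: (e) => a b; rewrite !ltcE/= => /andP[/eqP -> _] ->; rewrite eqxx.
Qed.

Lemma bounded_L2P m (A : set (L2 R m)) :
  bounded_set A <-> exists N, forall u, A u -> L2_norm u <= N.
Proof.
split=> [[c [cr h]]|[N h]].
  exists (complex.Re c + 1) => u Au.
  have /= := h (c + 1) _ u Au; rewrite ltrDl ltr01 => /(_ isT); rewrite normL2E.
  by case: (c) => a b; rewrite lecE/= => /andP[_].
exists (N%:C)%C; split; first by rewrite realE !lecE /= eqxx /= le_total.
move=> x Nx u Au /=; apply: le_trans (ltW Nx).
by rewrite normL2E lecR; exact: h.
Qed.

Lemma blin_continuous m n (T : L2 R m -> L2 R n) : blin T -> continuous T.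
Proof.
move=> bT x; have [lT [c c0 cP]] := bT.
apply/(L2_cvgP (nbhs_filter x) T (T x)) => e e0.
have d0 : 0 < e / (c + 1) by rewrite divr_gt0// ltr_wpDl.
have := (L2_cvgP (nbhs_filter x) (fun y : L2 R m => y) x).1 (@cvg_id _ (nbhs x)) _ d0; have FF := nbhs_filter x.
apply: filterS => y xy; rewrite -(blin_subE _ _ bT).
apply: le_lt_trans (cP _) _.
have c1 : 0 < c + 1 by rewrite ltr_wpDl.
apply: (@le_lt_trans _ _ ((c + 1) * L2_norm (x - y))).
  by rewrite ler_wpM2r ?L2_norm_ge0// lerDl.
by rewrite mulrC -ltr_pdivlMr.
Qed.

Lemma compact_precompact_L2 m (A B : set (L2 R m)) : compact B -> A `<=` B -> precompact A.
Proof.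
move=> cB AB; apply: (precompact_subset AB); apply: compact_precompact cB.
exact: norm_hausdorff.
Qed.

Lemma precompact_L2P m (A : set (L2 R m)) : precompact A ->
  exists2 B, compact B & A `<=` B.
Proof.
by move=> [B AB [cB _]]; exists B.
Qed.

Lemma compact_map_compl m n p (S : L2 R n -> L2 R p) (T : L2 R m -> L2 R n) :
  blin S -> compact_map T -> compact_map (S \o T).
Proof.
move=> bS [lT cT]; split; first by move=> a u v /=; rewrite lT bS.1.
move=> A bA; have [B cB TB] := precompact_L2P (cT A bA).
apply: (@compact_precompact_L2 _ _ (S @` B)).
  by apply: continuous_compact cB; apply: continuous_subspaceT; exact: blin_continuous.
by move=> _ [u Au <-]; exists (T u) => //; apply: TB; exists u.
Qed.

Lemma compact_map_compr m n p (T : L2 R n -> L2 R p) (S : L2 R m -> L2 R n) :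
  compact_map T -> blin S -> compact_map (T \o S).
Proof.
move=> [lT cT] [lS [c c0 cP]]; split; first by move=> a u v /=; rewrite lS lT.
move=> A /bounded_L2P[N AN].
have bSA : bounded_set (S @` A).
  apply/bounded_L2P; exists (c * N) => _ [u Au <-].
  by apply: le_trans (cP u) _; rewrite ler_wpM2l// AN.
have [B cB TB] := precompact_L2P (cT _ bSA).
apply: (compact_precompact_L2 cB) => _ [u Au <-].
by apply: TB; exists (S u) => //; exists u.
Qed.

Lemma compact_mapD m n (S T : L2 R m -> L2 R n) :
  compact_map S -> compact_map T -> compact_map (S \+ T).
Proof.
move=> [lS cS] [lT cT]; split=> [a u v /=|A bA].
  by rewrite lS lT scalerDr addrACA.
have [B1 cB1 SB] := precompact_L2P (cS A bA).
have [B2 cB2 TB] := precompact_L2P (cT A bA).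
apply: (@compact_precompact_L2 _ _ ((fun x : L2 R n * L2 R n => x.1 + x.2) @` (B1 `*` B2))).
  apply: continuous_compact; last exact: compact_setX.
  by apply: continuous_subspaceT; exact: add_continuous.
move=> _ [u Au <-]; exists (S u, T u) => //; split => /=.
  by apply: SB; exists u.
by apply: TB; exists u.
Qed.

Lemma L2_norm_continuous m : continuous (@L2_norm R m : L2 R m -> R).
Proof.
move=> x; apply/(@cvgrPdist_lt _ _ _ _ (nbhs_filter x)) => e e0.
have := (L2_cvgP (nbhs_filter x) (fun y : L2 R m => y) x).1 (@cvg_id _ (nbhs x)) _ e0; have FF := nbhs_filter x.
apply: filterS => y; apply: le_lt_trans.
have h (a b : L2 R m) : L2_norm a - L2_norm b <= L2_norm (a - b).
  by rewrite lerBlDr -{1}(subrK b a); exact: L2_ler_normD.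
have hyx := h y x; rewrite -[y - x]opprB L2_normN in hyx.
by rewrite ler_norml lerNl opprB hyx h.
Qed.

(** The image of the unit ball lies in a compact set, on which the norm is bounded. *)
Lemma compact_map_blin m n (T : L2 R m -> L2 R n) : compact_map T -> blin T.
Proof.
move=> [lT cT]; split => //.
have bB : bounded_set [set u : L2 R m | L2_norm u <= 1].
  by apply/bounded_L2P; exists 1.
have [B cB TB] := precompact_L2P (cT _ bB).
have cN : compact (@L2_norm R n @` B).
  by apply: continuous_compact cB; apply: continuous_subspaceT; exact: L2_norm_continuous.
have [N [_ hN]] := compact_bounded cN.
have NB u : L2_norm u <= 1 -> L2_norm (T u) <= `|N| + 1.
  move=> u1; have /= := hN (`|N| + 1) _ (L2_norm (T u)).
  rewrite (ger0_norm (L2_norm_ge0 _)) => h; apply: h.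
    by rewrite ltr_pwDr// ler_norm.
  by exists (T u) => //; apply: TB; exists u.
have T0 : T 0 = 0 by have := lT (-1) 0 0; rewrite scaler0 addr0 scaleN1r addNr.
exists (`|N| + 1); first by rewrite addr_ge0.
move=> u; have [u0|u0] := eqVneq (L2_norm u) 0.
  by rewrite (L2_norm0 u0) T0 !L2_norm0E mulr0.
have un0 : 0 < L2_norm u by rewrite lt_def u0 L2_norm_ge0.
have TZ (a : C) : T (a *: u) = a *: T u by have := lT a u 0; rewrite !addr0 T0 addr0.
have nrmR (r : R) : 0 <= r -> Normc.normc (r%:C)%C = r.
  by move=> r0; rewrite /Normc.normc/= expr0n addr0 sqrtr_sqr ger0_norm.
have := NB (((L2_norm u)^-1)%:C%C *: u).
rewrite TZ !L2_normZ nrmR ?invr_ge0 ?L2_norm_ge0// mulVf// lexx => /(_ isT).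
by rewrite mulrC ler_pdivrMr.
Qed.

Lemma ultra_limit T (F : set_system T) (f : T -> R) (c : R) : UltraFilter F ->
  F [set t | `|f t| <= c] -> exists l : R, f @ F --> l.
Proof.
move=> UF Fc.
have PF0 : ProperFilter F by exact: ultra_proper.
have PF : ProperFilter (f @ F) by exact: fmap_proper_filter.
have Fcc : (f @ F) `[- c, c]%classic.
  by apply: (@filterS _ F _ _ _ _ Fc) => t ft; rewrite /= in_itv/= -ler_norml.
have [l [_ cl]] := @segment_compact R (- c) c (f @ F) PF Fcc.
exists l => V Vl.
have [//|nV] := in_ultra_setVsetC (f @^-1` V) UF.
have [z [nz Vz]] := cl (~` V) V nV Vl.
by [].
Qed.

(** Arzela-Ascoli in the form needed here, for classes of functions of the second
    coordinate with a common bound [c] and a common modulus of continuity [d].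
    Along an ultrafilter the functions converge pointwise, and a finite net turns
    this into uniform convergence, hence into convergence in L2. *)
Section Equicontinuous.
Variables (m : nat) (c : R) (d : R -> R).
Hypothesis d_gt0 : forall e, 0 < e -> 0 < d e.

(** The inequalities are not strict so that pointwise limits inherit them. *)
Definition equicont (h : R -> 'cV[C]_m) : Prop :=
  (forall y, I01 y -> forall i b, `|cp b (h y i 0)| <= c) /\
  (forall e y y', 0 < e -> I01 y -> I01 y' -> `|y - y'| < d e ->
    forall i b, `|cp b (h y i 0) - cp b (h y' i 0)| <= e).

Lemma equicont_is_L2 h : equicont h -> is_L2 (fun k => h k.2).
Proof.
move=> [hc hd].
have mh : mmeas sq (fun k => h k.2).
  move=> i j b; rewrite ord1; apply: rcont_measurable; apply: uniform_rcont => e e0.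
  exists (d e); first exact: d_gt0.
  by move=> k l [_ k2] [_ l2] _ kl; apply: hd.
have c0 : 0 <= `|c| by [].
apply: (@L2_bounded _ _ _ (\sum_(p : 'I_m * bool) `|c| ^+ 2) _ mh _).1.
  by apply: sumr_ge0 => p _; rewrite sqr_ge0.
move=> k [_ k2]; rewrite nsq_cp; apply: ler_sum => p _.
rewrite -real_normK ?num_real// ler_pXn2r// ?nnegrE//.
by apply: le_trans (hc _ k2 _ _) (ler_norm _).
Qed.

Definition equicont_classes : set (L2 R m) :=
  [set u | exists2 h, equicont h & u = toL2 (fun k => h k.2)].

Lemma unit_net (r : R) : 0 < r -> exists (n : nat) (y : 'I_n -> R),
  (forall q, I01 (y q)) /\ forall t, I01 t -> exists q, `|t - y q| < r.
Proof.
move=> r0; pose n := (Num.trunc r^-1).+1.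
have n0 : 0 < n%:R :> R by rewrite ltr0n.
have nr : n%:R^-1 < r.
  by rewrite invf_plt// /n truncnS_gt.
exists n.+1, (fun q => q%:R / n%:R); split.
  move=> q; rewrite /unit_itv/= in_itv/= divr_ge0//= ler_pdivrMr// mul1r ler_nat.
  by rewrite -ltnS.
move=> t; rewrite /unit_itv/= in_itv/= => /andP[t0 t1].
have tn0 : 0 <= t * n%:R by rewrite mulr_ge0// ltW.
have /andP[h1 h2] := truncn_itv tn0.
have qn : (Num.trunc (t * n%:R) < n.+1)%N.
  rewrite ltnS -(@ler_nat R); apply: le_trans h1 _.
  by rewrite ler_piMl// ltW.
exists (Ordinal qn) => /=; apply: le_lt_trans nr.
rewrite ler_norml; apply/andP; split.
  apply: (@le_trans _ _ 0); first by rewrite oppr_le0 invr_ge0 ltW.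
  by rewrite subr_ge0 ler_pdivrMr.
rewrite -[leRHS]div1r lerBlDr -mulrDl ler_pdivlMr//.
by rewrite -natr1 in h2; rewrite addrC ltW.
Qed.

Lemma compact_equicont_classes : compact equicont_classes.
Proof.
rewrite compact_ultra => F UF FS.
have /choice[rho rhoP] (u : L2 R m) :
    exists h, equicont_classes u -> equicont h /\ u = toL2 (fun k => h k.2).
  by have [[h eh ->]|nu] := pselect (equicont_classes u); [exists h|exists (fun=> 0)].
have /choice[l lP] (j : R * ('I_m * bool)) :
    exists l : R, I01 j.1 -> (fun u => cp j.2.2 (rho u j.1 j.2.1 0)) @ F --> l.
  have [Ij|nI] := pselect (I01 j.1); last by exists 0.
  have PF : ProperFilter F by exact: ultra_proper.
  have Fj : F [set u | `|cp j.2.2 (rho u j.1 j.2.1 0)| <= c].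
    by apply: filterS FS => u /rhoP[[hc _] _] /=; exact: hc.
  have [l hl] := ultra_limit UF Fj.
  by exists l.
pose h y : 'cV[C]_m := \col_i (l (y, (i, true)) +i* l (y, (i, false)))%C.
have PF : ProperFilter F by exact: ultra_proper.
have hE y i b : cp b (h y i 0) = l (y, (i, b)) by rewrite mxE; case: b.
have near_l e y : 0 < e -> I01 y ->
    F [set u | equicont_classes u /\ forall i b, `|l (y, (i, b)) - cp b (rho u y i 0)| < e].
  move=> e0 Iy; apply: filterI => //.
  apply: filter_forall => i; apply: filter_forall => b.
  by have /cvgrPdist_lt/(_ _ e0) := lP (y, (i, b)) Iy.
(* The limit inherits bound and modulus from nearby members of the family. *)
have eh : equicont h.
  split=> [y Iy i b|e y y' e0 Iy Iy' yy' i b].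
    rewrite hE; apply/ler_addgt0Pr => e e0.
    have [u [/rhoP[[uc _] _] ul]] := filter_ex (near_l e y e0 Iy).
    rewrite -(subrK (cp b (rho u y i 0)) (l _)); apply: le_trans (ler_normD _ _) _.
    by rewrite addrC; apply: lerD; [exact: uc|exact/ltW/ul].
  rewrite !hE; apply/ler_addgt0Pr => e' e'0.
  have e20 : 0 < e' / 2 by rewrite divr_gt0.
  have [u [[/rhoP[[_ ud] _] ul] [_ ul']]] :=
    filter_ex (filterI (near_l _ y e20 Iy) (near_l _ y' e20 Iy')).
  have h1 := ul i b; have h2 := ul' i b; have h3 := ud e y y' e0 Iy Iy' yy' i b.
  move: h1 h2 h3; rewrite !ltr_norml !ler_norml => /andP[? ?] /andP[? ?] /andP[? ?].
  by apply/andP; split; lra.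
exists (toL2 (fun k => h k.2)); split; first by exists h.
apply/L2_cvgP => e e0.
pose s : R := (m * 2)%N%:R * (3 ^+ 2).
have s0 : 0 <= s by rewrite mulr_ge0// sqr_ge0.
have s1 : 0 < s + 1 by rewrite ltr_wpDl.
have [e1 e10 eE] : exists2 e1 : R, 0 < e1 & e = e1 * (s + 1).
  by exists (e / (s + 1)); [exact: divr_gt0|rewrite divfK// gt_eqF].
(* Three steps of size [e1] on a net whose mesh is the modulus of [e1], for each of
   the [m * 2] real components. *)
have [n [yq [Iyq net]]] := unit_net (d_gt0 e10).
have : \forall u \near F, forall q, equicont_classes u /\
    forall i b, `|l (yq q, (i, b)) - cp b (rho u (yq q) i 0)| < e1.
  by apply: filter_forall => q; exact: near_l.
have FS' : \forall u \near F, equicont_classes u by [].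
apply: filterS2 FS' => u Su hu.
have [eu uE] := rhoP u Su.
have hL := equicont_is_L2 eh; have uL := equicont_is_L2 eu.
rewrite [X in _ - X]uE -(toL2B hL uL).
have mhu : mmeas sq (fun k => h k.2 - rho u k.2) by exact: is_L2_mmeas (is_L2B hL uL).
have bnd : L2_norm (toL2 (fun k => h k.2 - rho u k.2)) ^+ 2 <= s * e1 ^+ 2.
  apply: (L2_bounded _ mhu _).2; first by rewrite mulr_ge0// sqr_ge0.
  move=> k [_ Ik2]; rewrite nsq_cp.
  have -> : s * e1 ^+ 2 = \sum_(p : 'I_m * bool) (3 * e1) ^+ 2.
    rewrite sumr_const card_prod card_ord card_bool -[RHS]mulr_natl.
    by rewrite /s; move: (e1) (m * 2)%N => x N; ring.
  apply: ler_sum => p _; rewrite -real_normK ?num_real//.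
  rewrite ler_pXn2r ?nnegrE// ?mulr_ge0// ?(ltW e10)//.
  have [q qk] := net k.2 Ik2.
  have [_ /(_ p.1 p.2) h1] := hu q.
  have h2 := eh.2 e1 k.2 (yq q) e10 Ik2 (Iyq q) qk p.1 p.2.
  have h3 := eu.2 e1 k.2 (yq q) e10 Ik2 (Iyq q) qk p.1 p.2.
  have -> : (h k.2 - rho u k.2) p.1 0 = h k.2 p.1 0 - rho u k.2 p.1 0 by rewrite !mxE.
  move: h1 h2 h3; rewrite cpB !hE !ltr_norml !ler_norml => /andP[? ?] /andP[? ?] /andP[? ?].
  by apply/andP; split; lra.
rewrite -(@ltr_pXn2r _ 2)// ?nnegrE ?L2_norm_ge0 ?(ltW e0)//.
apply: le_lt_trans bnd _.
rewrite eE exprMn mulrC ltr_pM2l ?exprn_gt0//.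
by have := sqr_ge0 s; rewrite sqrrD1; lra.
Qed.

End Equicontinuous.

End CompactMaps.

(** * Compactness of two crossed averages *)

Section CompactAverages.
Context (R : realType).
Notation C := R[i].
Notation sq := (@square R).
Notation I01 := (@unit_itv R).
Notation mu := (@lebesgue_measure R).
Notation mu2 := (lebesgue2 R).

Lemma nsq_integral_le m (F : R -> 'cV[C]_m) : mmeas I01 F ->
  ((nsq (integral01 F))%:E <= \int[mu]_(x in I01) (nsq (F x))%:E)%E.
Proof.
move=> mF.
have -> : (\int[mu]_(x in I01) (nsq (F x))%:E =
    \sum_(p : 'I_m * bool) \int[mu]_(x in I01) (cp p.2 (F x p.1 0) ^+ 2)%:E)%E.
  rewrite -ge0_integral_sum.
  - by apply: eq_integral => k _; rewrite nsq_cp sumEFin.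
  - exact: measurable_I01.
  - by move=> p; apply/measurable_EFinP; apply: measurable_funX; exact: mF.
  - by move=> p k _; rewrite lee_fin sqr_ge0.
rewrite nsq_cp -sumEFin; apply: lee_sum => p _; rewrite cp_mx_integral -[leRHS]mul1e.
have muI : (mu I01 <= 1%:E)%E by rewrite mu_I01.
have mFp := mF p.1 0 p.2.
by apply: (sqr_Rintegral_le mFp measurable_I01 ltr01 muI) => x Ix /(_ Ix).
Qed.

Lemma heine_mx m n (G : R * R -> 'M[C]_(m, n)) : mx_continuous G ->
  forall e, 0 < e -> exists2 d, 0 < d & forall k l, sq k -> sq l ->
    `|k.1 - l.1| < d -> `|k.2 - l.2| < d -> forall i j, nrm (G k i j - G l i j) <= e.
Proof.
move=> /mx_continuousP cG e e0; have e20 : 0 < e / 2 by rewrite divr_gt0.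
have /choice[d dP] (p : 'I_m * 'I_n * bool) : exists d, 0 < d /\ forall k l, sq k -> sq l ->
    `|k.1 - l.1| < d -> `|k.2 - l.2| < d ->
    `|cp p.2 (G k p.1.1 p.1.2) - cp p.2 (G l p.1.1 p.1.2)| < e / 2.
  by have [d d0 dP] := heine (cG p.1.1 p.1.2 p.2) e20; exists d.
have d0 p : 0 < d p by have [] := dP p.
pose s := 1 + \sum_p (d p)^-1.
have s0 : 0 < s by rewrite ltr_pwDl// sumr_ge0// => p _; rewrite invr_ge0 ltW.
have sd p : s^-1 <= d p.
  rewrite -[leRHS]invrK lef_pV2 ?posrE ?invr_gt0// /s (bigD1 p)//=.
  rewrite addrCA lerDl addr_ge0// sumr_ge0// => q _; by rewrite invr_ge0 ltW.
exists s^-1; first by rewrite invr_gt0.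
move=> k l kD lD k1 k2 i j.
have -> : e = 2 * (e / 2) by rewrite mulrC divfK.
apply: nrm_le_cp => b; rewrite cpB; apply/ltW.
by have [_] := dP (i, j, b); apply => //; apply: lt_le_trans (sd _).
Qed.

(** The compactness behind the theorem. The first average [w] depends on one
    coordinate and is only square-integrable, but integrating it against the
    uniformly continuous [G] gives functions of the other coordinate whose bound
    and modulus of continuity depend on [G] and on the norm of [w] alone. *)
Lemma compact_avg_mul_avg m1 m2 (G : R * R -> 'M[C]_(m1, m2)) : mx_continuous G ->
  compact_map (@avg_op R true m1 \o mul_op G \o @avg_op R false m2).
Proof.
move=> cG; have bG := mx_continuous_Linf cG.
have bT : blin (@avg_op R true m1 \o mul_op G \o @avg_op R false m2).
  apply: blin_comp; last exact: blin_avg_op.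
  by apply: blin_comp; [exact: blin_avg_op|exact: blin_mul_op].
split; first exact: bT.1.
move=> A /bounded_L2P[N AN].
pose q := Num.sqrt m1%:R * m2%:R * `|N|.
have q0 : 0 <= q by rewrite !mulr_ge0 ?sqrtr_ge0.
have q1 : 0 < q + 1 by rewrite ltr_wpDl.
have /choice[d dP] (e : R) : exists d, 0 < e -> 0 < d /\ forall k l, sq k -> sq l ->
    `|k.1 - l.1| < d -> `|k.2 - l.2| < d ->
    forall i j, nrm (G k i j - G l i j) <= e / (q + 1).
  have [e0|_] := ltP 0 e; last by exists 1.
  have e'0 : 0 < e / (q + 1) by rewrite divr_gt0.
  by have [d d0 dP] := heine_mx cG e'0; exists d.
have d_gt0 e : 0 < e -> 0 < d e by move=> /dP[].
have [mG [cst cst0 Gc]] := bG.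
apply: (compact_precompact_L2 (@compact_equicont_classes R m1 (q * cst) d d_gt0)).
move=> _ [u Au <-]; set f := L2rep u; have fL : is_L2 f := is_L2_rep u.
pose w x : 'cV[C]_m2 := integral01 (fun y => f (x, y)).
have [wL wu] : is_L2 (fun k => w k.1) /\ L2_norm (toL2 (fun k => w k.1)) <= L2_norm u.
  by have := avgf_L2 false fL; rewrite toL2_rep.
have mw : mmeas I01 w := mmeas_inner false (is_L2_mmeas fL).
have iw : mint mu I01 w := mint_inner false (is_L2_mint fL).
have wN : (\int[mu]_(x in I01) (nsq (w x))%:E <= (`|N| ^+ 2)%:E)%E.
  have mnw : measurable_fun I01 (fun x => (nsq (w x))%:E).
    by apply/measurable_EFinP; exact: measurable_nsq.
  have -> : (\int[mu]_(x in I01) (nsq (w x))%:E =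
             \int[mu2]_(k in sq) (nsq (w k.1))%:E)%E.
    rewrite (@tonelli_square _ false (fun k => (nsq (w k.1))%:E)).
    - apply: eq_integral => x _ /=.
      by rewrite (integral_cst mu measurable_I01) [X in (_ * X)%E]mu_I01 mule1.
    - exact: (measurable_comp_oc false mnw).
    - by move=> k _; rewrite lee_fin nsq_ge0.
  rewrite -(L2_norm_toL2 wL) lee_fin ler_pXn2r ?nnegrE ?L2_norm_ge0//.
  by apply: le_trans wu _; apply: le_trans (AN u Au) (ler_norm _).
have est (B : R -> 'M[C]_(m1, m2)) e : 0 <= e -> mmeas I01 B ->
    (forall x, I01 x -> forall i j, nrm (B x i j) <= e) ->
    forall i b, `|cp b (integral01 (fun x => B x *m w x) i 0)| <= q * e.
  move=> e0 mB Be i b; apply: le_trans (cp_le_nrm _ _) _.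
  rewrite -(@ler_pXn2r _ 2)// ?nnegrE ?nrm_ge0 ?mulr_ge0//.
  apply: le_trans (nrm_le_nsq _ _) _; rewrite -lee_fin.
  have mBw : mmeas I01 (fun x => B x *m w x) by exact: mmeasM.
  apply: le_trans (nsq_integral_le mBw) _.
  have c0 : 0 <= m1%:R * (m2%:R * e) ^+ 2 :> R by rewrite mulr_ge0// sqr_ge0.
  apply: (@le_trans _ _ ((m1%:R * (m2%:R * e) ^+ 2)%:E *
                         \int[mu]_(x in I01) (nsq (w x))%:E)%E).
    rewrite -ge0_integralZl//; first last.
    - by move=> x _; rewrite lee_fin nsq_ge0.
    - by apply/measurable_EFinP; exact: measurable_nsq.
    - exact: measurable_I01.
    apply: ge0_le_integral; first exact: measurable_I01.
    - by move=> x _; rewrite lee_fin nsq_ge0.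
    - by apply/measurable_EFinP; exact: measurable_nsq.
    - apply/measurable_EFinP; apply: measurable_funM; first exact: measurable_cst.
      exact: measurable_nsq.
    - by move=> x Ix; rewrite -EFinM lee_fin; apply: nsq_mulmx => //; exact: Be.
  apply: (@le_trans _ _ ((m1%:R * (m2%:R * e) ^+ 2)%:E * (`|N| ^+ 2)%:E)%E).
    by apply: lee_wpmul2l wN; rewrite lee_fin.
  have sE x : (Num.sqrt m1%:R * m2%:R * `|N| * x) ^+ 2 =
      m1%:R * (m2%:R * x) ^+ 2 * `|N| ^+ 2 :> R.
    rewrite -[in RHS](sqr_sqrtr (ler0n R m1)); move: (Num.sqrt _) (`|N|) => s y.
    by ring.
  by rewrite -EFinM lee_fin (sE e).
pose h y : 'cV[C]_m1 := integral01 (fun x => G (x, y) *m w x).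
exists h; last first.
  rewrite /= -{1}(toL2_rep u) (avg_op_toL2 false fL) (mul_op_toL2 bG wL).
  by rewrite (avg_op_toL2 true (is_L2_mul bG wL)).
split=> [y Iy i b|e y y' e0 Iy Iy' yy' i b].
  apply: est => //; first exact: (mmeas_slice true mG Iy).
  by move=> x Ix i' j'; apply: Gc; split.
have iGw z : I01 z -> mint mu I01 (fun x => G (x, z) *m w x).
  move=> Iz; have [mG' [c' Gc']] := Linf_slice true bG Iz.
  exact: (mint_boundedM measurable_I01 mG' Gc' iw).
have hB : h y - h y' = integral01 (fun x => (G (x, y) - G (x, y')) *m w x).
  rewrite /h /integral01 -(mx_integralB measurable_I01 (iGw y Iy) (iGw y' Iy')).
  by apply: eq_mx_integral => x _; rewrite mulmxBl.
have subE (X Y : 'cV[C]_m1) : (X - Y) i 0 = X i 0 - Y i 0 by rewrite !mxE.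
rewrite -cpB -subE hB; apply: (@le_trans _ _ (q * (e / (q + 1)))).
  apply: est; first by rewrite divr_ge0// ltW.
  - move=> i' j' b'.
    have -> : (fun x => cp b' ((G (x, y) - G (x, y')) i' j')) =
        (fun x => cp b' (G (x, y) i' j') - cp b' (G (x, y') i' j')).
      by apply/funext => x; rewrite !mxE cpB.
    by apply: measurable_funB; [exact: (mmeas_slice true mG Iy)|exact: (mmeas_slice true mG Iy')].
  - move=> x Ix i' j'; have [_ ] := dP e e0.
    have -> : (G (x, y) - G (x, y')) i' j' = G (x, y) i' j' - G (x, y') i' j' by rewrite !mxE.
    by apply => //=; rewrite subrr normr0 d_gt0.
rewrite mulrCA ler_piMr ?(ltW e0)// ler_pdivrMr// mul1r lerDl//.
Qed.

End CompactAverages.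

(** * Singular sequences with disjoint supports *)

Section SingularSequences.
Context (R : realType).
Notation C := R[i].
Notation sq := (@square R).
Notation I01 := (@unit_itv R).
Notation mu := (@lebesgue_measure R).
Notation mu2 := (lebesgue2 R).

Lemma L2_normB_sym m (u v : L2 R m) : L2_norm (u - v) = L2_norm (v - u).
Proof. by rewrite -[u - v]opprB L2_normN. Qed.

(** The images of a bounded sequence under a compact map have a cluster point. *)
Lemma compact_near_repetition m n (K : L2 R m -> L2 R n) (u : nat -> L2 R m) e :
  compact_map K -> (forall i, L2_norm (u i) <= 1) -> 0 < e ->
  exists i j, i != j /\ L2_norm (K (u i) - K (u j)) < e.
Proof.
move=> [lK cK] u1 e0.
have bB : bounded_set [set v : L2 R m | L2_norm v <= 1].
  by apply/bounded_L2P; exists 1.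
have [B cB KB] := precompact_L2P (cK _ bB).
have FB : ((K \o u) @ \oo) B.
  by exists 0%N => // i _; apply: KB; exists (u i) => //; exact: u1.
have [p [_ cp]] := cB _ _ FB.
have e20 : 0 < e / 2 by rewrite divr_gt0.
have Vp : nbhs p [set x | L2_norm (p - x) < e / 2].
  exact: ((L2_cvgP (nbhs_filter p) (fun y : L2 R n => y) p).1 (@cvg_id _ (nbhs p)) _ e20).
have rep N : exists i, (N <= i)%N /\ L2_norm (p - K (u i)) < e / 2.
  have FN : ((K \o u) @ \oo) [set x | exists2 i, (N <= i)%N & x = K (u i)].
    by exists N => // i /= Ni; exists i.
  have [x [[i Ni ->] xp]] := cp _ _ FN Vp.
  by exists i.
have [i [_ hi]] := rep 0%N; have [j [ij hj]] := rep i.+1.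
exists i, j; split; first by rewrite neq_ltn ij.
rewrite -(subrKA p); apply: le_lt_trans (L2_ler_normD _ _) _.
by rewrite L2_normB_sym [e]splitr ltrD.
Qed.

(** Normalize the functions [f i] of a sequence on which [T] is small compared
    with the lower bound [c] of [A]. Disjointness of the supports gives
    [|u i - u j| >= 1], whereas for some pair [K u i] is close to [K u j]; then
    [A (u i - u j)] is too small. *)
Lemma no_singular_sequence m (A K T : L2 R m -> L2 R m) (c : R) :
  0 < c -> (forall u, c * L2_norm u <= L2_norm (A u)) ->
  compact_map K -> blin T -> (forall u, A u = T u + K u) ->
  ~ (forall e, 0 < e -> exists f : nat -> R * R -> 'cV[C]_m,
      [/\ forall i, is_L2 (f i), forall i, L2_norm (toL2 (f i)) != 0,
          forall i j, i != j -> forall k, sq k -> f i k = 0 \/ f j k = 0 &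
          forall i, L2_norm (T (toL2 (f i))) <= e * L2_norm (toL2 (f i))]).
Proof.
move=> c0 cA cK bT AE sing.
have c40 : 0 < c / 4 by rewrite divr_gt0.
have [f [fL f0 fd fT]] := sing _ c40.
pose a i : C := ((L2_norm (toL2 (f i)))^-1)%:C%C.
have fpos i : 0 < L2_norm (toL2 (f i)) by rewrite lt_def f0 L2_norm_ge0.
have na i : Normc.normc (a i) = (L2_norm (toL2 (f i)))^-1.
  by rewrite /a /Normc.normc/= expr0n addr0 sqrtr_sqr ger0_norm// invr_ge0 ltW.
pose u i := a i *: toL2 (f i).
have u1 i : L2_norm (u i) = 1 by rewrite L2_normZ na mulVf.
have linZ S (bS : blin S) (z : C) (v : L2 R m) : S (z *: v) = z *: S v.
  by have := bS.1 z v 0; rewrite !addr0 (blin0 bS) addr0.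
have Tu i : L2_norm (T (u i)) <= c / 4.
  by rewrite /u (linZ _ T bT) L2_normZ na mulrC ler_pdivrMr// fT.
have u_le1 l : L2_norm (u l) <= 1 by rewrite u1.
have [i [j [ij Kij]]] := compact_near_repetition cK u_le1 c40.
have bK := compact_map_blin cK.
have fZ l : is_L2 (fun k => a l *: f l k).
  by apply: eq_is_L2 (is_L2_lin (a l) (fL l) (is_L2B (fL l) (fL l))) => k _; rewrite subrr addr0.
have uE l : u l = toL2 (fun k => a l *: f l k).
  rewrite /u -[LHS]addr0 -(subrr (toL2 (f l))) -(toL2B (fL l) (fL l)).
  rewrite -(toL2_lin _ (fL l) (is_L2B (fL l) (fL l))).
  by congr toL2; apply/funext => k; rewrite subrr addr0.
(* By disjointness, [u i - u j] coincides with [u i] where [u i] is nonzero. *)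
have sep : 1 <= L2_norm (u i - u j).
  rewrite -(@ler_pXn2r _ 2)// ?nnegrE ?L2_norm_ge0//.
  rewrite -{1}(u1 i) !uE -(toL2B (fZ i) (fZ j)) -[leRHS]mul1r.
  apply: (L2_domination _ (is_L2B (fZ i) (fZ j)) (is_L2_mmeas (fZ i)) _).2 => // k kD.
  have aux (X Y : 'cV[C]_m) : X = 0 \/ Y = 0 -> nsq X <= nsq (X - Y).
    by case=> ->; rewrite ?subr0// nsq0 nsq_ge0.
  rewrite mul1r; apply: aux.
  by case: (fd i j ij k kD) => fk; [left|right]; rewrite fk; exact: scaler0.
have := cA (u i - u j); rewrite AE (blin_subE _ _ bT) (blin_subE _ _ bK).
apply/negP; rewrite -ltNge.
apply: le_lt_trans (L2_ler_normD _ _) _.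
have h1 : L2_norm (T (u i) - T (u j)) <= c / 4 + c / 4.
  by apply: le_trans (L2_ler_normD _ _) _; rewrite L2_normN lerD.
have h2 : c <= c * L2_norm (u i - u j) by rewrite ler_peMr// ltW.
by move: h1 h2 Kij c0; lra.
Qed.

(** The intervals accumulate at one end of a small interval on that side of [y0]
    that stays inside the unit interval. *)
Lemma disjoint_intervals (y0 d : R) : I01 y0 -> 0 < d -> exists I : nat -> set R,
  [/\ forall n, measurable (I n : set (measurableTypeR R)),
      forall n y, I n y -> I01 y /\ `|y - y0| < d,
      forall n, (0 < mu (I n))%E /\ (mu (I n) <= d%:E)%E &
      forall n m, n != m -> forall y, I n y -> I m y -> False].
Proof.
rewrite /unit_itv/= in_itv/= => /andP[y00 y01] d0.
have [a [b [ab a0 b1 ay yb]]] : exists a b : R,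
    [/\ a < b, 0 <= a, b <= 1, y0 - d / 2 <= a <= y0 & y0 <= b <= y0 + d / 2].
  have d20 : 0 < d / 2 by rewrite divr_gt0.
  have [y0h|y0h] := lerP y0 (1 / 2).
    exists y0, (Num.min 1 (y0 + d / 2)); split => //.
    - by rewrite lt_min ltrDl d20 andbT; lra.
    - by rewrite ge_min lexx.
    - by apply/andP; split => //; lra.
    - by rewrite le_min y01 lerDl (ltW d20)/= ge_min lexx orbT.
  exists (Num.max 0 (y0 - d / 2)), y0; split => //.
  - by rewrite gt_max; apply/andP; split; lra.
  - by rewrite le_max lexx.
  - by rewrite le_max lexx orbT/= ge_max y00/=; lra.
  - by rewrite lexx lerDl ltW.
pose p n : R := a + (b - a) / n.+1%:R.
have ba : 0 < b - a by rewrite subr_gt0.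
have p_dec n m : (n <= m)%N -> p m <= p n.
  move=> nm; rewrite lerD2l ler_pM2l// lef_pV2 ?posrE ?ltr0n// ler_nat ltnS//.
have p_sdec n : p n.+1 < p n.
  by rewrite ltrD2l ltr_pM2l// ltf_pV2 ?posrE ?ltr0n// ltr_nat.
have ap n : a < p n by rewrite ltrDl divr_gt0// ltr0n.
have pb n : p n <= b.
  by apply: le_trans (p_dec 0%N n _) _ => //; rewrite /p divr1 addrC subrK.
exists (fun n => `]p n.+1, p n]%classic); split.
- by move=> n; exact: measurable_itv.
- move=> n y /=; rewrite !in_itv/= => /andP[y1 y2].
  have y3 := ap n.+1; have y4 := pb n.
  move: ay yb => /andP[? ?] /andP[? ?].
  split; first by apply/andP; split; lra.
  by rewrite ltr_norml; apply/andP; split; lra.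
- move=> n; rewrite lebesgue_measure_itv/= lte_fin p_sdec; split.
    by rewrite -EFinB lte_fin subr_gt0.
  rewrite -EFinB lee_fin.
  have y3 := ap n.+1; have y4 := pb n.
  by move: ay yb => /andP[? ?] /andP[? ?]; lra.
- move=> n m; rewrite neq_ltn => /orP[nm|nm] y /=; rewrite !in_itv/= => /andP[h1 h2] /andP[h3 h4].
    by have := p_dec n.+1 m nm; lra.
  by have := p_dec m.+1 n nm; lra.
Qed.

Lemma mmeas_indic b m (J I : set R) (g : R * R -> 'cV[C]_m) :
  measurable (J : set (measurableTypeR R)) -> measurable (I : set (measurableTypeR R)) ->
  mmeas sq g ->
  mmeas sq (fun k => if (ic b k \in J) && (oc b k \in I) then g k else 0).
Proof.
move=> mJ mI mg i j c.
have mi (D : set R) (o : R * R -> R) : measurable (D : set (measurableTypeR R)) ->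
    measurable_fun setT o -> measurable_fun sq (fun k => \1_D (o k) : R).
  move=> mD mo; apply: measurable_funTS.
  by apply: (measurableT_comp (measurable_indic _)).
have -> : (fun k => cp c ((if (ic b k \in J) && (oc b k \in I) then g k else 0) i j)) =
   (fun k => (\1_J (ic b k) * \1_I (oc b k)) * cp c (g k i j)).
  apply/funext => k; rewrite !indicE.
  case: (ic b k \in J); case: (oc b k \in I) => /=;
    by rewrite ?mxE ?cp0 ?mul0r ?mulr0 ?mul0r ?mul1r.
apply: measurable_funM; last exact: mg.
apply: measurable_funM; apply: mi => //; [exact: measurable_ic|exact: measurable_oc].
Qed.

Lemma L2_norm_indic_neq0 b m (J I : set R) (v : 'cV[C]_m) :
  measurable (J : set (measurableTypeR R)) -> measurable (I : set (measurableTypeR R)) ->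
  J `<=` I01 -> I `<=` I01 -> (0 < mu J)%E -> (0 < mu I)%E -> v != 0 ->
  let f k := if (ic b k \in J) && (oc b k \in I) then v else 0 in
  is_L2 f /\ L2_norm (toL2 f) != 0.
Proof.
move=> mJ mI JI II J0 I0 v0 f.
have mf : mmeas sq f by apply: mmeas_indic => //; exact: mmeas_cst.
have fL : is_L2 f.
  apply: (L2_bounded (nsq_ge0 v) mf _).1 => k _.
  by rewrite /f; case: ifP => // _; rewrite nsq0 nsq_ge0.
split => //; apply: contraTneq (I0) => /L2_norm0 f0.
have zL : is_L2 (fun=> 0 : 'cV[C]_m).
  by apply: eq_is_L2 (is_L2B fL fL) => k _; rewrite subrr.
have z0 : toL2 (fun=> 0 : 'cV[C]_m) = 0.
  rewrite -(subrr (toL2 f)) -(toL2B fL fL); congr toL2.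
  by apply/funext => k; rewrite subrr.
have [N [mN N0 PN]] : {ae mu2, forall k, sq k -> f k = 0}.
  by apply/(toL2_eq fL zL); rewrite f0 z0.
have sub (x y : R) : J x -> I y -> N (pt b x y).
  move=> Jx Iy; apply: PN => /= h; move/eqP: v0; apply.
  have := h _; rewrite /f ic_pt oc_pt !mem_set//=; apply.
  by apply/square_pt; split; [exact: JI|exact: II].
have P0 : (mu J * mu I)%E = 0%E.
  case: (b) sub => sub.
    have : (mu2 (J `*` I) <= 0)%E.
      rewrite -N0; apply: le_measure; rewrite ?inE//; first exact: measurableX.
      by move=> [x y] [/= Jx Iy]; exact: sub.
    rewrite measure_le0 => /eqP e.
    have h : mu2 (J `*` I) = (mu J * mu I)%E := product_measure1E mu mu mJ mI.
    by rewrite -h.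
  have : (mu2 (I `*` J) <= 0)%E.
    rewrite -N0; apply: le_measure; rewrite ?inE//; first exact: measurableX.
    by move=> [x y] [/= Ix Jy]; exact: (sub y x).
  rewrite measure_le0 muleC => /eqP e.
  have h : mu2 (I `*` J) = (mu I * mu J)%E := product_measure1E mu mu mI mJ.
  by rewrite -h.
move/eqP: P0; rewrite mule_eq0 => /orP[/eqP J00|/eqP I00].
  by move: J0; rewrite J00 ltxx.
by rewrite I00 ltxx.
Qed.

(** Averaging gains the square root of the measure of the support in the averaged
    direction. *)
Lemma supported_avg_small b M m (A : R * R -> 'M[C]_(M, m)) (B : R * R -> 'M[C]_(m, M)) :
  mx_continuous A -> mx_continuous B ->
  forall e, 0 < e -> exists2 s, 0 < s & forall f S, is_L2 f ->
    measurable (S : set (measurableTypeR R)) -> (mu S <= s%:E)%E ->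
    (forall k, sq k -> ~ S (ic b k) -> f k = 0) ->
    L2_norm (mul_op A (avg_op b (mul_op B (toL2 f)))) <= e * L2_norm (toL2 f).
Proof.
move=> cA cB e e0.
have [_ [c c0 cP]] := blin_mul_op (mx_continuous_Linf cA).
have bB := mx_continuous_Linf cB.
have [_ [c' c'0 c'P]] := blin_mul_op bB.
have cc : 0 < c * c' + 1 by rewrite ltr_wpDl// mulr_ge0.
have [r r0 re] : exists2 r : R, 0 < r & c * c' * r <= e.
  exists (e / (c * c' + 1)); first by rewrite divr_gt0.
  by rewrite mulrCA ler_piMr ?(ltW e0)// ler_pdivrMr// mul1r lerDl.
exists (r ^+ 2); first by rewrite exprn_gt0.
move=> f S fL mS Ss fS.
have BfL := is_L2_mul bB fL.
have BfS k : sq k -> ~ S (ic b k) -> B k *m f k = 0.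
  by move=> kD nS; rewrite fS// mulmx0.
have r20 : 0 < r ^+ 2 by rewrite exprn_gt0.
have [aL aN] := avgf_supported BfL mS r20 Ss BfS.
have h : L2_norm (avg_op b (mul_op B (toL2 f))) <= r * (c' * L2_norm (toL2 f)).
  apply: (@le_trans _ _ (r * L2_norm (mul_op B (toL2 f)))); last first.
    by rewrite ler_pM2l.
  rewrite (mul_op_toL2 bB fL) (avg_op_toL2 b BfL).
  rewrite -(@ler_pXn2r _ 2)// ?nnegrE ?L2_norm_ge0// ?exprMn//.
  by rewrite mulr_ge0 ?L2_norm_ge0// (ltW r0).
apply: le_trans (cP _) _.
apply: (@le_trans _ _ (c * (r * (c' * L2_norm (toL2 f))))); first by rewrite ler_wpM2l.
have -> : c * (r * (c' * L2_norm (toL2 f))) = (c * c') * r * L2_norm (toL2 f).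
  by move: (L2_norm _) => x; ring.
by rewrite ler_wpM2r ?L2_norm_ge0.
Qed.

End SingularSequences.

(** * Singular sequences at a degenerate symbol *)

Section Necessity.
Context (R : realType).
Notation C := R[i].
Notation sq := (@square R).
Notation I01 := (@unit_itv R).

Lemma small_sqr (c r : R) : 0 <= c -> 0 < r -> exists2 e, 0 < e & c * e ^+ 2 <= r ^+ 2.
Proof.
move=> c0 r0; have c1 : 0 < c + 1 by rewrite ltr_wpDl.
exists (r / (c + 1)); first by rewrite divr_gt0.
rewrite expr_div_n mulrA ler_pdivrMr ?exprn_gt0// mulrC ler_pM2l ?exprn_gt0//.
by have := sqr_ge0 c; rewrite sqrrD1; lra.
Qed.

Lemma det0_ker n (A : 'M[C]_n) : \det A = 0 -> exists2 v : 'cV[C]_n, v != 0 & A *m v = 0.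
Proof.
move=> dA; have /det0P[v v0 vA] : \det A^T == 0 by rewrite det_tr dA.
by exists v^T; [rewrite trmx_eq0|apply: trmx_inj; rewrite trmx_mul trmxK trmx0].
Qed.

(** Since [A k0 v = 0], only the difference [A k - A k0], small by continuity,
    acts on [v]. *)
Lemma nsq_near_kernel m n (A : R * R -> 'M[C]_(m, n)) k0 (v : 'cV[C]_n) r :
  mx_continuous A -> sq k0 -> A k0 *m v = 0 -> 0 < r ->
  exists2 d, 0 < d & forall k, sq k -> `|k.1 - k0.1| < d -> `|k.2 - k0.2| < d ->
    nsq (A k *m v) <= r ^+ 2 * nsq v.
Proof.
move=> cA k0D Av r0.
have c0 : 0 <= m%:R * n%:R ^+ 2 :> R by rewrite mulr_ge0// sqr_ge0.
have [e e0 er] := small_sqr c0 r0.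
have [d d0 dP] := heine_mx cA e0.
exists d => // k kD k1 k2.
have -> : A k *m v = (A k - A k0) *m v by rewrite mulmxBl Av subr0.
apply: (@le_trans _ _ ((m%:R * (n%:R * e) ^+ 2) * nsq v)).
  apply: nsq_mulmx; first exact: ltW.
  by move=> i j; have := dP k k0 kD k0D k1 k2 i j; rewrite !mxE.
by rewrite ler_wpM2r ?nsq_ge0// exprMn mulrA.
Qed.

(** A kernel vector [v] of [A0 k0], spread over thin disjoint rectangles close to
    [k0]. Multiplication by [A0] is small there by continuity, and both averages are
    small because the rectangles are thin in both directions. *)
Lemma singular_A0 M m1 m2 (A0 : R * R -> 'M[C]_M)
    (A1 : R * R -> 'M[C]_(M, m1)) (B1 : R * R -> 'M[C]_(m1, M))
    (A2 : R * R -> 'M[C]_(M, m2)) (B2 : R * R -> 'M[C]_(m2, M)) k0 :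
  mx_continuous A0 -> mx_continuous A1 -> mx_continuous B1 ->
  mx_continuous A2 -> mx_continuous B2 -> sq k0 -> \det (A0 k0) = 0 ->
  forall e, 0 < e -> exists f : nat -> R * R -> 'cV[C]_M,
    [/\ forall i, is_L2 (f i), forall i, L2_norm (toL2 (f i)) != 0,
        forall i j, i != j -> forall k, sq k -> f i k = 0 \/ f j k = 0 &
        forall i, L2_norm (mul_op A0 (toL2 (f i)) +
            mul_op A1 (avg_op true (mul_op B1 (toL2 (f i)))) +
            mul_op A2 (avg_op false (mul_op B2 (toL2 (f i))))) <=
          e * L2_norm (toL2 (f i))].
Proof.
move=> cA0 cA1 cB1 cA2 cB2 k0D /det0_ker[v v0 Av] e e0.
have e30 : 0 < e / 3 by rewrite divr_gt0.
have [d0 d00 d0P] := nsq_near_kernel cA0 k0D Av e30.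
have [s1 s10 s1P] := supported_avg_small true cA1 cB1 e30.
have [s2 s20 s2P] := supported_avg_small false cA2 cB2 e30.
pose d := Num.min d0 (Num.min s1 s2).
have dP : 0 < d by rewrite !lt_min d00 s10.
have dd0 : d <= d0 by rewrite ge_min lexx.
have ds1 : d <= s1 by rewrite !ge_min lexx orbT.
have ds2 : d <= s2 by rewrite !ge_min lexx !orbT.
have [J [mJ JI Jmu _]] := disjoint_intervals k0D.1 dP.
have [I [mI II Imu Idis]] := disjoint_intervals k0D.2 dP.
pose f n (k : R * R) : 'cV[C]_M :=
  if (ic true k \in J 0%N) && (oc true k \in I n) then v else 0.
have fP n : is_L2 (f n) /\ L2_norm (toL2 (f n)) != 0.
  apply: L2_norm_indic_neq0 => //; first by move=> y /JI[].
  - by move=> y /II[].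
  - by have [] := Jmu 0%N.
  - by have [] := Imu n.
exists f; split=> [i|i|i j ij k kD|i].
- by have [] := fP i.
- by have [] := fP i.
- rewrite /f; case: (boolP (_ && (oc true k \in I i))) => [/andP[_ /set_mem Ii]|_]; last by left.
  case: (boolP (_ && (oc true k \in I j))) => [/andP[_ /set_mem Ij]|_]; last by right.
  by have := Idis i j ij _ Ii Ij.
have [fL _] := fP i.
have h0 : L2_norm (mul_op A0 (toL2 (f i))) <= e / 3 * L2_norm (toL2 (f i)).
  have bA0 := mx_continuous_Linf cA0; rewrite (mul_op_toL2 bA0 fL).
  have he : 0 <= e / 3 * L2_norm (toL2 (f i)) := mulr_ge0 (ltW e30) (L2_norm_ge0 _).
  rewrite -(@ler_pXn2r _ 2)// ?nnegrE ?L2_norm_ge0//.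
  rewrite exprMn.
  apply: (L2_domination _ fL (is_L2_mmeas (is_L2_mul bA0 fL)) _).2; first exact: sqr_ge0.
  move=> k kD; rewrite /f; case: ifP => [/andP[/set_mem Jk /set_mem Ik]|_].
    apply: d0P => //.
      by have [_ h] := JI _ _ Jk; apply: lt_le_trans dd0.
    by have [_ h] := II _ _ Ik; apply: lt_le_trans dd0.
  by rewrite mulmx0 !nsq0 mulr0.
have h1 : L2_norm (mul_op A1 (avg_op true (mul_op B1 (toL2 (f i))))) <= e / 3 * L2_norm (toL2 (f i)).
  apply: (s1P _ (J 0%N) fL (mJ 0%N)).
    by apply: le_trans (Jmu 0%N).2 _; rewrite lee_fin.
  by move=> k kD nJ; rewrite /f memNset.
have h2 : L2_norm (mul_op A2 (avg_op false (mul_op B2 (toL2 (f i))))) <= e / 3 * L2_norm (toL2 (f i)).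
  apply: (s2P _ (I i) fL (mI i)).
    by apply: le_trans (Imu i).2 _; rewrite lee_fin.
  by move=> k kD nI; rewrite /f (memNset nI) andbF.
apply: le_trans (L2_ler_normD _ _) _.
have h3 := L2_ler_normD (mul_op A0 (toL2 (f i))) (mul_op A1 (avg_op true (mul_op B1 (toL2 (f i))))).
move: h0 h1 h2 h3; set x := L2_norm (toL2 (f i)).
by move: (L2_norm _) (L2_norm _) (L2_norm _) (L2_norm _) => y1 y2 y3 y4; lra.
Qed.

(** A kernel vector [v] of the symbol at [y0] gives functions [g] equal to [v] on
    thin disjoint strips around [y0], constant along the direction of the average.
    For [f = F g] the average of [B f] is [(E - 1) g], so that [f + F <B f>] equals
    [F E g], which is small because [E] almost kills [v] near [y0]. The average in
    the other direction is small because the strips are thin. *)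
Lemma singular_symE b M m n (A0 : R * R -> 'M[C]_M)
    (F : R * R -> 'M[C]_(M, m)) (B : R * R -> 'M[C]_(m, M))
    (A' : R * R -> 'M[C]_(M, n)) (B' : R * R -> 'M[C]_(n, M)) y0 :
  mx_continuous A0 -> mx_continuous F -> mx_continuous B ->
  mx_continuous A' -> mx_continuous B' -> I01 y0 -> \det (symE b F B y0) = 0 ->
  forall e, 0 < e -> exists f : nat -> R * R -> 'cV[C]_M,
    [/\ forall i, is_L2 (f i), forall i, L2_norm (toL2 (f i)) != 0,
        forall i j, i != j -> forall k, sq k -> f i k = 0 \/ f j k = 0 &
        forall i, L2_norm (mul_op A0 (toL2 (f i) + one_sided b F B (toL2 (f i))) +
            mul_op A' (avg_op (~~ b) (mul_op B' (toL2 (f i))))) <=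
          e * L2_norm (toL2 (f i))].
Proof.
move=> cA0 cF cB cA' cB' Iy0 /det0_ker[v v0 Ev] e e0.
have e20 : 0 < e / 2 by rewrite divr_gt0.
have [s s0 sP] := supported_avg_small (~~ b) cA' cB' e20.
have bF := mx_continuous_Linf cF; have bB := mx_continuous_Linf cB.
have bA0 := mx_continuous_Linf cA0.
have [_ [cAF cAF0 cAFP]] := blin_mul_op (mx_continuous_Linf (mx_continuousM cA0 cF)).
have [_ [cB_ cB0 cBP]] := blin_comp (@blin_avg_op R b m) (blin_mul_op bB).
have cE : mx_continuous (fun k => symE b F B (oc b k)) := @mx_continuous_symE R b _ _ _ _ cF cB.
have bE := mx_continuous_Linf cE.
(* [r] is such that the defect [cAF * (2 * cB_) * r] is at most [e / 2]. *)
have p0 : 0 < cAF * (2 * cB_) + 1 by rewrite ltr_wpDl// !mulr_ge0.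
have [r [r0 r1 rP]] : exists r, [/\ 0 < r, r <= 1 / 2 & cAF * (2 * cB_) * r <= e / 2].
  exists (Num.min (1 / 2) (e / 2 / (cAF * (2 * cB_) + 1))); split.
  - by rewrite lt_min !divr_gt0.
  - by rewrite ge_min lexx.
  - apply: (@le_trans _ _ (cAF * (2 * cB_) * (e / 2 / (cAF * (2 * cB_) + 1)))).
      by rewrite ler_wpM2l ?mulr_ge0// ge_min lexx orbT.
    by rewrite mulrCA ler_piMr ?(ltW e20)// ler_pdivrMr// mul1r lerDl.
have k0D : sq (pt b 0 y0).
  by apply/square_pt; split => //; rewrite /unit_itv/= in_itv/= lexx ler01.
have Ev' : symE b F B (oc b (pt b 0 y0)) *m v = 0 by rewrite oc_pt.
have [d0 d00 d0P] := nsq_near_kernel cE k0D Ev' r0.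
have near_E k : sq k -> `|oc b k - y0| < d0 ->
    nsq (symE b F B (oc b k) *m v) <= r ^+ 2 * nsq v.
  move=> kD ky; have := d0P (pt b 0 (oc b k)) _ _ _; rewrite oc_pt; apply.
  - apply/square_pt; split; last exact: square_oc.
    by rewrite /unit_itv/= in_itv/= lexx ler01.
  - by case: (b) ky => //= _; rewrite subrr normr0.
  - by case: (b) ky => //= _; rewrite subrr normr0.
pose d := Num.min d0 s.
have dP : 0 < d by rewrite !lt_min d00.
have dd0 : d <= d0 by rewrite ge_min lexx.
have ds : d <= s by rewrite !ge_min lexx orbT.
have [I [mI II Imu Idis]] := disjoint_intervals Iy0 dP.
pose g i (k : R * R) : 'cV[C]_m :=
  if (ic b k \in I01) && (oc b k \in I i) then v else 0.
have gP i : is_L2 (g i) /\ L2_norm (toL2 (g i)) != 0.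
  apply: L2_norm_indic_neq0 => //; first exact: measurable_I01.
  - by move=> y /II[].
  - by rewrite [X in (_ < X)%E]mu_I01 lte01.
  - by have [] := Imu i.
have g_oc i k l : sq k -> sq l -> oc b k = oc b l -> g i k = g i l.
  move=> kD lD kl; rewrite /g kl.
  by rewrite (mem_set (square_ic b kD)) (mem_set (square_ic b lD)).
pose f i (k : R * R) := F k *m g i k.
have fL i : is_L2 (f i) := is_L2_mul bF (gP i).1.
have BfL i : is_L2 (fun k => B k *m f i k) := is_L2_mul bB (fL i).
have avgBf i k : sq k -> avgf b (fun k => B k *m f i k) k =
    (symE b F B (oc b k) - 1%:M) *m g i k.
  move=> kD; rewrite /symE addrC addKr.
  have -> : avgf b (fun k => B k *m f i k) k =
     avgf b (fun l => (B l *m F l) *m g i (pt b (ic b k) (oc b l))) k.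
    apply: eq_mx_integral => x Ix; rewrite -mulmxA; congr (_ *m (_ *m _)).
    have Ok := square_oc b kD.
    have xD : sq (pt b x (oc b k)) by apply/square_pt.
    apply: g_oc => //; last by rewrite !oc_pt.
    by apply/square_pt; split; [exact: square_ic|rewrite oc_pt].
  rewrite (avgf_mulr (mx_continuous_Linf (mx_continuousM cB cF)) kD).
    by rewrite pt_icoc.
  by move=> k' l' ->.
have EgL i : is_L2 (fun k => symE b F B (oc b k) *m g i k) := is_L2_mul bE (gP i).1.
have Eg_small i : L2_norm (toL2 (fun k => symE b F B (oc b k) *m g i k)) <= r * L2_norm (toL2 (g i)).
  have he : 0 <= r * L2_norm (toL2 (g i)) := mulr_ge0 (ltW r0) (L2_norm_ge0 _).
  rewrite -(@ler_pXn2r _ 2)// ?nnegrE ?L2_norm_ge0//.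
  rewrite exprMn.
  apply: (L2_domination _ (gP i).1 (is_L2_mmeas (EgL i)) _).2; first exact: sqr_ge0.
  move=> k kD; rewrite /g; case: ifP => [/andP[_ /set_mem Ik]|_].
    apply: near_E => //.
    by have [_ h] := II _ _ Ik; apply: lt_le_trans dd0.
  by rewrite mulmx0 !nsq0 mulr0.
have aL i : is_L2 (avgf b (fun k => B k *m f i k)) := (avgf_L2 b (BfL i)).1.
have avgE i : avg_op b (mul_op B (toL2 (f i))) =
    toL2 (fun k => symE b F B (oc b k) *m g i k) - toL2 (g i).
  rewrite (mul_op_toL2 bB (fL i)) (avg_op_toL2 b (BfL i)) -(toL2B (EgL i) (gP i).1).
  apply: toL2_eq_on => //; first exact: is_L2B (EgL i) (gP i).1.
  by move=> k kD; rewrite (avgBf i k kD) mulmxBl mul1mx.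
have g_le_f i : L2_norm (toL2 (g i)) <= 2 * cB_ * L2_norm (toL2 (f i)).
  have h1 := cBP (toL2 (f i)); have h2 := Eg_small i.
  have h3 : L2_norm (toL2 (g i)) <=
      L2_norm (toL2 (fun k => symE b F B (oc b k) *m g i k)) +
      L2_norm (avg_op b (mul_op B (toL2 (f i)))).
    rewrite -(L2_normN (avg_op _ _)) avgE.
    move: (toL2 (fun k => _)) (toL2 (g i)) => x y.
    by rewrite -{1}(subKr x y); exact: L2_ler_normD.
  have h4 : r * L2_norm (toL2 (g i)) <= 1 / 2 * L2_norm (toL2 (g i)).
    by rewrite ler_wpM2r ?L2_norm_ge0.
  move: h1 h2 h3 h4; rewrite /comp.
  move: (L2_norm (avg_op _ _)) (L2_norm (toL2 (g i))) (L2_norm (toL2 (f i))) (L2_norm (toL2 _)).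
  by move=> x1 x2 x3 x4; lra.
exists f; split=> [i|i|i j ij k kD|i].
- exact: fL.
- apply: contra_neq (gP i).2 => f0; apply/eqP; rewrite eq_le L2_norm_ge0 andbT.
  by have := g_le_f i; rewrite f0 mulr0.
- rewrite /f /g; case: (boolP (_ && (oc b k \in I i))) => [/andP[_ /set_mem Ii]|_].
    case: (boolP (_ && (oc b k \in I j))) => [/andP[_ /set_mem Ij]|_].
      by have := Idis i j ij _ Ii Ij.
    by right; rewrite mulmx0.
  by left; rewrite mulmx0.
have h1 : L2_norm (mul_op A0 (toL2 (f i) + one_sided b F B (toL2 (f i)))) <= e / 2 * L2_norm (toL2 (f i)).
  have -> : toL2 (f i) + one_sided b F B (toL2 (f i)) =
      mul_op F (toL2 (fun k => symE b F B (oc b k) *m g i k)).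
    rewrite /one_sided avgE (blin_subE _ _ (blin_mul_op bF)) (mul_op_toL2 bF (gP i).1).
    by rewrite addrCA subrr addr0.
  rewrite (mul_op_mul _ bA0 bF); apply: le_trans (cAFP _) _.
  apply: (@le_trans _ _ (cAF * (r * (2 * cB_ * L2_norm (toL2 (f i)))))).
    rewrite ler_wpM2l//; apply: le_trans (Eg_small i) _.
    by rewrite ler_wpM2l// ltW.
  have -> : cAF * (r * (2 * cB_ * L2_norm (toL2 (f i)))) =
      cAF * (2 * cB_) * r * L2_norm (toL2 (f i)) by move: (L2_norm _) => x; ring.
  by rewrite ler_wpM2r ?L2_norm_ge0.
have h2 : L2_norm (mul_op A' (avg_op (~~ b) (mul_op B' (toL2 (f i))))) <= e / 2 * L2_norm (toL2 (f i)).
  apply: (sP _ (I i) (fL i) (mI i)).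
    by apply: le_trans (Imu i).2 _; rewrite lee_fin.
  move=> k kD nI; rewrite /f /g.
  have -> : oc b k = ic (~~ b) k by case: (b).
  by rewrite (memNset nI) andbF mulmx0.
apply: le_trans (L2_ler_normD _ _) _.
by move: h1 h2; move: (L2_norm _) (L2_norm _) (L2_norm _) => x y z; lra.
Qed.

End Necessity.

(** * Inverses and the operator algebra *)

Section FiniteRankFactors.
Context (R : realType).
Notation C := R[i].
Notation I01 := (@unit_itv R).
Notation mu := (@lebesgue_measure R).

(** [|u| = |S (A u)|] and [S] is bounded. *)
Lemma inverse_op_bounded_below m (A S : L2 R m -> L2 R m) : inverse_op A S ->
  exists2 c, 0 < c & forall u, c * L2_norm u <= L2_norm (A u).
Proof.
move=> [_ /blin_bounded_op[_ [c c0 cS]] SA _].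
have c1 : 0 < c + 1 by rewrite ltr_wpDl.
exists (c + 1)^-1; first by rewrite invr_gt0.
move=> u; rewrite mulrC ler_pdivrMr// mulrC.
have := cS (A u); rewrite (congr1 (fun f => f u) SA : S (A u) = u).
have := L2_norm_ge0 (A u); rewrite /idfun.
by move: (L2_norm _) (L2_norm _) => x y; lra.
Qed.

Lemma inverse_op_sym m (T S : L2 R m -> L2 R m) : inverse_op T S -> inverse_op S T.
Proof. by case. Qed.

Lemma inverse_op_comp m (T S T' S' : L2 R m -> L2 R m) :
  inverse_op T S -> inverse_op T' S' -> inverse_op (T \o T') (S' \o S).
Proof.
move=> [/blin_bounded_op bT /blin_bounded_op bS ST TS].
move=> [/blin_bounded_op bT' /blin_bounded_op bS' ST' TS'].
split; [exact/blin_bounded_op/blin_comp..| |].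
  by apply/funext => u /=; rewrite (congr1 (fun f => f (T' u)) ST : S (T _) = _);
    exact: (congr1 (fun f => f u) ST').
by apply/funext => u /=; rewrite (congr1 (fun f => f (S u)) TS' : T' (S' _) = _);
  exact: (congr1 (fun f => f u) TS).
Qed.

Lemma inverse_op_unique m (T S S' : L2 R m -> L2 R m) :
  inverse_op T S -> inverse_op T S' -> S = S'.
Proof.
move=> [_ _ ST _] [_ _ _ TS']; apply/funext => u.
have <- := congr1 (fun f => S (f u)) TS'.
exact: (congr1 (fun f => f (S' u)) ST).
Qed.

Lemma mul_opD m n (A B : R * R -> 'M[C]_(m, n)) u : mx_Linf A -> mx_Linf B ->
  mul_op (fun k => A k + B k) u = mul_op A u + mul_op B u.
Proof.
move=> bA bB; have uL := is_L2_rep u.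
rewrite -[RHS]toL2D; [|exact: is_L2_mul..].
by congr toL2; apply/funext => k; rewrite mulmxDl.
Qed.

Lemma mul_op0 m n u : mul_op (fun=> 0 : 'M[C]_(m, n)) u = 0.
Proof.
have b0 := mx_continuous_Linf (@mx_continuous_cst R m n 0).
apply: (eq_trans _ (subrr (mul_op (fun=> 0 : 'M[C]_(m, n)) u))).
rewrite -(mul_opB u b0 b0); congr (mul_op _ u); apply/funext => k.
by rewrite subrr.
Qed.

(** Averages commute with constant matrices; this moves the averages of vectors of
    length [m] to vectors of length [M] below. *)
Lemma avg_op_constM b m n (J : 'M[C]_(m, n)) (w : L2 R n) :
  avg_op b (mul_op (fun=> J) w) = mul_op (fun=> J) (avg_op b w).
Proof.
have bJ := mx_continuous_Linf (@mx_continuous_cst R m n J).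
have wL := is_L2_rep w; have JwL := is_L2_mul bJ wL.
have aL := (avgf_L2 b wL).1.
rewrite -(toL2_rep w) (mul_op_toL2 bJ wL) (avg_op_toL2 b JwL) (avg_op_toL2 b wL).
rewrite (mul_op_toL2 bJ aL); apply/toL2_eq.
- exact: (avgf_L2 b JwL).1.
- exact: is_L2_mul.
- have := ae_avgf_slice b wL; apply: filterS => k h kD.
  exact: (@mx_integral_constM R _ _ mu I01 measurable_I01 _ _ _ J
    (fun x => L2rep w (pt b x (oc b k))) (h kD)).
Qed.

Section Subalgebra.
Variables (M : nat) (X : set (L2 R M -> L2 R M)).
Hypotheses (alg_X : @bounded_subalgebra C (L2 R M) X).
Hypotheses (gen_X : @opalg_generators R M `<=` X).

Lemma subalgebra_mul_op (A : R * R -> 'M[C]_M) : mx_continuous A -> X (mul_op A).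
Proof. by move=> cA; apply: gen_X; left; exists A. Qed.

Lemma subalgebra_avg_op b : X (@avg_op R b M).
Proof. by apply: gen_X; case: b; right; [left|right; left]. Qed.

Lemma subalgebra_id : X idfun.
Proof.
rewrite (_ : idfun = mul_op (fun=> 1%:M)).
  exact/subalgebra_mul_op/mx_continuous_cst.
by apply/funext => u; rewrite mul_op_id.
Qed.

Lemma subalgebraB T S : X T -> X S -> X (T \- S).
Proof.
case: alg_X => _ XD XZ _ XT XS.
rewrite (_ : T \- S = T \+ (-1 \*: S)); first by apply: XD => //; exact: XZ.
by apply/funext => u /=; rewrite scaleN1r.
Qed.

(** The algebra only contains averages of vectors of length [M]. Writing the
    identity of size [m] as the sum of its diagonal units, the operator is a sum over
    [j] of an operator that carries the coordinate [j] through the coordinate [i0]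
    of vectors of length [M]. *)
Lemma subalgebra_one_sided b m (F : R * R -> 'M[C]_(M, m))
    (B : R * R -> 'M[C]_(m, M)) : (0 < M)%N ->
  mx_continuous F -> mx_continuous B ->
  X (mul_op F \o @avg_op R b m \o mul_op B).
Proof.
move=> M0 cF cB; case: alg_X => _ XD _ XM.
pose i0 : 'I_M := Ordinal M0.
have bB := mx_continuous_Linf cB.
have cst p q (J : 'M[C]_(p, q)) := mx_continuous_Linf (@mx_continuous_cst R p q J).
have cFJ p (J : 'M[C]_(m, p)) : mx_continuous (fun k => F k *m J).
  exact: mx_continuousM cF (@mx_continuous_cst R _ _ J).
have bFJ p (J : 'M[C]_(m, p)) := mx_continuous_Linf (cFJ p J).
suff h (s : seq 'I_m) : X (mul_op (fun k => F k *m \sum_(j <- s) delta_mx j j)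
    \o @avg_op R b m \o mul_op B).
  have := h (index_enum 'I_m).
  rewrite -mx1_sum_delta (_ : (fun k => F k *m 1%:M) = F)//.
  by apply/funext => k; rewrite mulmx1.
elim: s => [|j s IH].
  rewrite (_ : _ \o _ = mul_op (fun=> 0)).
    exact/subalgebra_mul_op/mx_continuous_cst.
  apply/funext => u /=; rewrite mul_op0; apply: (eq_trans _ (mul_op0 _ (avg_op b (mul_op B u)))).
  by apply: eq_mul_op => // k _; rewrite big_nil mulmx0.
rewrite (_ : _ \o _ =
    (mul_op (fun k => F k *m delta_mx j i0) \o @avg_op R b M \o
     mul_op (fun k => delta_mx i0 j *m B k)) \+
    (mul_op (fun k => F k *m \sum_(j <- s) delta_mx j j)
    \o @avg_op R b m \o mul_op B)).
  have cJB : mx_continuous (fun k => delta_mx i0 j *m B k : 'M[C]_M).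
    exact: mx_continuousM (@mx_continuous_cst R _ _ _) cB.
  apply: (XD _ _ _ IH); apply: (XM _ _ _ (subalgebra_mul_op cJB)).
  exact: (XM _ _ (subalgebra_mul_op (cFJ _ _)) (subalgebra_avg_op b)).
apply/funext => u /=.
rewrite -(mul_op_mul u (cst _ _ _) bB) avg_op_constM (mul_op_mul _ (bFJ _ _) (cst _ _ _)).
have cFj : mx_Linf (fun k => F k *m delta_mx j i0 *m delta_mx i0 j).
  exact/mx_continuous_Linf/mx_continuousM/mx_continuous_cst.
rewrite -(mul_opD _ cFj (bFJ _ _)); apply: eq_mul_op => // k _.
by rewrite big_cons mulmxDr -[F k *m _ *m _]mulmxA mul_delta_mx.
Qed.

End Subalgebra.
End FiniteRankFactors.

(** * Invertibility forces the symbols to be nondegenerate *)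

Section SymbolsNonzero.
Context (R : realType).
Notation C := R[i].
Notation sq := (@square R).
Notation I01 := (@unit_itv R).

(** Both averages and the compact term are treated as perturbations of the
    multiplication by [A0]. *)
Lemma det_A0_neq0 M m1 m2 (A0 : R * R -> 'M[C]_M)
    (A1 : R * R -> 'M[C]_(M, m1)) (B1 : R * R -> 'M[C]_(m1, M))
    (A2 : R * R -> 'M[C]_(M, m2)) (B2 : R * R -> 'M[C]_(m2, M))
    (A K : L2 R M -> L2 R M) c :
  mx_continuous A0 -> mx_continuous A1 -> mx_continuous B1 ->
  mx_continuous A2 -> mx_continuous B2 -> compact_map K ->
  (forall u, A u = mul_op A0 u + mul_op A1 (avg_op true (mul_op B1 u)) +
    mul_op A2 (avg_op false (mul_op B2 u)) + K u) ->
  0 < c -> (forall u, c * L2_norm u <= L2_norm (A u)) ->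
  forall k, sq k -> \det (A0 k) != 0.
Proof.
move=> cA0 cA1 cB1 cA2 cB2 cK AE c0 cA k kD; apply/eqP => d0.
have bT : blin (mul_op A0 \+ one_sided true A1 B1 \+ one_sided false A2 B2).
  apply: blinD; last exact: blin_one_sided.
  by apply: blinD; [exact/blin_mul_op/mx_continuous_Linf|exact: blin_one_sided].
exact: (no_singular_sequence c0 cA cK bT AE
  (singular_A0 cA0 cA1 cB1 cA2 cB2 kD d0)).
Qed.

Lemma mul_op_invmx_one_sided b M m (A0 : R * R -> 'M[C]_M)
    (F : R * R -> 'M[C]_(M, m)) (B : R * R -> 'M[C]_(m, M)) u :
  mx_continuous A0 -> mx_continuous F ->
  (forall k, sq k -> \det (A0 k) != 0) ->
  mul_op A0 (one_sided b (fun k => invmx (A0 k) *m F k) B u) =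
  one_sided b F B u.
Proof.
move=> cA0 cF dA0; have cCF := mx_continuousM (mx_continuousV cA0 dA0) cF.
have bCF := mx_continuous_Linf cCF; have bA0 := mx_continuous_Linf cA0.
apply: (eq_trans (mul_op_mul _ bA0 bCF)); apply: eq_mul_op.
  exact/mx_continuous_Linf/mx_continuousM.
by move=> k kD; rewrite mulKVmx// unitmxE unitfE; exact: dA0.
Qed.

(** Dividing by [A0] exhibits the average in direction [b] as a one-sided
    operator; the other average is a perturbation. *)
Lemma det_symE_neq0 b M m n (A0 : R * R -> 'M[C]_M)
    (F : R * R -> 'M[C]_(M, m)) (B : R * R -> 'M[C]_(m, M))
    (A' : R * R -> 'M[C]_(M, n)) (B' : R * R -> 'M[C]_(n, M))
    (A K : L2 R M -> L2 R M) c :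
  mx_continuous A0 -> mx_continuous F -> mx_continuous B ->
  mx_continuous A' -> mx_continuous B' -> compact_map K ->
  (forall k, sq k -> \det (A0 k) != 0) ->
  (forall u, A u = mul_op A0 u + mul_op F (avg_op b (mul_op B u)) +
    mul_op A' (avg_op (~~ b) (mul_op B' u)) + K u) ->
  0 < c -> (forall u, c * L2_norm u <= L2_norm (A u)) ->
  forall y, I01 y -> \det (symE b (fun k => invmx (A0 k) *m F k) B y) != 0.
Proof.
move=> cA0 cF cB cA' cB' cK dA0 AE c0 cA y Iy; apply/eqP => d0.
have cCF := mx_continuousM (mx_continuousV cA0 dA0) cF.
have bA0 := blin_mul_op (mx_continuous_Linf cA0).
pose T u := mul_op A0 (u + one_sided b (fun k => invmx (A0 k) *m F k) B u) +
  one_sided (~~ b) A' B' u.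
have bT : blin T.
  apply: (@blinD _ _ _ (mul_op A0 \o (idfun \+ one_sided b _ B)) (one_sided (~~ b) A' B')).
    by apply: blin_comp => //; apply: blinD; [exact: blin_id|exact: blin_one_sided].
  exact: blin_one_sided.
have AT u : A u = T u + K u.
  by rewrite AE /T (blin_addE _ _ bA0) mul_op_invmx_one_sided.
exact: (no_singular_sequence c0 cA cK bT AT
  (singular_symE cA0 cCF cB cA' cB' Iy d0)).
Qed.

End SymbolsNonzero.

(** * The regularizer *)

Section Regularizer.
Context (R : realType) (M M1 M2 : nat).
Notation C := R[i].
Notation sq := (@square R).
Notation I01 := (@unit_itv R).
Variables (A0 : R * R -> 'M[C]_M).
Variables (A1 : R * R -> 'M[C]_(M, M1)) (A2 : R * R -> 'M[C]_(M, M2)).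
Variables (B1 : R * R -> 'M[C]_(M1, M)) (B2 : R * R -> 'M[C]_(M2, M)).
Variables (K : L2 R M -> L2 R M).
Hypotheses (cA0 : mx_continuous A0).
Hypotheses (cA1 : mx_continuous A1) (cA2 : mx_continuous A2).
Hypotheses (cB1 : mx_continuous B1) (cB2 : mx_continuous B2).
Hypotheses (cK : compact_op K).
Hypotheses (detE0 : forall k, sq k -> \det (A0 k) != 0).
Hypotheses (detE1 : forall y, I01 y -> \det (symE1 A0 A1 B1 y) != 0).
Hypotheses (detE2 : forall y, I01 y -> \det (symE2 A0 A2 B2 y) != 0).

Let C0 := symC0 A0.
Let C1 := symC1 A0 A1.
Let C2 := symC2 A0 A2.
Let RR := R_op A0 A1 A2 B1 B2.
Let K1 := K1_op A0 A1 A2 B1 B2 K.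
Let S1 := one_sided true C1 B1.
Let S2 := one_sided false C2 B2.
Let P1 := one_sided_inv true C1 B1.
Let P2 := one_sided_inv false C2 B2.

Let cC0 : mx_continuous C0.
Proof. exact: mx_continuousV. Qed.
Let cC1 : mx_continuous C1.
Proof. exact: mx_continuousM. Qed.
Let cC2 : mx_continuous C2.
Proof. exact: mx_continuousM. Qed.
Let dE1 : forall y, I01 y -> \det (symE true C1 B1 y) != 0.
Proof. exact: detE1. Qed.
Let dE2 : forall y, I01 y -> \det (symE false C2 B2 y) != 0.
Proof. exact: detE2. Qed.

Let R_opE u : RR u =
  (mul_op C0 u - P1 (mul_op C0 u)) - P2 (mul_op C0 u - P1 (mul_op C0 u)).
Proof. by []. Qed.

Let bC0 := blin_mul_op (mx_continuous_Linf cC0).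
Let bA0 := blin_mul_op (mx_continuous_Linf cA0).
Let bS1 : blin S1. Proof. exact: blin_one_sided. Qed.
Let bS2 : blin S2. Proof. exact: blin_one_sided. Qed.
Let bP1 : blin P1. Proof. exact: blin_one_sided_inv. Qed.
Let bP2 : blin P2. Proof. exact: blin_one_sided_inv. Qed.

Lemma blin_R_op : blin RR.
Proof.
have bid := @blin_id R M.
exact: (blin_comp (blin_comp (blinB bid bP2) (blinB bid bP1)) bC0).
Qed.

Lemma mul_op_A0C0 u : mul_op A0 (mul_op C0 u) = u.
Proof.
apply: (eq_trans (mul_op_mul u (mx_continuous_Linf cA0) (mx_continuous_Linf cC0))).
apply: (eq_trans _ (mul_op_id u)); apply: eq_mul_op.
  exact/mx_continuous_Linf/mx_continuousM.
by move=> k kD; rewrite mulmxV// unitmxE unitfE; exact: detE0.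
Qed.

Lemma mul_op_C0A0 u : mul_op C0 (mul_op A0 u) = u.
Proof.
apply: (eq_trans (mul_op_mul u (mx_continuous_Linf cC0) (mx_continuous_Linf cA0))).
apply: (eq_trans _ (mul_op_id u)); apply: eq_mul_op.
  exact/mx_continuous_Linf/mx_continuousM.
by move=> k kD; rewrite mulVmx// unitmxE unitfE; exact: detE0.
Qed.

Definition R_op_inv (u : L2 R M) : L2 R M :=
  mul_op A0 ((u + S2 u) + S1 (u + S2 u)).

Lemma inverse_R_op : inverse_op RR R_op_inv.
Proof.
split.
- exact/blin_bounded_op/blin_R_op.
- have bid := @blin_id R M; apply/blin_bounded_op.
  exact: (blin_comp bA0 (blin_comp (blinD bid bS1) (blinD bid bS2))).
- apply/funext => u; rewrite /= R_opE /R_op_inv.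
  rewrite (one_sided_Kinv cC2 cB2 dE2) (one_sided_Kinv cC1 cB1 dE1).
  exact: mul_op_A0C0.
- apply/funext => u; rewrite /= R_opE /R_op_inv mul_op_C0A0.
  rewrite (one_sided_invK cC1 cB1 dE1); exact: (one_sided_invK cC2 cB2 dE2).
Qed.

Let Q u := P1 (S2 u).

Let QE u : Q u = mul_op (fun k => C1 k *m invmx (symE true C1 B1 (oc true k)))
  (avg_op true (mul_op (fun k => B1 k *m C2 k) (avg_op false (mul_op B2 u)))).
Proof.
by rewrite -(mul_op_mul _ (mx_continuous_Linf cB1) (mx_continuous_Linf cC2)).
Qed.

Let cF1 : mx_continuous (fun k => C1 k *m invmx (symE true C1 B1 (oc true k))).
Proof. exact: mx_continuousM cC1 (mx_continuous_invsymE cC1 cB1 dE1). Qed.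
Let cF2 : mx_continuous (fun k => C2 k *m invmx (symE false C2 B2 (oc false k))).
Proof. exact: mx_continuousM cC2 (mx_continuous_invsymE cC2 cB2 dE2). Qed.
Let cG : mx_continuous (fun k => B1 k *m C2 k).
Proof. exact: mx_continuousM. Qed.

Lemma kernel_op_sym u :
  kernel_op (fun k k' => symD2 A0 A1 A2 B1 B2 k k' - symD1 A0 A1 A2 B1 B2 k k') u =
  P2 (Q u) - Q u.
Proof.
rewrite QE; apply: (eq_trans _ (kernel_op_D2_D1 cF1 cG cF2 cB2 u)).
have e1 : symD1 A0 A1 A2 B1 B2 = fun k k' : R * R =>
    C1 k *m invmx (symE true C1 B1 (oc true k)) *m
    (B1 (k'.1, k.2) *m C2 (k'.1, k.2)) *m B2 k'.
  by apply/funext => k; apply/funext => k'; rewrite mulmxA.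
by rewrite /symD2 e1.
Qed.

(** The kernel operator is [P2 Q - Q], and the middle factors of [Q] are two
    averages in different directions. *)
Lemma compact_kernel_op : compact_map
  (kernel_op (fun k k' => symD2 A0 A1 A2 B1 B2 k k' - symD1 A0 A1 A2 B1 B2 k k')).
Proof.
rewrite (_ : kernel_op _ = (P2 \- idfun) \o
  (mul_op (fun k => C1 k *m invmx (symE true C1 B1 (oc true k))) \o
   (@avg_op R true M1 \o mul_op (fun k => B1 k *m C2 k) \o @avg_op R false M2) \o
   mul_op B2)); last first.
  by apply/funext => u; rewrite kernel_op_sym QE.
apply: compact_map_compl; first exact: (blinB bP2 (@blin_id R M)).
apply: compact_map_compr; last exact/blin_mul_op/mx_continuous_Linf.
apply: compact_map_compl; first exact/blin_mul_op/mx_continuous_Linf.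
exact: compact_avg_mul_avg.
Qed.

Lemma compact_K1_op : compact_op K1.
Proof.
apply: (@compact_mapD _ _ _ _ (RR \o K)); first exact: compact_kernel_op.
exact: compact_map_compl blin_R_op cK.
Qed.

(** Multiplication by [C0] turns [A - K] into [1 + S1 + S2]. As [1 - P1] inverts
    [1 + S1], it leaves [1 + S2 - P1 S2]; as [1 - P2] inverts [1 + S2], it leaves
    [1 - Q + P2 Q] with [Q = P1 S2], which is [1] plus the kernel operator. *)
Lemma R_op_regularizes (A : L2 R M -> L2 R M) :
  (forall u, A u = mul_op A0 u + mul_op A1 (avg1 (mul_op B1 u)) +
    mul_op A2 (avg2 (mul_op B2 u)) + K u) ->
  RR \o A = idfun \+ K1.
Proof.
move=> AE; apply/funext => u.
have key : RR (mul_op A0 u + mul_op A1 (avg1 (mul_op B1 u)) +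
    mul_op A2 (avg2 (mul_op B2 u))) = u + (P2 (Q u) - Q u).
  have -> : mul_op A1 (avg1 (mul_op B1 u)) = mul_op A0 (S1 u).
    by rewrite (mul_op_invmx_one_sided true B1 u cA0 cA1 detE0).
  have -> : mul_op A2 (avg2 (mul_op B2 u)) = mul_op A0 (S2 u).
    by rewrite (mul_op_invmx_one_sided false B2 u cA0 cA2 detE0).
  rewrite -!(blin_addE _ _ bA0) R_opE mul_op_C0A0 (blin_addE _ _ bP1).
  have e : u + S1 u + S2 u - (P1 (u + S1 u) + P1 (S2 u)) = u + S2 u - Q u.
    rewrite opprD addrACA (one_sided_invK cC1 cB1 dE1).
    by rewrite addrA.
  rewrite e (blin_subE _ _ bP2).
  move: (one_sided_invK cC2 cB2 dE2 u : u + S2 u - P2 (u + S2 u) = u).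
  move: (S2 u) (Q u) (P2 (Q u)) (P2 (u + S2 u)) => s q p x h.
  by rewrite opprB [p - x]addrC addrACA h [- q + p]addrC.
apply: (eq_trans (congr1 RR (AE u))).
apply: (eq_trans (blin_addE _ _ blin_R_op)).
apply: (eq_trans (congr1 (fun x => x + RR (K u)) key)).
apply: (eq_trans (Logic.eq_sym (addrA u (P2 (Q u) - Q u) (RR (K u))))).
exact: (congr1 (fun x => u + (x + RR (K u))) (Logic.eq_sym (kernel_op_sym u))).
Qed.

Lemma opalg_R_op (M_gt0 : (0 < M)%N) (X : set (L2 R M -> L2 R M)) :
  @bounded_subalgebra C (L2 R M) X -> @opalg_generators R M `<=` X -> X RR.
Proof.
move=> aX gX; have [_ _ _ XM] := aX.
have Xid := subalgebra_id gX.
have XP2 := subalgebra_one_sided aX gX false M_gt0 cF2 cB2.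
have XP1 := subalgebra_one_sided aX gX true M_gt0 cF1 cB1.
exact: (XM _ _ (XM _ _ (subalgebraB aX Xid XP2) (subalgebraB aX Xid XP1))
  (subalgebra_mul_op gX cC0)).
Qed.

End Regularizer.

Theorem theorem1p4 (R : realType) (M M1 M2 : nat)
    (M_gt0 : (0 < M)%N) (M1_gt0 : (0 < M1)%N) (M2_gt0 : (0 < M2)%N)
    (A0 : R * R -> 'M[R[i]]_M)
    (A1 : R * R -> 'M[R[i]]_(M, M1)) (A2 : R * R -> 'M[R[i]]_(M, M2))
    (B1 : R * R -> 'M[R[i]]_(M1, M)) (B2 : R * R -> 'M[R[i]]_(M2, M))
    (K A : L2 R M -> L2 R M)
    (A0_cont : mx_continuous A0)
    (A1_cont : mx_continuous A1) (A2_cont : mx_continuous A2)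
    (B1_cont : mx_continuous B1) (B2_cont : mx_continuous B2)
    (K_compact : compact_op K)
    (A_alg : opalg A)
    (A_form : forall u : L2 R M,
       A u = mul_op A0 u + mul_op A1 (avg1 (mul_op B1 u))
                         + mul_op A2 (avg2 (mul_op B2 u)) + K u) :
  let E0 := symE0 A0 in
  let E1 := symE1 A0 A1 B1 in
  let E2 := symE2 A0 A2 B2 in
  let K1 := K1_op A0 A1 A2 B1 B2 K in
  let detE_neq0 :=
    [/\ forall k, square k -> \det (E0 k) != 0,
        forall k2, unit_itv k2 -> \det (E1 k2) != 0 &
        forall k1, unit_itv k1 -> \det (E2 k1) != 0] in
  [/\ invertible_op A <-> detE_neq0 /\ invertible_op (idfun \+ K1),
      detE_neq0 -> compact_op K1 &
      forall Ainv K1inv : L2 R M -> L2 R M,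
        inverse_op A Ainv -> inverse_op (idfun \+ K1) K1inv ->
        opalg Ainv /\
        Ainv = (idfun \- (K1 \o K1inv)) \o R_op A0 A1 A2 B1 B2].
Proof.
move=> E0 E1 E2 K1 detE_neq0.
have inv_det S : inverse_op A S -> detE_neq0.
  move=> AS; have [c c0 cA] := inverse_op_bounded_below AS.
  have d0 := det_A0_neq0 A0_cont A1_cont B1_cont A2_cont B2_cont K_compact A_form c0 cA.
  split; first exact: d0.
  - exact: (det_symE_neq0 (b := true) A0_cont A1_cont B1_cont A2_cont B2_cont
      K_compact d0 A_form c0 cA).
  - apply: (det_symE_neq0 (b := false) A0_cont A2_cont B2_cont A1_cont B1_cont
      K_compact d0 _ c0 cA).
    by move=> u; rewrite A_form -[_ + mul_op A1 _ + _]addrAC.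
pose RR := R_op A0 A1 A2 B1 B2; pose RRinv := R_op_inv A0 A1 A2 B1 B2.
have RRi : detE_neq0 -> inverse_op RR RRinv.
  by move=> [d0 d1 d2]; exact: inverse_R_op.
have RA : detE_neq0 -> RR \o A = idfun \+ K1.
  by move=> [d0 d1 d2]; exact: R_op_regularizes.
have A_fac : detE_neq0 -> A = RRinv \o (idfun \+ K1).
  move=> dE; rewrite -(RA dE); apply/funext => u.
  by have [_ _ h _] := RRi dE; exact: (congr1 (fun f => f (A u)) (Logic.eq_sym h)).
have inv_A L : detE_neq0 -> inverse_op (idfun \+ K1) L -> inverse_op A (L \o RR).
  move=> dE hL; rewrite (A_fac dE).
  exact: inverse_op_comp (inverse_op_sym (RRi dE)) hL.
have cK1 : detE_neq0 -> compact_op K1.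
  by move=> [d0 d1 d2]; exact: compact_K1_op.
split; [|exact: cK1|].
- split=> [[S AS]|[dE [L hL]]]; last by exists (L \o RR); exact: inv_A.
  have dE := inv_det S AS; split => //; exists (S \o RRinv).
  by rewrite -(RA dE); exact: inverse_op_comp (RRi dE) AS.
- move=> Ainv L AS hL; have dE := inv_det Ainv AS.
  have LE : L = idfun \- (K1 \o L).
    apply/funext => u; have [_ _ _ h] := hL.
    have e : L u + K1 (L u) = u := congr1 (fun f => f u) h.
    apply: (eq_trans _ (congr1 (fun v => v - K1 (L u)) e)).
    by rewrite addrK.
  have AE : Ainv = (idfun \- (K1 \o L)) \o RR.
    by rewrite -LE; exact: inverse_op_unique AS (inv_A L dE hL).
  suff oA : opalg ((idfun \- (K1 \o L)) \o RR).
    by refine (conj _ AE); rewrite AE.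
  move=> X [aX gX].
  have XR : X RR by have [d0 d1 d2] := dE; exact: opalg_R_op.
  have [_ _ _ XM] := aX; apply: (XM _ _ _ XR).
  apply: (subalgebraB aX (subalgebra_id gX)).
  apply: gX; right; right; right.
  apply: (compact_map_compr (cK1 dE)).
  by have [_ /blin_bounded_op] := hL.
Qed.
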